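(* Let $m,\lambda\in\mathscr{M}$ and $\kappa>0$, and let $X$, $X^{\mathrm s}$, $X^{\mathrm i}$ be the Markov processes associated with the Dirichlet forms $(\mathcal{E},\mathcal{F})$, $(\mathcal{E}^{\mathrm s},\mathcal{F}^{\mathrm s})$, $(\mathcal{E}^{\mathrm i},\mathcal{F}^{\mathrm i})$ defined in the context, with generators $\mathcal{L},\mathcal{L}^{\mathrm s},\mathcal{L}^{\mathrm i}$ on $H=L^2(\mathbb{R},m)=L^2(\mathbb{G},m)$. (1) The generator of $X$ is $\mathcal{L}u|_{\mathbb{G}_\pm}=\frac12\frac{d}{dm_\pm}\left(\frac{du_\pm}{d\lambda_\pm}\right)$ with \[ \mathcal{D}(\mathcal{L})=\left\{u\in\mathcal{F}:\frac{du_\pm}{d\lambda_\pm}\ll m_\pm,\ \frac{d}{dm_\pm}\left(\frac{du_\pm}{d\lambda_\pm}\right)\in L^2(\mathbb{G}_\pm,m_\pm),\ \frac{du_\pm}{d\lambda_\pm}(0\pm)=0\right\}. \] (2) The generator of $X^{\mathrm s}$ is $\mathcal{L}^{\mathrm s}u|_{\mathbb{G}_\pm}=\frac12\frac{d}{dm_\pm}\left(\frac{du_\pm}{d\lambda_\pm}\right)$ with \[ \mathcal{D}(\mathcal{L}^{\mathrm s})=\left\{u\in\mathcal{F}^{\mathrm s}:\frac{du_\pm}{d\lambda_\pm}\ll m_\pm,\ \frac{d}{dm_\pm}\left(\frac{du_\pm}{d\lambda_\pm}\right)\in L^2(\mathbb{G}_\pm,m_\pm),\ \frac{du_\pm}{d\lambda_\pm}(0\pm)=\frac{\kappa}{2}(u(0+)-u(0-))\right\}.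 \] (3) The generator of $X^{\mathrm i}$ is $\mathcal{L}^{\mathrm i}u=\frac12\frac{d}{dm}\left(\frac{du}{d\lambda}\right)$ with \[ \mathcal{D}(\mathcal{L}^{\mathrm i})=\left\{u\in\mathcal{F}^{\mathrm i}:\frac{du}{d\lambda}\ll m,\ \frac{d}{dm}\left(\frac{du}{d\lambda}\right)\in L^2(\mathbb{R},m)\right\}. \]
   Context: $\mathbb{G}=\mathbb{G}_-\cup\mathbb{G}_+$ with $\mathbb{G}_-=(-\infty,0-]$, $\mathbb{G}_+=[0+,\infty)$, a disjoint union ($0+\ne0-$). $\mathscr{M}$ is the set of fully supported positive Radon measures $\nu$ on $\mathbb{G}$ with $\nu(\{x\})=0$ for all $x$; such $\nu$ is also regarded as a measure on $\mathbb{R}$. For a function $f$ (measure $\nu$) on $\mathbb{G}$, $f_\pm=f|_{\mathbb{G}_\pm}$, $\nu_\pm=\nu|_{\mathbb{G}_\pm}$. Statements with $\pm$ are read once with $+$ and once with $-$ (both required). For an atomless fully supported Radon measure $\nu$ on an interval with (continuous strictly increasing) distribution function $\mathtt{s}$, $f\ll\nu$ means $f=g\circ\mathtt{s}$ for some absolutely continuous function $g$, and $\frac{df}{d\nu}:=g'\circ\mathtt{s}$. $f(\pm\infty):=\lim_{x\to\pm\infty}f(x)$. When $\frac{du_\pm}{d\lambda_\pm}\ll m_\pm$, the function $\frac{du_\pm}{d\lambda_\pm}$ is taken continuous on $\mathbb{G}_\pm$, so its value at $0\pm$ is well defined. Forms: on $L^2(\mathbb{G}_\pm,m_\pm)$,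 \[ \mathcal{F}^\pm=\Big\{f\in L^2(\mathbb{G}_\pm,m_\pm):f\ll\lambda_\pm,\int_{\mathbb{G}_\pm}\Big(\frac{df}{d\lambda_\pm}\Big)^2d\lambda_\pm<\infty,\ f(\pm\infty)=0\text{ if }\lambda_\pm(\mathbb{G}_\pm)<\infty\Big\},\quad \mathcal{E}^\pm(f,g)=\frac12\int_{\mathbb{G}_\pm}\frac{df}{d\lambda_\pm}\frac{dg}{d\lambda_\pm}d\lambda_\pm ; \] $\mathcal{F}=\{f\in L^2(\mathbb{G},m):f_+\in\mathcal{F}^+,f_-\in\mathcal{F}^-\}$, $\mathcal{E}(f,g)=\mathcal{E}^+(f_+,g_+)+\mathcal{E}^-(f_-,g_-)$ ($X$ is the union of reflecting diffusions on $\mathbb{G}_\pm$ with scale function induced by $\lambda_\pm$, speed measure $m_\pm$ and no killing inside); $\mathcal{F}^{\mathrm s}=\mathcal{F}$, $\mathcal{E}^{\mathrm s}(f,g)=\mathcal{E}(f,g)+\frac{\kappa}{4}(f(0+)-f(0-))(g(0+)-g(0-))$ ($X^{\mathrm s}$ is the snapping out Markov process with respect to $X$ and $\frac\kappa2(\delta_{\{0+\}}+\delta_{\{0-\}})$); \[ \mathcal{F}^{\mathrm i}=\Big\{f\in L^2(\mathbb{R},m):f\ll\lambda,\int_{\mathbb{R}}\Big(\frac{df}{d\lambda}\Big)^2d\lambda<\infty,\ f(\pm\infty)=0\text{ if }\lambda_\pm(\mathbb{G}_\pm)<\infty\Big\},\quad\mathcal{E}^{\mathrm i}(f,g)=\frac12\int_{\mathbb{R}}\frac{df}{d\lambda}\frac{dg}{d\lambda}d\lambda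 \] ($X^{\mathrm i}$ is the diffusion on $\mathbb{R}$ with scale function induced by $\lambda$, speed measure $m$ and no killing inside). Generator of a Dirichlet form $(\mathcal{A},\mathcal{D}(\mathcal{A}))$ on $H$: $u\in\mathcal{D}(\mathcal{L})$ with $f=\mathcal{L}u\in H$ if and only if $u\in\mathcal{D}(\mathcal{A})$ and $\mathcal{A}(u,v)=(-f,v)_H$ for all $v\in\mathcal{D}(\mathcal{A})$. *)

(* Defs.v *)
From HB Require Import structures.
From mathcomp Require Import all_boot all_order all_algebra.
From mathcomp Require Import all_classical all_reals all_analysis.
Set Implicit Arguments.
Unset Strict Implicit.
Unset Printing Implicit Defensive.
Import Order.TTheory GRing.Theory Num.Theory.
Import numFieldNormedType.Exports.
Local Open Scope classical_set_scope.
Local Open Scope ring_scope.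

Section Space.
Context {R : realType}.

(* G is realised as a subset of [bool * R]: [(true, x)] with [0 <= x] is a
   point of G_+ and [(false, x)] with [x <= 0] a point of G_-; thus
   0+ = (true, 0) and 0- = (false, 0) are distinct.  Values of functions
   outside G are never used. *)
Definition halfline (b : bool) : set R :=
  if b then `[0, +oo[%classic else `]-oo, 0]%classic.

Definition Gspace : set (bool * R) := [set p | halfline p.1 p.2].

Definition zero_pt (b : bool) : bool * R := (b, 0).

Definition restr (b : bool) (f : bool * R -> R) : R -> R := fun x => f (b, x).

Lemma measurable_halfline b : measurable (halfline b).
Proof. by case: b; exact: measurable_itv. Qed.

Lemma measurable_GspaceI b : measurable ([set b] `*` halfline b : set (bool * R)).
Proof. by apply: measurableX => //; exact: measurable_halfline. Qed.

Lemma measurable_Gspace : measurable Gspace.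
Proof.
rewrite (_ : Gspace = ([set true] `*` halfline true)
                  `|` ([set false] `*` halfline false)).
  by apply: measurableU; exact: measurable_GspaceI.
apply/seteqP; split=> [[[] x]|[b x] [] [/= -> ]] //= h; first by left.
by right.
Qed.

Definition atomless_on_G (nu : set (bool * R) -> \bar R) : Prop :=
  forall x, Gspace x -> nu [set x] = 0%E.

(* G is locally compact with a countable base, so every Borel measure that is
   finite on compact sets is regular, i.e. Radon. *)
Definition Radon_on_G (nu : set (bool * R) -> \bar R) : Prop :=
  nu (~` Gspace) = 0%E /\
  forall K, K `<=` Gspace -> compact K -> (nu K < +oo)%E.

Definition fully_supported_on_G (nu : set (bool * R) -> \bar R) : Prop :=
  forall U : set (bool * R), open U -> U `&` Gspace !=set0 ->
  (0 < nu (U `&` Gspace))%E.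

Definition scrM (nu : set (bool * R) -> \bar R) : Prop :=
  [/\ Radon_on_G nu, fully_supported_on_G nu & atomless_on_G nu].

Definition half_measure (nu : {measure set (bool * R) -> \bar R}) (b : bool) :
    set R -> \bar R :=
  pushforward (mrestr nu (measurable_GspaceI b)) snd.

HB.instance Definition _ nu b := Measure.copy (half_measure nu b)
  (measure_function_pushforward__canonical__measure_function_Measure
     (mrestr nu (measurable_GspaceI b)) measurable_snd).

Definition line_measure (nu : {measure set (bool * R) -> \bar R}) :
    set R -> \bar R :=
  pushforward (mrestr nu measurable_Gspace) snd.

HB.instance Definition _ nu := Measure.copy (line_measure nu)
  (measure_function_pushforward__canonical__measure_function_Measure
     (mrestr nu measurable_Gspace) measurable_snd).

End Space.

Section AbsoluteContinuity.
Context {R : realType}.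

Definition abs_cont_itv (a b : R) (g : R -> R) : Prop :=
  forall e : R, 0 < e -> exists2 d : R, 0 < d &
  forall (n : nat) (x y : 'I_n -> R),
    (forall i, [/\ a <= x i, x i <= y i & y i <= b]) ->
    trivIset setT (fun i => `]x i, y i[%classic) ->
    \sum_i (y i - x i) < d -> \sum_i `|g (y i) - g (x i)| < e.

(* On an interval [J] that need not be compact, absolute continuity is required
   on every compact subinterval of [J]. *)
Definition abs_cont (J : set R) (g : R -> R) : Prop :=
  forall a b : R, `[a, b]%classic `<=` J -> abs_cont_itv a b g.

(* The distribution function of [nu], normalised to vanish at 0; for the
   measures used here (atomless and finite on compact sets) it is also the
   scale function induced by [nu]. *)
Definition distr_fun (nu : set R -> \bar R) (x : R) : R :=
  if 0 <= x then fine (nu `]0, x]%classic) else - fine (nu `]x, 0]%classic).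

Definition factors_through (D : set R) (nu : set R -> \bar R) (f : R -> R)
    (g : R -> R) : Prop :=
  abs_cont (distr_fun nu @` D) g /\ forall x, D x -> f x = g (distr_fun nu x).

(* [f << nu] *)
Definition ll (D : set R) (nu : set R -> \bar R) (f : R -> R) : Prop :=
  exists g, factors_through D nu f g.

(* [df / dnu]: two admissible choices of [g] coincide on [distr_fun nu @` D],
   hence the value does not depend on the choice except possibly at an endpoint
   of [D]. *)
Definition dd (D : set R) (nu : set R -> \bar R) (f : R -> R) : R -> R :=
  derive1 (xget (cst 0) [set g | factors_through D nu f g]) \o distr_fun nu.

(* [w] is a version of [df / dlam] with [w << m]; such a [w] is continuous on
   [D], and unique there when [lam] has full support. *)
Definition is_dd_version (D : set R) (lam : {measure set R -> \bar R})
    (m : set R -> \bar R) (f w : R -> R) : Prop :=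
  w = dd D lam f %[ae lam in D] /\ ll D m w.

Definition dd_ll (D : set R) (lam : {measure set R -> \bar R})
    (m : set R -> \bar R) (f : R -> R) : Prop :=
  exists w, is_dd_version D lam m f w.

(* The continuous version of [df / dlam]; junk unless [dd_ll] holds. *)
Definition cdd (D : set R) (lam : {measure set R -> \bar R})
    (m : set R -> \bar R) (f : R -> R) : R -> R :=
  xget (dd D lam f) [set w | is_dd_version D lam m f w].

Definition ddd (D : set R) (lam : {measure set R -> \bar R})
    (m : set R -> \bar R) (f : R -> R) : R -> R :=
  dd D m (cdd D lam m f).

End AbsoluteContinuity.

Section Generator.
Context {R : realType} {d : measure_display} {T : measurableType d}.

Definition L2 (mu : {measure set T -> \bar R}) (D : set T) : set (T -> R) :=
  [set f | f \_ D \in Lfun mu 2%:E].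

(* [(u, f)] is in the graph of the generator of the form [(A, dom)] on
   [L2 mu D]. *)
Definition generates (mu : {measure set T -> \bar R}) (D : set T)
    (dom : set (T -> R)) (A : (T -> R) -> (T -> R) -> R) (u f : T -> R) :
    Prop :=
  [/\ L2 mu D f, dom u &
      forall v, dom v -> A u v = \int[mu]_(x in D) (- f x * v x)].

Definition generator_dom (mu : {measure set T -> \bar R}) (D : set T)
    (dom : set (T -> R)) (A : (T -> R) -> (T -> R) -> R) : set (T -> R) :=
  [set u | exists f, generates mu D dom A u f].

End Generator.

Section Forms.
Context {R : realType}.
Implicit Types (m lam : {measure set (bool * R) -> \bar R}).

Definition infty (b : bool) : set_system R :=
  if b then pinfty_nbhs R else ninfty_nbhs R.

Definition vanishes_at_infty lam (b : bool) (f : R -> R) : Prop :=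
  (half_measure lam b (halfline b) < +oo)%E -> f @ infty b --> (0 : R).

Definition finite_energy (D : set R) (nu : {measure set R -> \bar R})
    (f : R -> R) : Prop :=
  (\int[nu]_(x in D) ((dd D nu f x) ^+ 2)%:E < +oo)%E.

Definition energy (D : set R) (nu : {measure set R -> \bar R})
    (f g : R -> R) : R :=
  2^-1 * \int[nu]_(x in D) (dd D nu f x * dd D nu g x).

Definition F_half m lam (b : bool) : set (R -> R) :=
  [set f | [/\ L2 (half_measure m b) (halfline b) f,
               ll (halfline b) (half_measure lam b) f,
               finite_energy (halfline b) (half_measure lam b) f &
               vanishes_at_infty lam b f]].

Definition E_half lam (b : bool) (f g : R -> R) : R :=
  energy (halfline b) (half_measure lam b) f g.

Definition F_X m lam : set (bool * R -> R) :=
  [set f | L2 m Gspace f /\ forall b, F_half m lam b (restr b f)].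

Definition E_X lam (f g : bool * R -> R) : R :=
  E_half lam true (restr true f) (restr true g) +
  E_half lam false (restr false f) (restr false g).

Definition jump (f : bool * R -> R) : R :=
  f (zero_pt true) - f (zero_pt false).

Definition F_s m lam : set (bool * R -> R) := F_X m lam.

Definition E_s lam (kappa : R) (f g : bool * R -> R) : R :=
  E_X lam f g + kappa / 4 * jump f * jump g.

Definition F_i m lam : set (R -> R) :=
  [set f | [/\ L2 (line_measure m) setT f,
               ll setT (line_measure lam) f,
               finite_energy setT (line_measure lam) f &
               forall b, vanishes_at_infty lam b f]].

Definition E_i lam (f g : R -> R) : R := energy setT (line_measure lam) f g.

Definition cdd_half m lam (b : bool) (u : bool * R -> R) : R -> R :=
  cdd (halfline b) (half_measure lam b) (half_measure m b) (restr b u).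

Definition ddd_half m lam (b : bool) (u : bool * R -> R) : R -> R :=
  ddd (halfline b) (half_measure lam b) (half_measure m b) (restr b u).

Definition dd_half_ll m lam (b : bool) (u : bool * R -> R) : Prop :=
  dd_ll (halfline b) (half_measure lam b) (half_measure m b) (restr b u).

End Forms.

(* Main.v *)
Require Import Defs.
From HB Require Import structures.
From mathcomp Require Import all_boot all_order all_algebra.
From mathcomp Require Import all_classical all_reals all_analysis.
From mathcomp Require Import measurable_realfun ring lra.
Set Implicit Arguments.
Unset Strict Implicit.
Unset Printing Implicit Defensive.
Import Order.TTheory GRing.Theory Num.Theory.
Import numFieldNormedType.Exports.
Local Open Scope classical_set_scope.
Local Open Scope ring_scope.

(** The three assertions are one computation in two settings: the two closed
    half-lines coupled at the origin by a jump term with constant [kappa] (the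
    reflecting case is [kappa = 0]), and the whole line.

    The definitions of [f << nu] and [df/dnu] go through a function [g] with
    [f = g o s], [s] the distribution function of [nu]. They are first
    replaced by an integral description: [primitive D nu f phi] says that
    [f y - f x] is the integral of [phi] over (x, y] for all x <= y in [D].
    That [f << nu] gives a primitive with density [df/dnu] ([ll_dd]) rests on
    the fundamental theorem of calculus for absolutely continuous functions
    ([abs_cont_FTC]): such a function is a difference of nondecreasing
    absolutely continuous ones, the Stieltjes measure of each of these is
    dominated by Lebesgue measure, and Radon-Nikodym and the Lebesgue
    differentiation theorem apply. The identity for [g] is then transported
    by [s], which carries [nu] to Lebesgue measure ([integral_distr_fun]). The
    converse is [primitive_ll], and densities are unique almost everywhere
    ([primitive_unique]). Consequently, if a primitive [w] of [h] with respect
    to [m] is a version of [du/dlam], then [w] is its continuous version and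
    [h] is [d/dm (du/dlam)] ([primitive_cdd]).

    The functions described in the theorem belong to the domain of the
    generator because of Green's formula on a half-line ([green_halfline]):
    with [w = du/dlam] and [h = dw/dm], the sum of the integrals of [w dv/dlam]
    with respect to [lam] and of [h v] with respect to [m] is the boundary term
    [-+ w(0) v(0)]. On compact intervals this is integration by parts, a case
    of Fubini's theorem ([primitive_by_parts]). The point is that no boundary
    term arises at infinity ([boundary_by_parts]). The product [w v] has a
    limit there; if the limit were nonzero, then far out [dv/dlam / v], which
    is [w dv/dlam] divided by [w v], would be integrable with small integral,
    so that [v] would be almost constant and nonzero. This contradicts
    [v -> 0] when [lam] is finite, and makes [w] bounded away from zero, hence
    not square integrable, when [lam] is infinite. The boundary terms at the
    origin cancel against the jump term, or against each other on the line.

    Conversely, let [u] be in the domain of the generator with image [f]. The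
    form identity is tested against ramps, the functions whose [lam]-density is
    the indicator of (x, y], shifted so as to have compact support; on the
    line a multiple of the ramp of (0, 1] is subtracted for that purpose. It
    follows that [du/dlam] and the primitive of [2 f] with respect to [m] differ
    by a constant almost everywhere ([weak_solution]). On a half-line the test
    function need not vanish at the origin and the constant is identified with
    the boundary value [kappa / 2 (u(0+) - u(0-))]. *)

(** * Absolute continuity and total variation *)

Section AbsContVariation.
Context {R : realType}.
Implicit Types (a b : R) (g : R -> R) (p q : R * R) (s : seq (R * R)).

(** The pair [p] stands for the interval [[p.1, p.2]], here inside [[a, b]]. *)
Definition subseg a b p := [&& a <= p.1, p.1 <= p.2 & p.2 <= b].

Definition nonoverlap p q := (p.2 <= q.1) || (q.2 <= p.1).

(** A finite family of intervals inside [[a, b]] with disjoint interiors. *)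
Definition nonoverlapping a b s := all (subseg a b) s && pairwise nonoverlap s.

Definition total_length s := \sum_(p <- s) (p.2 - p.1).

Lemma abs_cont_itv_seq a b g : abs_cont_itv a b g ->
  forall e : R, 0 < e -> exists2 d : R, 0 < d &
  forall s, nonoverlapping a b s -> total_length s < d ->
    \sum_(p <- s) `|g p.2 - g p.1| < e.
Proof.
move=> acg e e0; have [d d0 H] := acg e e0.
exists d => // s /andP[sok snon] sd.
pose x (i : 'I_(size s)) := (nth (0, 0) s i).1.
pose y (i : 'I_(size s)) := (nth (0, 0) s i).2.
have hE (F : R * R -> R) :
    \sum_(p <- s) F p = \sum_(i < size s) F (nth (0, 0) s i).
  by rewrite (big_nth (0, 0)) big_mkord.
rewrite hE; apply: (H _ x y).
- by move=> i; have := all_nthP (0,0) sok i (ltn_ord i) => /and3P[].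
- apply/trivIsetP => i j _ _ ij; apply/seteqP; split=> // t [] /=.
  rewrite !in_itv/= => /andP[xit tyi] /andP[xjt tyj].
  have key (k l : 'I_(size s)) : (k < l)%N ->
      nonoverlap (nth (0,0) s k) (nth (0,0) s l).
    by move=> kl; exact: (pairwiseP (0,0) snon) (ltn_ord k) (ltn_ord l) kl.
  have : nonoverlap (nth (0,0) s i) (nth (0,0) s j).
    move: ij; rewrite -val_eqE neq_ltn => /orP[/key//|/key].
    by rewrite /nonoverlap orbC.
  rewrite /nonoverlap -/(x i) -/(y i) -/(x j) -/(y j) => /orP[h|h].
    by have := lt_trans xjt tyi; rewrite ltNge h.
  by have := lt_trans xit tyj; rewrite ltNge h.
- by move: sd; rewrite /total_length hE.
Qed.

Lemma nonoverlap_sym p q : nonoverlap p q = nonoverlap q p.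
Proof. by rewrite /nonoverlap orbC. Qed.

(** The consecutive subintervals cut out by the partition [l] of [[x, _]]. *)
Definition pieces (x : R) (l : seq R) := pairmap (fun u v => (u, v)) x l.

Lemma pieces_subseg x y l : itv_partition x y l -> all (subseg x y) (pieces x l).
Proof.
move=> [+ /eqP]; elim: l x => //= z l ih x /andP[xz pl] zy.
have := ih _ pl zy => hall.
have zley : z <= y by rewrite -zy; elim: l z pl {ih xz zy hall} => //= w l ih z /andP[zw /ih]; apply: le_trans; exact: ltW.
rewrite /subseg/= lexx ltW//= zley/=.
by apply: sub_all hall => -[u v] /and3P[/= zu uv vy]; rewrite uv vy !andbT (le_trans (ltW xz)).
Qed.

Lemma pieces_nonoverlap x y l : itv_partition x y l -> pairwise nonoverlap (pieces x l).
Proof.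
elim: l x => //= z l ih x hl; have hl' := itv_partition_cons hl.
rewrite ih// andbT.
by apply: sub_all (pieces_subseg hl') => -[u v] /and3P[/= zu _ _]; rewrite /nonoverlap/= zu.
Qed.

Lemma pieces_length x y l : itv_partition x y l -> total_length (pieces x l) = y - x.
Proof.
rewrite /total_length; elim: l x => [x /itv_partition_nil ->|z l ih x hl] /=.
  by rewrite big_nil subrr.
by rewrite big_cons (ih _ (itv_partition_cons hl))/= addrC subrKA.
Qed.

Lemma pieces_variation x y g l : itv_partition x y l ->
  variation x y g l = \sum_(p <- pieces x l) `|g p.2 - g p.1|.
Proof.
elim: l x => [x _|z l ih x hl] /=; first by rewrite /variation/= big_geq// big_nil.
rewrite big_cons -(ih _ (itv_partition_cons hl)).
by rewrite /variation/= big_nat_recl.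
Qed.

Lemma subseg_trans a b p q : subseg a b p -> subseg p.1 p.2 q -> subseg a b q.
Proof.
move=> /and3P[ap pp pb] /and3P[pq qq qp]; rewrite /subseg qq (le_trans ap pq).
by rewrite (le_trans qp pb).
Qed.

Lemma subseg_nonoverlap p q r : subseg p.1 p.2 q -> nonoverlap p r -> nonoverlap q r.
Proof.
move=> /and3P[pq qq qp] /orP[h|h]; rewrite /nonoverlap.
  by rewrite (le_trans qp h).
by rewrite (le_trans h pq) orbT.
Qed.

Lemma nonoverlapping_refine a b p L s l : itv_partition p.1 p.2 l ->
  nonoverlapping a b (p :: L ++ s) -> nonoverlapping a b (L ++ pieces p.1 l ++ s).
Proof.
move=> hl; rewrite /nonoverlapping/= !all_cat !pairwise_cat allrel_catr.
move=> /andP[/andP[pab /andP[aL as_]]].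
move=> /andP[/andP[pL ps] /and3P[Ls LL ss]].
have hp := pieces_subseg hl.
rewrite aL as_ LL ss (pieces_nonoverlap hl) Ls !andbT/=.
have -> /= : all (subseg a b) (pieces p.1 l).
  by apply: sub_all hp => q; exact: subseg_trans pab.
apply/andP; split; apply/allrelP => u v.
  move=> uL /(allP hp) vp; rewrite nonoverlap_sym.
  exact: subseg_nonoverlap vp (allP pL _ uL).
move=> /(allP hp) up vs; exact: subseg_nonoverlap up (allP ps _ vs).
Qed.

Lemma total_length_refine p L s l : itv_partition p.1 p.2 l ->
  total_length (L ++ pieces p.1 l ++ s) = total_length (p :: L ++ s).
Proof.
move=> hl; have := pieces_length hl; rewrite /total_length !(big_cat, big_cons)/= => ->.
by rewrite addrCA.
Qed.

(** Intervals can be traded one at a time for their total variation: replace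
    the first interval by an arbitrary partition and take the supremum. *)
Lemma total_variation_sum_le a b g (e d : R) :
  (forall s, nonoverlapping a b s -> total_length s < d ->
    \sum_(p <- s) `|g p.2 - g p.1| < e) ->
  forall s, nonoverlapping a b s -> total_length s < d ->
    (\sum_(p <- s) total_variation p.1 p.2 g <= e%:E)%E.
Proof.
move=> H; suff Q L : forall s, nonoverlapping a b (L ++ s) -> total_length (L ++ s) < d ->
    (\sum_(p <- L) total_variation p.1 p.2 g <=
     (e - \sum_(p <- s) `|g p.2 - g p.1|)%:E)%E.
  move=> s ss sd; have := Q s [::]; rewrite cats0 => /(_ ss sd).
  by rewrite big_nil subr0.
elim: L => [s ss sd|p L ih s ss sd].
  by rewrite big_nil lee_fin subr_ge0 ltW// H.
have pp : p.1 <= p.2 by move: ss; rewrite /nonoverlapping/= => /andP[/andP[/and3P[]]].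
rewrite big_cons -leeBrDr; last first.
  rewrite ge0_fin_numE; last first.
    rewrite big_seq; apply: sume_ge0 => q qL; apply: total_variation_ge0.
    by move: ss => /andP[/allP/(_ q)]; rewrite inE mem_cat qL orbT => /(_ isT) /and3P[].
  have hl : exists l, itv_partition p.1 p.2 l.
    move: pp; rewrite le_eqVlt => /predU1P[->|pp]; first by exists [::]; split => /=.
    by exists [:: p.2]; exact: itv_partition1.
  case: hl => l hl.
  have := ih (pieces p.1 l ++ s); rewrite total_length_refine// => /(_ (nonoverlapping_refine hl ss) sd).
  by move=> /le_lt_trans; apply; rewrite ltry.
(* It suffices to bound the variation of [g] along each partition [l] of the
   first interval, whose pieces are moved to the list [s]. *)
apply: ub_ereal_sup => _ [_ [l hl <-] <-].
have Lfin : (\sum_(p0 <- L) total_variation p0.1 p0.2 g)%E \is a fin_num.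
  rewrite ge0_fin_numE; last first.
    rewrite big_seq; apply: sume_ge0 => q qL; apply: total_variation_ge0.
    by move: ss => /andP[/allP/(_ q)]; rewrite inE mem_cat qL orbT => /(_ isT) /and3P[].
  have := ih (pieces p.1 l ++ s); rewrite total_length_refine// => /(_ (nonoverlapping_refine hl ss) sd).
  by move=> /le_lt_trans; apply; rewrite ltry.
rewrite leeBrDr// addeC -leeBrDr//.
have := ih (pieces p.1 l ++ s); rewrite total_length_refine// => /(_ (nonoverlapping_refine hl ss) sd).
by rewrite big_cat/= -(pieces_variation _ hl) -EFinB [X in e - X]addrC opprD addrA.
Qed.

End AbsContVariation.

(** * Densities of monotone absolutely continuous functions *)

Section StieltjesContinuous.
Context {R : realType}.
Implicit Types (x y : R).

Lemma lebesgue_stieltjes_measure_ocitv (G : cumulative R R) x y : x <= y ->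
  lebesgue_stieltjes_measure G `]x, y]%classic = (G y - G x)%:E.
Proof.
move=> xy; rewrite /lebesgue_stieltjes_measure /measure_extension.
rewrite measurable_mu_extE; first exact: (wlength_itv_bnd _ false false xy).
by exists (x, y).
Qed.

Lemma lebesgue_stieltjes_measure_set1 (G : cumulative R R) x :
  continuous G -> lebesgue_stieltjes_measure G [set x] = 0%E.
Proof.
move=> cG; apply/eqP; rewrite eq_le measure_ge0 andbT.
apply/lee_addgt0Pr => e e0; rewrite add0e.
have /cvgrPdist_lt/(_ e e0) := cG x.
move=> [d /= d0 hd].
have d2 : 0 < d / 2 by rewrite divr_gt0.
have : (lebesgue_stieltjes_measure G [set x] <=
    lebesgue_stieltjes_measure G `](x - d / 2)%R, x]%classic)%E.
  apply: le_measure; rewrite ?inE; [exact: measurable_set1|exact: measurable_itv|].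
  by move=> _ ->; rewrite /= in_itv/= lexx andbT ltrBlDr ltrDl.
move=> /le_trans; apply.
rewrite lebesgue_stieltjes_measure_ocitv; last by rewrite lerBlDr lerDl ltW.
rewrite lee_fin; apply: le_trans (ler_norm _) _; apply/ltW; apply: hd.
by rewrite /= opprB addrCA subrr addr0 gtr0_norm// ltr_pdivrMr// ltr_pMr// ltr1n.
Qed.

Lemma lebesgue_stieltjes_measure_cc (G : cumulative R R) x y : x <= y ->
  continuous G -> lebesgue_stieltjes_measure G `[x, y]%classic = (G y - G x)%:E.
Proof.
move=> xy cG; rewrite -(@setU1itv _ _ _ _ false)// measureU//=.
- by rewrite lebesgue_stieltjes_measure_set1// add0e lebesgue_stieltjes_measure_ocitv.
- by apply/seteqP; split => // t [/= -> ]; rewrite in_itv/= ltxx.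
Qed.

Lemma lebesgue_stieltjes_measure_oo (G : cumulative R R) x y : x < y ->
  continuous G -> lebesgue_stieltjes_measure G `]x, y[%classic = (G y - G x)%:E.
Proof.
move=> xy cG; rewrite -lebesgue_stieltjes_measure_ocitv ?ltW//.
rewrite -(@setUitv1 _ _ (BRight x) y true)//= measureU//=.
- by rewrite lebesgue_stieltjes_measure_set1// adde0.
- by apply/seteqP; split => // t []/= /[swap] ->; rewrite in_itv/= ltxx andbF.
Qed.

End StieltjesContinuous.

Section MonotoneDensity.
Context {R : realType}.
Implicit Types (a b : R) (F : R -> R).

(** [F] has the absolute continuity property on [[a, b]], phrased with finite
    sequences of non-overlapping intervals. *)
Definition abs_cont_seq a b F := forall e : R, 0 < e -> exists2 d : R, 0 < d &
  forall s, nonoverlapping a b s -> total_length s < d ->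
    \sum_(p <- s) `|F p.2 - F p.1| < e.

(** The projection of the line onto [[a, b]], for [a <= b]. *)
Definition clamp a b x : R := Num.min (Num.max a x) b.

Lemma clamp_id a b x : a <= x <= b -> clamp a b x = x.
Proof. by move=> /andP[ax xb]; rewrite /clamp (max_idPr ax) (min_idPl xb). Qed.

Lemma clamp_in a b x : a <= b -> a <= clamp a b x <= b.
Proof. by move=> ab; rewrite /clamp le_min ge_min le_max !lexx ab orbT. Qed.

Lemma clamp_nd a b : nondecreasing (clamp a b).
Proof.
move=> x y xy; rewrite /clamp le_min !ge_min lexx orbT andbT.
by apply/orP; left; rewrite ge_max !le_max lexx xy orbT.
Qed.

Lemma clamp_dist a b x y : x <= y -> clamp a b y - clamp a b x <= y - x.
Proof.
rewrite /clamp => xy; case: (leP a x) => ?; case: (leP a y) => ?;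
case: (leP x b) => ?; case: (leP y b) => ?; case: (leP a b) => ?; lra.
Qed.

Lemma clamp_le a b x : x <= a -> a <= b -> clamp a b x = a.
Proof. by move=> xa ab; rewrite /clamp (max_idPl xa) (min_idPl ab). Qed.

Lemma clamp_ge a b x : b <= x -> a <= b -> clamp a b x = b.
Proof. by move=> bx ab; rewrite /clamp (max_idPr (le_trans ab bx)) (min_idPr bx). Qed.

(** An open interval inside [[a, b]] is sandwiched between an open and a closed
    interval with the same endpoints; the pair [(a, a)] serves for the empty
    one. *)
Lemma open_interval_endpoints (a b : R) (J : set R) : a <= b -> open J ->
  is_interval J -> J `<=` `[a, b] ->
  exists p : R * R, [/\ subseg a b p, J `<=` `[p.1, p.2],
    `]p.1, p.2[ `<=` J & p = (a, a) \/ p.1 < p.2].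
Proof.
move=> ab oJ iJ Jab; have [->|/set0P J0] := eqVneq J set0.
  exists (a, a); split => //=; last by left.
    by rewrite /subseg/= lexx ab.
  by move=> t /=; rewrite in_itv/= => /andP[at_ /(lt_trans at_)]; rewrite ltxx.
have hl : has_lbound J by exists a => t /Jab; rewrite /= in_itv/= => /andP[].
have hu : has_ubound J by exists b => t /Jab; rewrite /= in_itv/= => /andP[].
have ai : a <= inf J.
  by apply: lb_le_inf => // t /Jab; rewrite /= in_itv/= => /andP[].
have sb : sup J <= b.
  by apply: ge_sup => // t /Jab; rewrite /= in_itv/= => /andP[].
have Jis : J `<=` `[inf J, sup J].
  move=> t Jt; rewrite /= in_itv/=; apply/andP; split.
    exact: ge_inf.
  exact: ub_le_sup.
have lt_is : inf J < sup J.
  case: J0 => t Jt; have /= := oJ; rewrite openE => /(_ _ Jt) [e /= e0 he].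
  have te : J (t + e / 2).
    by apply: he; rewrite /ball/= opprD addNKr normrN gtr0_norm ?ltr_pdivrMr ?ltr_pMr ?ltr1n// divr_gt0.
  have := Jis _ Jt; have := Jis _ te; rewrite /= !in_itv/= => /andP[_ h1] /andP[h2 _].
  by rewrite (le_lt_trans h2)// (lt_le_trans _ h1)// ltrDl divr_gt0.
exists (inf J, sup J); split => //=; last by right.
  by rewrite /subseg/= ai sb (ltW lt_is).
move=> t /=; rewrite in_itv/= => /andP[it ts].
have /(inf_lt J0)[u Ju ut] := it.
have /(sup_gt J0)[v Jv tv] := ts.
by apply: (iJ u v) => //; rewrite (ltW ut) (ltW tv).
Qed.

Lemma abs_cont_seq_cont a b F : abs_cont_seq a b F -> a <= b ->
  continuous (F \o clamp a b).
Proof.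
move=> acF ab x; apply/cvgrPdist_lt => e e0.
have [d d0 H] := acF e e0.
exists d => //= y; rewrite /ball_ /= => xyd.
wlog xy : x y xyd / x <= y.
  move=> h; case: (leP x y) => [|/ltW] xy; first exact: h.
  by rewrite distrC; apply: h => //; rewrite distrC.
have := H [:: (clamp a b x, clamp a b y)]; rewrite /nonoverlapping/= /subseg/=.
have /andP[-> _] := clamp_in x ab.
have /andP[_ ->] := clamp_in y ab.
rewrite clamp_nd// /total_length !big_seq1/= distrC; apply => //.
apply: le_lt_trans (clamp_dist _ _ xy) _.
by move: xyd; rewrite distrC ger0_norm// subr_ge0.
Qed.

Lemma nonoverlapping_seq a b (p : nat -> R * R) : a <= b ->
  (forall n, subseg a b (p n)) ->
  (forall n, p n = (a, a) \/ (p n).1 < (p n).2) ->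
  (forall m n, m != n -> `](p m).1, (p m).2[ `&` `](p n).1, (p n).2[ = set0) ->
  forall n, nonoverlapping a b (map p (iota 0 n)).
Proof.
move=> ab ps pd pI n; apply/andP; split.
  by apply/allP => _ /mapP[k _ ->].
rewrite pairwise_map; apply/(pairwiseP 0%N) => i j.
rewrite !inE size_iota => iN jN ij /=; rewrite !nth_iota// !add0n.
have ne : i != j by rewrite neq_ltn ij.
have /and3P[ai _ _] := ps i; have /and3P[aj _ _] := ps j.
case: (pd i) => [->/=|i12]; first by rewrite /nonoverlap aj.
case: (pd j) => [->/=|j12]; first by rewrite /nonoverlap ai orbT.
apply: contraT; rewrite /nonoverlap negb_or -!ltNge => /andP[h1 h2].
pose l := Num.max (p i).1 (p j).1; pose r := Num.min (p i).2 (p j).2.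
have lr : l < r by rewrite /l /r lt_min !gt_max i12 j12 h1 h2.
have : (`](p i).1, (p i).2[ `&` `](p j).1, (p j).2[) ((l + r) / 2).
  have := midf_lt lr => -[m1 m2].
  by move: m1 m2; rewrite /l /r gt_max lt_min => /andP[? ?] /andP[? ?]; split; rewrite /= in_itv/=; apply/andP.
by rewrite pI.
Qed.

End MonotoneDensity.

Section AbsContDensity.
Context {R : realType}.
Implicit Types (a b : R) (F g : R -> R).
Notation leb := (@lebesgue_measure R).

(** The Stieltjes measure of a nondecreasing absolutely continuous function
    vanishes on Lebesgue-null sets: cover such a set by an open set of small
    Lebesgue measure and split the latter into intervals. *)
Lemma abs_cont_seq_stieltjes_small a b F (G : cumulative R R) : a < b ->
  G = F \o clamp a b :> (R -> R) -> {in `[a, b] &, nondecreasing F} ->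
  abs_cont_seq a b F ->
  forall A, measurable A -> leb A = 0%E ->
    lebesgue_stieltjes_measure G (A `&` `]a, b[) = 0%E.
Proof.
move=> ab GE ndF acF A mA A0.
have cG : continuous G by rewrite GE; apply: abs_cont_seq_cont => //; exact: ltW.
apply/eqP; rewrite eq_le measure_ge0 andbT.
apply/lee_addgt0Pr => e e0; rewrite add0e.
have [d d0 H] := acF e e0.
have lebA : (leb A < +oo)%E by rewrite A0 ltry.
have [U [oU AU Ud]] := lebesgue_regularity_outer mA lebA d0.
have {Ud} Ud : (leb U < d%:E)%E.
  apply: le_lt_trans Ud; rewrite -[in leLHS](setDUK AU).
  apply: le_trans (measureU2 _ _ _) _ => //.
    by apply: measurableD => //; exact: measurable_realfun.open_measurable.
  by rewrite [X in (X + _)%E]A0 add0e.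
pose V := U `&` `]a, b[.
have oV : open V by apply: openI => //; exact: interval_open.
pose I := open_disjoint_itv oV.
have IU n : I n `<=` U.
  move=> t It; have : V t by rewrite (open_disjoint_itv_bigcup oV); exists n.
  by case.
have Iab n : I n `<=` `[a, b].
  move=> t It; have : V t by rewrite (open_disjoint_itv_bigcup oV); exists n.
  by move=> [_ h]; move: t h {It}; exact: subset_itv_oo_cc.
have /choice[p hp] : forall n, exists p : R * R, [/\ subseg a b p, I n `<=` `[p.1, p.2],
    `]p.1, p.2[ `<=` I n & p = (a, a) \/ p.1 < p.2].
  move=> n; apply: open_interval_endpoints => //; first exact: ltW.
    exact: open_disjoint_itv_open.
  exact: open_disjoint_itv_is_interval.
have pI m n : m != n -> `](p m).1, (p m).2[ `&` `](p n).1, (p n).2[ = set0.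
  move=> mn; have /trivIsetP/(_ m n Logic.I Logic.I mn) := @open_disjoint_itv_trivIset R V oV.
  apply: subsetI_eq0; [by case: (hp m)|by case: (hp n)].
have ltab : a <= b by exact: ltW.
have valid n : nonoverlapping a b (map p (iota 0 n)).
  by apply: nonoverlapping_seq => // k; case: (hp k).
have len n : total_length (map p (iota 0 n)) < d.
  rewrite -lte_fin; apply: le_lt_trans Ud.
  rewrite /total_length big_map.
  have -> : (\sum_(j <- iota 0 n) ((p j).2 - (p j).1))%:E =
     (\sum_(j < n) leb `](p j).1, (p j).2[)%E.
    rewrite -sumEFin -(big_mkord xpredT (fun j => leb `](p j).1, (p j).2[)) /index_iota subn0.
    apply: eq_bigr => j _; rewrite lebesgue_measure_itv/= lte_fin.
    case: ltP => // h; have /and3P[_ h' _] : subseg a b (p j) by case: (hp j).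
    by have -> : (p j).1 = (p j).2 by [apply/eqP; rewrite eq_le h h']; rewrite subrr.
  rewrite -(@measure_bigsetU _ _ _ leb (fun j => `](p j).1, (p j).2[%classic))//; last by apply/trivIsetP => i j _ _; exact: pI.
  apply: le_measure; rewrite ?inE.
  - exact: bigsetU_measurable.
  - exact: measurable_realfun.open_measurable.
  - rewrite -(bigcup_mkord n (fun j => `](p j).1, (p j).2[%classic)); apply: bigcup_sub => j _.
    by apply: subset_trans (IU j); case: (hp j).
apply: (@le_trans _ _ (lebesgue_stieltjes_measure G V)).
  apply: le_measure; rewrite ?inE.
  - by apply: measurableI => //; exact: measurable_itv.
  - exact: measurable_realfun.open_measurable.
  - exact: setSI.
rewrite (open_disjoint_itv_bigcup oV) measure_bigcup//; last first.
- exact: (@open_disjoint_itv_trivIset R V oV).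
- by move=> i _; apply: measurable_realfun.open_measurable; exact: open_disjoint_itv_open.
apply: lime_le; first by apply: is_cvg_nneseries => *; exact: measure_ge0.
near=> n.
apply: (@le_trans _ _ (\sum_(j <- map p (iota 0 n)) `|F j.2 - F j.1|)%:E); last first.
  by rewrite lee_fin ltW// H.
rewrite big_map -sumEFin /index_iota subn0 big_mkcond/=.
apply: lee_sum => j _.
rewrite in_setT.
have [pab Ip _ _] := hp j.
have /and3P[ap pp pb] := pab.
apply: (@le_trans _ _ (lebesgue_stieltjes_measure G `[(p j).1, (p j).2])).
  apply: le_measure; rewrite ?inE//.
  by apply: measurable_realfun.open_measurable; exact: open_disjoint_itv_open.
rewrite lebesgue_stieltjes_measure_cc// lee_fin GE /=.
by rewrite !clamp_id ?ler_norm ?ap ?pb ?(le_trans ap pp) ?(le_trans pp pb).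
Unshelve. all: by end_near. Qed.

Lemma monotone_abs_cont_density a b F : a < b -> {in `[a, b] &, nondecreasing F} ->
  abs_cont_seq a b F ->
  exists2 phi : R -> R, leb.-integrable setT (EFin \o phi) &
    forall x, a <= x <= b -> F x - F a = \int[leb]_(t in `]a, x]) phi t.
Proof.
move=> ab ndF acF; have leab := ltW ab.
have ndG : nondecreasing (F \o clamp a b).
  by move=> x y xy; apply: ndF; rewrite ?in_itv/= ?clamp_in// clamp_nd.
have cG := abs_cont_seq_cont acF leab.
have rcG : right_continuous (F \o clamp a b) by exact: right_continuousW.
pose G : cumulative R R := HB.pack (F \o clamp a b)
  (isCumulative.Build R _ R (F \o clamp a b) ndG rcG).
have mab : measurable (`]a, b[%classic : set R) by exact: measurable_itv.
have Gfin : (lebesgue_stieltjes_measure G `]a, b[%classic < +oo)%E.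
  by rewrite lebesgue_stieltjes_measure_oo// ltry.
pose nu : {finite_measure set (measurableTypeR R) -> \bar R} :=
  @mfrestr _ (measurableTypeR R) R _ (lebesgue_stieltjes_measure G) mab Gfin.
have nuleb : nu `<< leb.
  apply/null_content_dominatesP => A mA A0.
  rewrite /nu/= /mfrestr /mrestr.
  exact: (abs_cont_seq_stieltjes_small ab _ ndF).
have [phi [phi0 phifin iphi phiE]] := radon_nikodym_sigma_finite nuleb.
exists (fine \o phi).
  by apply: eq_integrable iphi => // x _; rewrite /= fineK.
move=> x /andP[ax xb].
have -> : F x - F a = fine (nu `]a, x]%classic).
  rewrite /nu/= /mfrestr /mrestr.
  have [xltb|bx] := ltP x b.
    rewrite setIidl; last first.
      by move=> t /=; rewrite !in_itv/= => /andP[->]/= /le_lt_trans; apply.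
    by rewrite lebesgue_stieltjes_measure_ocitv//= !clamp_id ?lexx ?ax ?xb ?leab.
  have -> : x = b by apply/eqP; rewrite eq_le xb bx.
  rewrite setIidr; last exact: subset_itv_oo_oc.
  by rewrite lebesgue_stieltjes_measure_oo//= !clamp_id ?lexx ?leab.
rewrite phiE; last exact: measurable_itv.
by congr fine; apply: eq_integral => t _; rewrite /= fineK.
Qed.

(** * The fundamental theorem of calculus for absolutely continuous functions *)

Notation TV := total_variation.

Lemma abs_cont_seq_total_variation_fin a b g : a <= b -> abs_cont_seq a b g ->
  forall x, a <= x <= b -> TV a x g \is a fin_num.
Proof.
move=> ab acg; have [d d0 H] := acg 1 ltr01.
have small x y : a <= x -> x <= y -> y <= b -> y - x < d -> (TV x y g <= 1%:E)%E.
  move=> ax xy yb yxd.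
  have := total_variation_sum_le H (s := [:: (x, y)]).
  rewrite /nonoverlapping/= /subseg/= ax xy yb /total_length !big_seq1/=.
  exact.
(* The variation is finite on intervals of length [d / 2], and [[a, x]] is
   covered by finitely many of these. *)
have step k : forall x, a <= x <= b -> x - a <= k%:R * (d / 2) -> TV a x g \is a fin_num.
  elim: k => [x /andP[ax xb]|k ih x /andP[ax xb] h].
    rewrite mul0r subr_le0 => xa.
    have -> : x = a by apply/eqP; rewrite eq_le xa ax.
    by rewrite total_variationxx.
  have d2 : 0 < d / 2 by rewrite divr_gt0.
  pose y := Num.max a (x - d / 2).
  have ay : a <= y by rewrite /y le_max lexx.
  have yx : y <= x by rewrite /y ge_max ax lerBlDr lerDl ltW.
  rewrite (total_variationD g ay yx) fin_numD; apply/andP; split.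
    apply: ih; first by rewrite ay (le_trans yx).
    have kd : 0 <= k%:R * (d / 2) by rewrite mulr_ge0// ltW.
    move: h kd; rewrite -natr1 mulrDl mul1r /y; move: (k%:R * (d / 2)) => K.
    by move=> h kd; case: (leP a (x - d / 2)) => ?; lra.
  rewrite ge0_fin_numE ?total_variation_ge0//.
  apply: le_lt_trans (small _ _ ay yx xb _) (ltry _).
  by rewrite /y; case: (leP a (x - d / 2)) => ?; lra.
move=> x axb; apply: (step (Num.bound ((x - a) / (d / 2)))) => //.
rewrite -ler_pdivrMr ?divr_gt0//; apply/ltW/archi_boundP.
by rewrite divr_ge0 ?divr_ge0 ?subr_ge0 ?(ltW d0)//; case/andP: axb.
Qed.

(** Absolutely continuous functions are primitives of integrable functions. *)
Lemma abs_cont_density a b g : a < b -> abs_cont_itv a b g ->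
  exists2 phi : R -> R, leb.-integrable setT (EFin \o phi) &
    forall x, a <= x <= b -> g x - g a = \int[leb]_(t in `]a, x]) phi t.
Proof.
move=> ab /abs_cont_itv_seq acg; have leab := ltW ab.
have tvfin := abs_cont_seq_total_variation_fin leab acg.
(* Jordan decomposition: [g = P - N] with [P] the variation of [g] on [[a, x]]. *)
pose P x := fine (TV a x g).
have PD x y : a <= x -> x <= y -> y <= b -> (P y - P x)%:E = TV x y g.
  move=> ax xy yb; have ay := le_trans ax xy; have xb := le_trans xy yb.
  rewrite /P EFinB !fineK ?tvfin ?ax ?ay ?xb//.
  rewrite (total_variationD g ax xy) addeAC subee ?add0e//.
  by rewrite tvfin// ax.
have Pge x y : a <= x -> x <= y -> y <= b -> `|g y - g x| <= P y - P x.
  by move=> ax xy yb; rewrite -lee_fin PD// total_variation_ge.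
have ndP : {in `[a, b] &, nondecreasing P}.
  move=> x y; rewrite !in_itv/= => /andP[ax xb] /andP[ay yb] xy.
  by rewrite -subr_ge0; apply: le_trans (Pge _ _ ax xy yb).
pose N x := P x - g x.
have ndN : {in `[a, b] &, nondecreasing N}.
  move=> x y; rewrite !in_itv/= => /andP[ax xb] /andP[ay yb] xy.
  by have := le_trans (ler_norm _) (Pge _ _ ax xy yb); rewrite /N; lra.
have acP : abs_cont_seq a b P.
  move=> e e0; have e2 : 0 < e / 2 by rewrite divr_gt0.
  have [d d0 H] := acg _ e2; exists d => // s ss sd.
  have := total_variation_sum_le H ss sd => h.
  apply: (@le_lt_trans _ _ (e / 2)); last by rewrite ltr_pdivrMr// ltr_pMr// ltr1n.
  rewrite -lee_fin; apply: le_trans h; rewrite -sumEFin.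
  rewrite big_seq [leRHS]big_seq; apply: lee_sum => p ps.
  case/andP: ss => /allP/(_ p ps)/and3P[ap pp pb] _.
  rewrite ger0_norm ?PD// subr_ge0; apply: ndP => //; rewrite in_itv/= ?ap ?pb ?andbT.
    exact: le_trans pb.
  exact: le_trans pp.
have acN : abs_cont_seq a b N.
  move=> e e0; have e2 : 0 < e / 2 by rewrite divr_gt0.
  have [d d0 H] := acP _ e2; exists d => // s ss sd.
  rewrite (splitr e); apply: le_lt_trans (ltrD (H _ ss sd) (H _ ss sd)).
  rewrite -big_split/= big_seq [leRHS]big_seq; apply: ler_sum => p ps.
  case/andP: ss => /allP/(_ p ps)/and3P[ap pp pb] _.
  have -> : N p.2 - N p.1 = (P p.2 - P p.1) - (g p.2 - g p.1) by rewrite /N; lra.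
  apply: le_trans (ler_normB _ _) _; rewrite lerD2l.
  by apply: le_trans (Pge _ _ ap pp pb) _; rewrite ler_norm.
have [phi iphi phiE] := monotone_abs_cont_density ab ndP acP.
have [psi ipsi psiE] := monotone_abs_cont_density ab ndN acN.
exists (phi \- psi).
  by rewrite (_ : EFin \o _ = (EFin \o phi) \- (EFin \o psi))%E//; exact: integrableB.
move=> x xab; rewrite RintegralB//; first by rewrite -phiE// -psiE// /N; lra.
  by apply: integrableS iphi.
by apply: integrableS ipsi.
Qed.

End AbsContDensity.

Section DerivativeMeasurable.
Context {R : realType}.
Implicit Types (a b : R) (g : R -> R).
Notation leb := (@lebesgue_measure R).

Lemma derive1_eq_itv a b (f g : R -> R) x : a < x < b -> {in `]a, b[, f =1 g} ->
  derive1 f x = derive1 g x.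
Proof.
move=> axb fg; rewrite !derive1E; apply: near_eq_derive.
have : x \in `]a, b[ by rewrite in_itv.
by move=> /near_in_itvoo; apply: filterS => y /fg.
Qed.

(** The difference quotient of [g] at [x] with increment [h]. *)
Definition dquot g x h : R := h^-1 * (g (h + x) - g x).

Lemma near_rat_le (f : R -> R) h (r c : R) : 0 < r -> {for h, continuous f} ->
  (forall p : rat, `|ratr p - h| < r -> f (ratr p) <= c) -> f h <= c.
Proof.
move=> r0 cf H; rewrite leNgt; apply/negP => cfh.
have : \forall y \near h, c < f y by apply: (cvgr_gt _ cf).
move=> [d /= d0 hd].
have [p] : exists p : rat, ratr p \in `]h, h + Num.min r d[.
  by apply: rat_in_itvoo; rewrite ltrDl lt_min r0.
rewrite in_itv/= => /andP[hp ph].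
have : `|ratr p - h| < Num.min r d.
  by rewrite gtr0_norm ?subr_gt0// ltrBlDl.
rewrite lt_min => /andP[/H fp]; rewrite distrC => /hd.
by rewrite /= ltNge fp.
Qed.

Lemma dquot_continuous g x h : continuous g -> h != 0 ->
  {for h, continuous (dquot g x)}.
Proof.
move=> cg h0; apply: continuousM; first exact: inv_continuous.
apply: continuousB; last exact: cst_continuous.
apply: continuous_comp; last exact: cg.
by apply: continuousD => //; exact: cst_continuous.
Qed.

(** The points at which the difference quotients of [g] along rational increments
    satisfy the Cauchy criterion at [0]; the quotient of increment [1 / (n + 2)]
    is the reference value. *)
Definition dquot_cauchy g : set R :=
  \bigcap_(k in [set: nat]) \bigcup_(n in [set: nat]) \bigcap_(p in [set: rat])
    [set x | p != 0 -> `|ratr p : R| < n.+1%:R^-1 ->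
      `|dquot g x (ratr p) - dquot g x n.+2%:R^-1| <= k.+1%:R^-1].

Lemma invS_lt (e : R) : 0 < e -> exists k : nat, k.+1%:R^-1 < e.
Proof.
move=> e0; exists (Num.bound e^-1); rewrite -[ltRHS]invrK ltf_pV2 ?posrE ?invr_gt0//.
apply: lt_trans (archi_boundP _) _; first by rewrite invr_ge0 ltW.
by rewrite ltr_nat.
Qed.

Lemma dquot_cauchyP g x : continuous g ->
  dquot_cauchy g x <-> cvg (dquot g x h @[h --> 0^']).
Proof.
move=> cg; split.
  move=> H; apply/cauchy_cvgP; apply: cauchy_exP => e e0.
  have [k ke] := invS_lt e0.
  have [n _ Hn] := H k Logic.I.
  exists (dquot g x n.+2%:R^-1).
  suff : \forall h \near 0^', ball (dquot g x n.+2%:R^-1) e (dquot g x h) by [].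
  near=> h; rewrite /ball/=; apply: le_lt_trans ke; rewrite distrC.
  have h0 : h != 0 by near: h; rewrite near_withinE; exact: nearW.
  have hn : `|h| < n.+1%:R^-1 by near: h; apply: dnbhs0_lt.
  apply: (@near_rat_le (fun h => `|dquot g x h - dquot g x n.+2%:R^-1|) h
     (Num.min `|h| (n.+1%:R^-1 - `|h|))).
  - by rewrite lt_min normr_gt0 h0 subr_gt0.
  - apply: (@continuous_comp _ _ _ (fun h => dquot g x h - dquot g x n.+2%:R^-1)
      Num.norm); last exact: norm_continuous.
    by apply: continuousB; [exact: dquot_continuous|exact: cst_continuous].
  - move=> p; rewrite lt_min => /andP[p1 p2].
    apply: Hn => //.
      by apply/negP => /eqP p0; move: p1; rewrite p0 raddf0 sub0r normrN ltxx.
    have -> : (ratr p : R) = h + (ratr p - h) by rewrite addrC subrK.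
    by apply: le_lt_trans (ler_normD _ _) _; rewrite -ltrBrDl.
move=> /cvg_ex[l /cvgrPdist_lt hl] k _.
have k2 : 0 < (k.+1%:R^-1 / 2 : R) by rewrite divr_gt0.
have [d /= d0 hd] := hl _ k2.
have [n nd] := invS_lt d0.
exists n => // p _ p0 pn.
have inv_lt : (n.+2%:R^-1 : R) < n.+1%:R^-1 by rewrite ltf_pV2 ?posrE// ltr_nat.
have /= h1 := hd (ratr p); have /= h2 := hd n.+2%:R^-1.
rewrite (splitr k.+1%:R^-1) -(subrKA l) addrC.
apply: le_trans (ler_normD _ _) _; apply: lerD; apply/ltW.
  rewrite h2 ?invr_neq0//= sub0r normrN gtr0_norm ?invr_gt0//.
  exact: lt_trans nd.
rewrite distrC h1 ?fmorph_eq0//= sub0r normrN.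
exact: lt_trans nd.
Unshelve. all: by end_near. Qed.

Lemma measurable_dquot_cauchy g : continuous g -> measurable (dquot_cauchy g).
Proof.
move=> cg; apply: bigcapT_measurable => k; apply: bigcupT_measurable => n.
rewrite -[X in measurable X]setCK setC_bigcap; apply: measurableC.
apply: bigcupT_measurable_rat => p; apply: measurableC.
have [p0|p0] := eqVneq p 0.
  rewrite [X in measurable X](_ : _ = setT)//.
  by apply/seteqP; split.
have [pn|pn] := ltP (`|ratr p : R|) n.+1%:R^-1; last first.
  rewrite [X in measurable X](_ : _ = setT)//.
  by apply/seteqP; split.
have mg : measurable_fun setT g by exact: measurable_realfun.continuous_measurable_fun.
have mq h : measurable_fun setT (fun x => dquot g x h).
  apply: measurable_funM => //; apply: measurable_funB => //.
  by apply: measurableT_comp => //; apply: measurable_funD.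
rewrite [X in measurable X](_ : _ = (fun x => `|dquot g x (ratr p) - dquot g x n.+2%:R^-1|) @^-1`
   `]-oo, k.+1%:R^-1]).
  rewrite -[X in measurable X]setTI.
  have : measurable_fun setT (fun x => `|dquot g x (ratr p) - dquot g x n.+2%:R^-1|).
    by apply: measurableT_comp => //; apply: measurable_funB.
  by apply => //; exact: measurable_itv.
by apply/seteqP; split => x /=; rewrite in_itv/= => h; [exact: h|].
Qed.

(** The derivative, set to its default value wherever it does not exist, of a
    continuous function is Borel. *)
Lemma measurable_derive1_continuous g : continuous g -> measurable_fun setT (derive1 g).
Proof.
move=> cg; rewrite -(setUv (dquot_cauchy g)).
have mE := measurable_dquot_cauchy cg.
have mg : measurable_fun setT g by exact: measurable_realfun.continuous_measurable_fun.
apply/measurable_funU => //; first exact: measurableC.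
split.
  apply: (@measurable_realfun.measurable_fun_cvg _ _ _ _ (fun n x => dquot g x n.+1%:R^-1)).
    move=> n; apply: measurable_funTS.
    apply: measurable_funM => //; apply: measurable_funB => //.
    by apply: measurableT_comp => //; apply: measurable_funD.
  move=> x /(dquot_cauchyP _ cg).1 Ex.
  have h1 : dquot g x h @[h --> 0^'] --> derive1 g x by [].
  have /cvg_at_rightP/(_ harmonic) := cvg_dnbhs_at_right h1.
  apply; split; first by move=> n; rewrite /harmonic/= invr_gt0.
  exact: cvg_harmonic.
apply: (@eq_measurable_fun _ _ _ _ _ (cst point)).
  move=> x; rewrite inE => /= nEx.
  by rewrite /derive1 dvgP// => cE; apply: nEx; exact/dquot_cauchyP.
exact: measurable_cst.
Qed.

End DerivativeMeasurable.

Section FundamentalTheorem.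
Context {R : realType}.
Implicit Types (a b : R) (g : R -> R).
Notation leb := (@lebesgue_measure R).

Lemma measurable_derive1_itv a b g : a < b -> abs_cont_itv a b g ->
  measurable_fun `]a, b] (derive1 g).
Proof.
move=> ab /abs_cont_itv_seq acg; have leab := ltW ab.
have -> : `]a, b]%classic = `]a, b[%classic `|` [set b] by rewrite setUitv1.
apply/measurable_funU => //; split; last first.
  exact: measurable_fun_set1.
apply: (@eq_measurable_fun _ _ _ _ _ (derive1 (g \o clamp a b))).
  move=> x; rewrite inE /= => xab; apply: (@derive1_eq_itv _ a b) => // t.
  by rewrite in_itv/= => /andP[/ltW ta /ltW tb]; rewrite clamp_id// ta.
apply: measurable_funTS; apply: measurable_derive1_continuous.
exact: abs_cont_seq_cont.
Qed.

(** Lebesgue's differentiation theorem for [g]. *)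
Lemma abs_cont_derive1_ae a b g (phi : R -> R) : a < b ->
  leb.-integrable setT (EFin \o phi) ->
  (forall x, a <= x <= b -> g x - g a = \int[leb]_(t in `]a, x]) phi t) ->
  {ae leb, forall x, `]a, b]%classic x -> derive1 g x = phi x}.
Proof.
move=> ab iphi gE.
have iphiab y : leb.-integrable [set` Interval (BRight a) (BRight y)] (EFin \o phi).
  by apply: integrableS iphi.
have h := FTC1 iphiab (open_integrable_locally openT iphi).
have hb : {ae leb, forall x, x != b}.
  exists [set b]; split => //; first exact: lebesgue_measure_set1.
  by move=> x /= /negP; rewrite negbK => /eqP.
have aeF := ae_filter_ringOfSetsType leb.
apply: filterS2 h hb => x /= h xb; rewrite in_itv/= => /andP[ax xleb].
have xltb : x < b by rewrite lt_neqAle xb.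
have [_ <-] := h ax.
transitivity (derive1 (fun x => g a + \int[leb]_(t in `]a, x]) phi t) x).
  apply: (@derive1_eq_itv _ a b); first by rewrite ax.
  by move=> t; rewrite in_itv/= => /andP[/ltW ta /ltW tb]; rewrite -gE ?ta// addrC subrK.
rewrite /derive1; apply: (congr1 (fun f : R -> R => lim (f h @[h --> 0^']))).
apply/funext => k.
by congr (_ *: _); rewrite opprD addrACA subrr add0r.
Qed.

(** The fundamental theorem of calculus for absolutely continuous functions;
    the derivative at [b] depends on values of [g] beyond [b], but [{b}] is
    negligible. *)
Lemma abs_cont_FTC a b g : a < b -> abs_cont_itv a b g ->
  leb.-integrable `]a, b] (EFin \o derive1 g) /\
  forall x, a <= x <= b -> g x - g a = \int[leb]_(t in `]a, x]) derive1 g t.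
Proof.
move=> ab acg; have mg := measurable_derive1_itv ab acg.
have [phi iphi gE] := abs_cont_density ab acg.
have ae := abs_cont_derive1_ae ab iphi gE.
have aeF := ae_filter_ringOfSetsType leb.
have ae' x : x <= b -> ae_eq leb `]a, x]%classic (EFin \o phi) (EFin \o derive1 g).
  move=> xb; apply: filterS ae => t /= h; rewrite in_itv/= => /andP[at_ tx].
  by rewrite h// in_itv/= at_ (le_trans tx).
have iphiab x : leb.-integrable `]a, x] (EFin \o phi) by apply: integrableS iphi.
split.
  apply/integrableP; split; first exact/measurable_EFinP.
  have /integrableP[mphi] := iphiab b.
  apply: le_lt_trans; rewrite le_eqVlt; apply/orP; left; apply/eqP.
  apply: ae_eq_integral => //.
  - by apply: measurableT_comp => //; exact/measurable_EFinP.
  - exact: measurableT_comp.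
  - exact: (ae_eq_comp abse (ae_eq_sym (ae' b (lexx _)))).
move=> x /andP[ax xb]; rewrite gE ?ax// /Rintegral; congr fine.
apply: ae_eq_integral => //; last exact: ae'.
- by have /integrableP[] := iphiab x.
- apply/measurable_EFinP; apply: measurable_funS mg => // t/=.
  by rewrite !in_itv/= => /andP[->]/= /le_trans; apply.
Qed.

End FundamentalTheorem.

(** * Diffuse measures and their distribution functions *)

Section Diffuse.
Context {R : realType}.
Implicit Types (nu : {measure set R -> \bar R}) (D : set R) (x y : R).

(** Locally finite measures on the line without atoms. *)
Definition diffuse nu : Prop :=
  (forall x y, (nu `[x, y]%classic < +oo)%E) /\ (forall x, nu [set x] = 0%E).

(** [nu] charges every nondegenerate subinterval of [D]. *)
Definition charging D nu : Prop :=
  forall x y, D x -> D y -> x < y -> (0 < nu `]x, y]%classic)%E.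

Lemma diffuse_oc_lty nu x y : diffuse nu -> (nu `]x, y]%classic < +oo)%E.
Proof.
move=> [fin _]; apply: le_lt_trans (fin x y).
by apply: le_measure; rewrite ?inE//; exact: subset_itv_oc_cc.
Qed.

Lemma diffuse_oc_fin nu x y : diffuse nu -> nu `]x, y]%classic \is a fin_num.
Proof. by move=> h; rewrite ge0_fin_numE ?measure_ge0// diffuse_oc_lty. Qed.

Lemma distr_funB nu x y : diffuse nu -> x <= y ->
  (distr_fun nu y - distr_fun nu x)%:E = nu `]x, y]%classic.
Proof.
move=> hnu xy.
have split_ (u v w : R) : u <= v -> v <= w ->
    nu `]u, w]%classic = (nu `]u, v]%classic + nu `]v, w]%classic)%E.
  move=> uv vw; rewrite -measureU//.
    by rewrite -itv_bndbnd_setU//= bnd_simp.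
  apply/seteqP; split => // t [] /=; rewrite !in_itv/= => /andP[_ tv] /andP[vt _].
  by move: (le_lt_trans tv vt); rewrite ltxx.
rewrite /distr_fun; case: (leP 0 x) => x0.
  rewrite (le_trans x0 xy) EFinB !fineK ?diffuse_oc_fin//.
  by rewrite (split_ 0 x y)// addeAC subee ?add0e// diffuse_oc_fin.
case: (leP 0 y) => y0.
  rewrite opprK EFinD !fineK ?diffuse_oc_fin//.
  by rewrite addeC -split_// ltW.
rewrite opprK EFinD EFinN !fineK ?diffuse_oc_fin//.
by rewrite (split_ x y 0) ?(ltW y0)// addeC addeK ?diffuse_oc_fin.
Qed.

Lemma distr_fun_nd nu : diffuse nu -> nondecreasing (distr_fun nu).
Proof. by move=> hnu x y xy; rewrite -subr_ge0 -lee_fin distr_funB. Qed.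

Lemma distr_fun_lt nu D x y : diffuse nu -> charging D nu -> D x -> D y ->
  x < y -> distr_fun nu x < distr_fun nu y.
Proof.
by move=> hnu cnu Dx Dy xy; rewrite -subr_gt0 -lte_fin distr_funB ?cnu ?ltW.
Qed.

Lemma distr_fun_leE nu D x y : diffuse nu -> charging D nu -> D x -> D y ->
  (distr_fun nu x <= distr_fun nu y) = (x <= y).
Proof.
move=> hnu cnu Dx Dy; case: (leP x y) => xy; first by rewrite distr_fun_nd.
by apply/negbTE; rewrite -ltNge (distr_fun_lt hnu cnu).
Qed.

Lemma diffuse_small nu x (e : R) : diffuse nu -> 0 < e ->
  exists2 d : R, 0 < d & (nu `[(x - d)%R, (x + d)%R]%classic < e%:E)%E.
Proof.
move=> [fin at0] e0.
pose F n := `[x - n.+1%:R^-1, x + n.+1%:R^-1]%classic.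
have capF : \bigcap_n F n = [set x].
  apply/seteqP; split=> [t Ft|_ -> n _].
    apply/eqP; rewrite -subr_eq0; apply: contraT; rewrite -normr_gt0 => /invS_lt[k hk].
    have := Ft k Logic.I; rewrite /F/= in_itv/= -ler_distlC distrC.
    by rewrite leNgt hk.
  by rewrite /F/= in_itv/= lerBlDr lerDl invr_ge0 ler0n.
have /(_ (fin _ _)) h := @nonincreasing_cvg_mu _ _ _ nu F.
have : (nu \o F) x @[x --> \oo] --> (0%E : \bar R).
  rewrite -(at0 x) -capF; apply: h.
  - by move=> i; exact: measurable_itv.
  - by rewrite capF; exact: measurable_set1.
  - move=> n m nm; apply/subsetPset => t; rewrite /F/= !in_itv/= => /andP[h1 h2].
    have : (m.+1%:R^-1 : R) <= n.+1%:R^-1 by rewrite lef_pV2 ?posrE// ler_nat.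
    move=> h3; apply/andP; split.
      by apply: le_trans h1; rewrite lerD2l lerN2.
    by apply: le_trans h2 _; rewrite lerD2l.
move=> /fine_cvgP[finF /cvgrPdist_lt/(_ e e0)] hF.
have [n [nfin nlt]] := filter_ex (filterI finF hF).
exists n.+1%:R^-1; first by rewrite invr_gt0.
rewrite -[ltLHS]fineK// lte_fin.
by move: nlt; rewrite /= sub0r normrN ger0_norm// fine_ge0.
Qed.

Lemma distr_fun_continuous nu : diffuse nu -> continuous (distr_fun nu).
Proof.
move=> hnu x; apply/cvgrPdist_lt => e e0.
have [d d0 hd] := diffuse_small x hnu e0.
have key u v : u <= v -> x - d <= u -> v <= x + d ->
    `|distr_fun nu u - distr_fun nu v| < e.
  move=> uv xu vx; rewrite distrC ger0_norm ?subr_ge0 ?distr_fun_nd//.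
  rewrite -lte_fin distr_funB//; apply: le_lt_trans hd.
  apply: le_measure; rewrite ?inE//= => t /=; rewrite !in_itv/= => /andP[ut tv].
  by rewrite (le_trans xu (ltW ut)) (le_trans tv vx).
exists d => //= y; rewrite /ball_/= => /ltW; rewrite ler_distlC => /andP[h1 h2].
case: (leP x y) => [xy|/ltW yx]; first by apply: key => //; lra.
by rewrite distrC; apply: key => //; lra.
Qed.

Lemma measurable_distr_fun nu : diffuse nu -> measurable_fun setT (distr_fun nu).
Proof. by move=> /distr_fun_continuous; exact: continuous_measurable_fun. Qed.

Lemma ge0_integral_mrestr d (T : measurableType d) (mu : {measure set T -> \bar R})
    (D : set T) (mD : measurable D) (f : T -> \bar R) :
  (forall z, 0 <= f z)%E -> measurable_fun setT f ->
  (\int[mrestr mu mD]_z f z = \int[mu]_(z in D) f z)%E.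
Proof.
move=> f0 mf; rewrite -(setUv D) ge0_integral_setU//=.
- rewrite [X in (_ + X)%E](_ : _ = 0%E) ?adde0.
    apply: eq_measure_integral => A mA AD.
    by rewrite /= /mrestr setIidl.
  apply: null_set_integral => //=.
  - exact: measurableC.
  - exact: measurable_funTS.
  - by rewrite /= /mrestr setICl measure0.
- exact: measurableC.
- by rewrite setUv.
- by apply/disj_setPLR; rewrite setCK.
Qed.

End Diffuse.

Section Transport.
Context {R : realType}.
Implicit Types (nu : {measure set R -> \bar R}) (D : set R) (x y : R).
Notation leb := (@lebesgue_measure R).
Notation s := distr_fun.

Lemma distr_fun_surj nu a b u : diffuse nu -> a <= b ->
  s nu a <= u <= s nu b -> exists2 p, a <= p <= b & s nu p = u.
Proof.
move=> hnu ab hu.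
have /IVT : {within `[a, b], continuous (s nu)}.
  by apply: continuous_subspaceT; exact: distr_fun_continuous.
move=> /(_ u ab); have sab : s nu a <= s nu b by exact: distr_fun_nd.
rewrite (min_idPl sab) (max_idPr sab) => /(_ hu)[p]; rewrite in_itv/= => pab <-.
by exists p.
Qed.

(** The distribution function of [nu] carries the restriction of [nu] to (a, b]
    to Lebesgue measure on (s a, s b]. *)
Lemma distr_fun_preimage nu D a b A : diffuse nu -> charging D nu -> a <= b ->
  `[a, b] `<=` D -> measurable A ->
  leb (A `&` `]s nu a, s nu b]) = nu (s nu @^-1` A `&` `]a, b]).
Proof.
move=> hnu cnu ab abD mA.
have ms : measurable_fun setT (s nu : R -> measurableTypeR R).
  exact: measurable_distr_fun.
have mab : measurable (`]a, b]%classic : set R) by exact: measurable_itv.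
have msab : measurable (`]s nu a, s nu b]%classic : set (measurableTypeR R)).
  exact: measurable_itv.
pose m1 : {measure set (measurableTypeR R) -> \bar R} := mrestr leb msab.
pose m2 : {measure set (measurableTypeR R) -> \bar R} :=
  measure_function_pushforward__canonical__measure_function_Measure
     (mrestr nu mab) ms.
suff : m1 A = m2 A by [].
have sab : s nu a <= s nu b by exact: distr_fun_nd.
have aD : D a by apply: abD; rewrite /= in_itv/= lexx.
have lt_s x y : a <= x <= b -> a <= y <= b -> (s nu x <= s nu y) = (x <= y).
  by move=> xab yab; apply: (distr_fun_leE hnu cnu); exact: abD.
(* Both sides are finite measures of [A], compared on the half-open intervals. *)
have H := @measure_unique _ R (measurableTypeR R) (@ocitv R)
  (fun k : nat => `](- k%:R), k%:R]%classic).
apply: (H _ _ _ _ m1 m2) => {H} //.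
- exact: ocitvI.
- by move=> k; exact: is_ocitv.
- rewrite -subTset => /= x _ /=.
  have := archi_boundP (normr_ge0 x); rewrite ltr_norml => /andP[h1 h2].
  by exists (Num.bound `|x|) => //=; rewrite in_itv/= h1 ltW.
- move=> _ [[x y] _ <-]/=.
  rewrite /m1/= /m2/= /mrestr /pushforward /=.
  have [xy|yx] := leP x y; last first.
    by rewrite set_itv_ge ?set0I ?preimage_set0 ?set0I ?measure0// bnd_simp -leNgt ltW.
  have := clamp_in x sab => /(distr_fun_surj hnu ab)[p pab px].
  have := clamp_in y sab => /(distr_fun_surj hnu ab)[q qab qy].
  have pq : p <= q by rewrite -lt_s// px qy clamp_nd.
  have clampl u v : s nu a < u <= s nu b -> (v < u) = (clamp (s nu a) (s nu b) v < u).
    move=> /andP[au ub]; rewrite /clamp gt_min gt_max au/=.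
    by case: (ltP v u) => //= uv; rewrite ltNge ub.
  have clampr u v : s nu a < u <= s nu b -> (u <= v) = (u <= clamp (s nu a) (s nu b) v).
    move=> /andP[au ub]; rewrite /clamp le_min ub andbT le_max.
    by rewrite [u <= s nu a]leNgt au.
  have -> : `]x, y] `&` `]s nu a, s nu b] = `]s nu p, s nu q]%classic.
    rewrite px qy; apply/seteqP; split => u /=; rewrite !in_itv/=.
      by move=> [/andP[xu uy] uab]; rewrite -clampl// -clampr// xu uy.
    move=> /andP[h1 h2].
    have uab : s nu a < u <= s nu b.
      have /andP[c1 _] := clamp_in x sab; have /andP[_ c2] := clamp_in y sab.
      by rewrite (le_lt_trans c1 h1) (le_trans h2 c2).
    by split => //; rewrite clampl// h1 clampr.
  have -> : s nu @^-1` `]x, y] `&` `]a, b] = `]p, q]%classic.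
    apply/seteqP; split => t /=; rewrite !in_itv/=.
      move=> [/andP[xt ty] /andP[at_ tb]].
      have sat : s nu a < s nu t <= s nu b.
        by rewrite ltNge !lt_s ?lexx ?ab ?tb ?(ltW at_) ?(ltW at_)//= -?ltNge ?at_.
      move: xt ty; rewrite clampl// clampr// -px -qy ltNge !lt_s ?(ltW at_) ?tb//.
      by rewrite -ltNge => -> ->.
    move=> /andP[pt tq].
    have /andP[ap pb] := pab; have /andP[aq qb] := qab.
    have at_ : a < t by exact: le_lt_trans pt.
    have tb : t <= b by exact: le_trans qb.
    have sat : s nu a < s nu t <= s nu b.
      by rewrite ltNge !lt_s ?lexx ?ab ?tb ?(ltW at_) ?(ltW at_)//= -?ltNge ?at_.
    split; last by rewrite at_ tb.
    rewrite clampl// clampr// -px -qy ltNge !lt_s ?(ltW at_) ?tb//.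
    by rewrite -ltNge pt tq.
  rewrite -distr_funB// lebesgue_measure_itv/= lte_fin.
  case: ltP => // h; have : s nu q = s nu p by apply/eqP; rewrite eq_le h distr_fun_nd.
  by move=> ->; rewrite subrr.
- move=> k; apply: (@le_lt_trans _ _ (leb `]s nu a, s nu b])).
    by apply: le_measure; rewrite ?inE//; apply: measurableI => //; exact: measurable_itv.
  by rewrite lebesgue_measure_itv/=; case: ifPn => _; rewrite ltry.
Qed.

Lemma ge0_integral_distr_fun nu D a b (f : R -> \bar R) : diffuse nu ->
  charging D nu -> a <= b -> `[a, b] `<=` D ->
  measurable_fun setT f -> (forall x, 0 <= f x)%E ->
  (\int[leb]_(x in `]s nu a, s nu b]) f x = \int[nu]_(x in `]a, b]) f (s nu x))%E.
Proof.
move=> hnu cnu ab abD mf f0.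
have ms : measurable_fun setT (s nu : R -> measurableTypeR R).
  exact: measurable_distr_fun.
have mab : measurable (`]a, b]%classic : set R) by exact: measurable_itv.
have msab : measurable (`]s nu a, s nu b]%classic : set (measurableTypeR R)).
  exact: measurable_itv.
pose m2 : {measure set (measurableTypeR R) -> \bar R} :=
  measure_function_pushforward__canonical__measure_function_Measure
     (mrestr nu mab) ms.
have mf' : measurable_fun (setT : set (measurableTypeR R)) f by exact: mf.
transitivity (\int[m2]_x f x)%E; last first.
  rewrite (@ge0_integral_pushforward _ _ _ _ _ _ ms (mrestr nu mab) setT f)//.
  rewrite preimage_setT (ge0_integral_mrestr nu mab)//.
    by move=> z; exact: f0.
  exact: (measurableT_comp mf' ms).
transitivity (\int[mrestr leb msab]_x f x)%E.
  by rewrite (ge0_integral_mrestr leb msab).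
apply: eq_measure_integral => A mA _.
exact: (distr_fun_preimage hnu cnu).
Qed.

Lemma integral_distr_fun nu D a b (f : R -> R) : diffuse nu ->
  charging D nu -> a <= b -> `[a, b] `<=` D ->
  leb.-integrable `]s nu a, s nu b] (EFin \o f) ->
  measurable_fun `]a, b] (f \o s nu) ->
  nu.-integrable `]a, b] (EFin \o (f \o s nu)) /\
  \int[leb]_(x in `]s nu a, s nu b]) f x = \int[nu]_(x in `]a, b]) f (s nu x).
Proof.
move=> hnu cnu ab abD /integrableP[/measurable_EFinP mf intf] mfs.
pose g := f \_ `]s nu a, s nu b].
have mg : measurable_fun setT g.
  by apply: (measurable_restrictT f (measurable_itv _)).1; exact: mf.
have sab t : a < t <= b -> s nu t \in `]s nu a, s nu b]%classic.
  move=> /andP[at_ tb]; rewrite inE /= in_itv/= (distr_fun_nd hnu tb) andbT.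
  by apply: (distr_fun_lt hnu cnu) => //; apply: abD; rewrite /= in_itv/= ?lexx// (ltW at_).
have gl (h : R -> \bar R) : (\int[leb]_(x in `]s nu a, s nu b]) h (g x) =
    \int[leb]_(x in `]s nu a, s nu b]) h (f x))%E.
  by apply: eq_integral => x xin; rewrite /g patchE xin.
have gr (h : R -> \bar R) : (\int[nu]_(x in `]a, b]) h (g (s nu x)) =
    \int[nu]_(x in `]a, b]) h (f (s nu x)))%E.
  apply: eq_integral => x; rewrite inE/= in_itv/= => xin.
  by rewrite /g patchE sab.
split.
  apply/integrableP; split; first exact/measurable_EFinP.
  rewrite -(gr (fun y => `|y%:E|%E)).
  rewrite -(ge0_integral_distr_fun hnu cnu ab abD (f := fun x => `|(g x)%:E|%E))//.
    by rewrite (gl (fun y => `|y%:E|%E)).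
  by apply: measurableT_comp => //; exact/measurable_EFinP.
rewrite /Rintegral; congr fine; rewrite -(gl EFin) -(gr EFin) integralE [RHS]integralE.
have mgE : measurable_fun setT (EFin \o g) by exact/measurable_EFinP.
have pos := @ge0_integral_distr_fun nu D a b ((EFin \o g)^\+)%E hnu cnu ab abD
   (measurable_funepos mgE) (fun x => funepos_ge0 _ x).
have neg := @ge0_integral_distr_fun nu D a b ((EFin \o g)^\-)%E hnu cnu ab abD
   (measurable_funeneg mgE) (fun x => funeneg_ge0 _ x).
congr (_ - _)%E; [apply: etrans; first exact: pos|apply: etrans; first exact: neg].
  by apply: eq_integral => x _; rewrite !funeposE.
by apply: eq_integral => x _; rewrite !funenegE.
Qed.

End Transport.

(** * Primitives with respect to a diffuse measure *)

Section Primitive.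
Context {R : realType}.
Implicit Types (nu : {measure set R -> \bar R}) (D : set R) (x y : R).
Implicit Types (f g phi : R -> R).
Notation leb := (@lebesgue_measure R).
Notation s := distr_fun.

(** [D] is an interval containing [0], exhausted by the nested compact
    intervals [[a n, b n]]. *)
Definition exhausted D : Prop := exists a b : nat -> R,
  [/\ forall n, a n <= 0 <= b n, forall n, a n < b n,
      {homo a : n k / (n <= k)%N >-> k <= n}, {homo b : n k / (n <= k)%N >-> n <= k} &
      forall x, D x <-> exists n, a n <= x <= b n].

Lemma exhausted_le D x y t : exhausted D -> D x -> D y -> x <= t <= y -> D t.
Proof.
move=> [a [b [ab0 ab nda ndb DE]]] /DE[n /andP[anx xbn]] /DE[k /andP[aky ybk]].
move=> /andP[xt ty]; apply/DE; exists (maxn n k).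
rewrite (le_trans _ (le_trans anx xt)) ?nda ?leq_maxl//=.
by rewrite (le_trans (le_trans ty ybk))// ndb// leq_maxr.
Qed.

Lemma exhausted_sub D x y : exhausted D -> D x -> D y -> `[x, y] `<=` D.
Proof. by move=> eD Dx Dy t; rewrite /= in_itv/=; exact: exhausted_le. Qed.

Lemma exhausted0 D : exhausted D -> D 0.
Proof. by move=> [a [b [ab0 _ _ _ DE]]]; apply/DE; exists 0%N. Qed.

Lemma exhausted_bigcup D : exhausted D -> exists a b : nat -> R,
  [/\ forall n, a n < b n, forall n, D (a n), forall n, D (b n) & D = \bigcup_n `[a n, b n]%classic].
Proof.
move=> [a [b [ab0 ab nda ndb DE]]]; exists a, b; split => //.
- by move=> n; apply/DE; exists n; rewrite lexx ltW.
- by move=> n; apply/DE; exists n; rewrite lexx ltW.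
- apply/seteqP; split => x; first by move=> /DE[n h]; exists n => //=; rewrite in_itv.
  by move=> [n _ /=]; rewrite in_itv/= => h; apply/DE; exists n.
Qed.

Lemma exhausted_measurable D : exhausted D -> measurable D.
Proof.
move=> /exhausted_bigcup[a [b [_ _ _ ->]]].
by apply: bigcupT_measurable => n; exact: measurable_itv.
Qed.

Lemma halfline_exhausted b : exhausted (@halfline R b).
Proof.
case: b.
  exists (fun=> 0), (fun n => n.+1%:R); split.
  - by move=> n; rewrite lexx ler0n.
  - by move=> n; rewrite ltr0n.
  - by [].
  - by move=> n k nk; rewrite ler_nat.
  - move=> x; rewrite /halfline/= in_itv/= andbT; split; last by move=> [n /andP[]].
    move=> x0; exists (Num.bound x); rewrite x0/= ltW//.
    by apply: lt_trans (archi_boundP x0) _; rewrite ltr_nat.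
exists (fun n => - n.+1%:R), (fun=> 0); split.
- by move=> n; rewrite lexx oppr_le0 ler0n.
- by move=> n; rewrite oppr_lt0 ltr0n.
- by move=> n k nk; rewrite lerN2 ler_nat.
- by [].
- move=> x; rewrite /halfline/= in_itv/=; split; last by move=> [n /andP[]].
  move=> x0; have Nx0 : 0 <= - x by rewrite oppr_ge0.
  exists (Num.bound (- x)); rewrite x0 andbT lerNl ltW//.
  by apply: lt_trans (archi_boundP Nx0) _; rewrite ltr_nat.
Qed.

Lemma setT_exhausted : exhausted [set: R].
Proof.
exists (fun n => - n.+1%:R), (fun n => n.+1%:R); split.
- by move=> n; rewrite oppr_le0 ler0n.
- by move=> n; rewrite (@lt_trans _ _ 0)// ?oppr_lt0 ?ltr0n.
- by move=> n k nk; rewrite lerN2 ler_nat.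
- by move=> n k nk; rewrite ler_nat.
- move=> x; split => // _; exists (Num.bound `|x|).
  rewrite -ler_norml ltW//; apply: lt_trans (archi_boundP (normr_ge0 x)) _.
  by rewrite ltr_nat.
Qed.

(** [phi] is a locally integrable density on [D] of the increments of [f] with
    respect to [nu]. *)
Definition primitive D nu f phi : Prop :=
  measurable_fun D phi /\ forall x y, D x -> D y -> x <= y ->
    nu.-integrable `]x, y] (EFin \o phi) /\
    f y - f x = \int[nu]_(t in `]x, y]) phi t.

Lemma factors_through_itv D nu f g x y : exhausted D -> diffuse nu ->
  factors_through D nu f g -> D x -> D y -> x <= y ->
  abs_cont_itv (s nu x) (s nu y) g.
Proof.
move=> eD hnu [acg _] Dx Dy xy; apply: acg => u /=; rewrite in_itv/= => hu.
have [p pxy <-] := distr_fun_surj hnu xy hu.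
by exists p => //; exact: exhausted_le pxy.
Qed.

Lemma factors_through_primitive D nu f g : exhausted D -> diffuse nu ->
  charging D nu -> factors_through D nu f g ->
  primitive D nu f (derive1 g \o s nu).
Proof.
move=> eD hnu cnu fg.
have meas x y : D x -> D y -> x < y -> measurable_fun `]x, y] (derive1 g \o s nu).
  move=> Dx Dy xy.
  have sxy := distr_fun_lt hnu cnu Dx Dy xy.
  have acg := factors_through_itv eD hnu fg Dx Dy (ltW xy).
  apply: (measurable_comp (measurable_itv `]s nu x, s nu y])).
  - move=> u [t /=]; rewrite !in_itv/= => /andP[xt ty] <-.
    rewrite (distr_fun_lt hnu cnu Dx) ?distr_fun_nd//.
    by apply: (exhausted_le eD Dx Dy); rewrite (ltW xt).
  - exact: measurable_derive1_itv.
  - by apply: measurable_funTS; exact: measurable_distr_fun.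
split.
  have [a [b [ab Da Db DE]]] := exhausted_bigcup eD.
  rewrite [X in measurable_fun X _]DE.
  apply/measurable_fun_bigcup => // n.
  rewrite -(@setU1itv _ _ _ _ false) ?bnd_simp ?ltW//.
  apply/measurable_funU => //; split; first exact: measurable_fun_set1.
  exact: meas.
move=> x y Dx Dy; rewrite le_eqVlt => /predU1P[<-|xy].
  by rewrite set_itvoc0 subrr Rintegral_set0; split => //; exact: integrable_set0.
have sxy := distr_fun_lt hnu cnu Dx Dy xy.
have acg := factors_through_itv eD hnu fg Dx Dy (ltW xy).
have [ig gE] := abs_cont_FTC sxy acg.
have [-> <-] := integral_distr_fun hnu cnu (ltW xy) (exhausted_sub eD Dx Dy) ig (meas _ _ Dx Dy xy).
by rewrite !fg.2// gE// ltW//= lexx.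
Qed.

Lemma primitive_integrable D nu f phi x y : primitive D nu f phi -> D x -> D y ->
  nu.-integrable `]x, y] (EFin \o phi).
Proof.
move=> [_ H] Dx Dy; have [xy|yx] := leP x y; first by have [] := H _ _ Dx Dy xy.
by rewrite set_itv_ge ?bnd_simp -?leNgt ?ltW//; exact: integrable_set0.
Qed.

(** Integrals of a density control the increments over disjoint intervals, which
    makes primitives absolutely continuous with respect to [nu]. *)
Lemma primitive_ll D nu f phi : exhausted D -> diffuse nu -> charging D nu ->
  primitive D nu f phi -> ll D nu f.
Proof.
move=> eD hnu cnu hf.
(* The inverse of the distribution function on its image. *)
pose t u := xget 0 [set x | D x /\ s nu x = u].
have tK x : D x -> t (s nu x) = x.
  move=> Dx; have [Dt st] : [set x' | D x' /\ s nu x' = s nu x] (t (s nu x)).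
    by apply: (@xgetI _ _ _ x).
  apply/eqP; rewrite eq_le -(distr_fun_leE hnu cnu Dt Dx).
  by rewrite -(distr_fun_leE hnu cnu Dx Dt) st lexx.
exists (f \o t); split; last by move=> x Dx /=; rewrite tK.
move=> p q pqD e e0.
have [pq|qp] := leP p q; last first.
  exists 1 => // -[|n] x y xy _ _; first by rewrite big_ord0.
  have [h1 h2 h3] := xy ord0.
  by move: (le_trans h1 (le_trans h2 h3)); rewrite leNgt qp.
have [a Da ap] : (s nu @` D) p by apply: pqD; rewrite /= in_itv/= lexx.
have [b Db bq] : (s nu @` D) q by apply: pqD; rewrite /= in_itv/= lexx pq.
have ab : a <= b by rewrite -(distr_fun_leE hnu cnu)// ap bq.
have mab : measurable (`]a, b]%classic : set R) by exact: measurable_itv.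
have iphi : nu.-integrable setT (EFin \o (phi \_ `]a, b])).
  rewrite -restrict_EFin; apply/(integrable_mkcond _ mab).1.
  exact: primitive_integrable hf Da Db.
have [d [d0 H]] := integral_normr_continuous iphi e0.
exists d => // n x y xy triv len.
have /choice[u hu] : forall i, exists u, a <= u <= b /\ s nu u = x i.
  move=> i; have [h1 h2 h3] := xy i.
  suff /(distr_fun_surj hnu ab)[u uab su] : s nu a <= x i <= s nu b by exists u.
  by rewrite ap bq h1 (le_trans h2).
have /choice[v hv] : forall i, exists v, a <= v <= b /\ s nu v = y i.
  move=> i; have [h1 h2 h3] := xy i.
  suff /(distr_fun_surj hnu ab)[w wab sw] : s nu a <= y i <= s nu b by exists w.
  by rewrite ap bq h3 (le_trans h1).
have Du i : D (u i) by apply: (exhausted_le eD Da Db); have [] := hu i.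
have Dv i : D (v i) by apply: (exhausted_le eD Da Db); have [] := hv i.
have uv i : u i <= v i.
  by rewrite -(distr_fun_leE hnu cnu)// (hu i).2 (hv i).2; have [] := xy i.
have uvab i : `]u i, v i] `<=` `]a, b].
  move=> w /=; rewrite !in_itv/= => /andP[uw wv].
  have [/andP[au _] _] := hu i; have [/andP[_ vb] _] := hv i.
  by rewrite (le_lt_trans au uw) (le_trans wv vb).
have trivuv : trivIset setT (fun i => `]u i, v i]%classic).
  apply/trivIsetP => i j _ _ ij; apply/seteqP; split => // w [] /=.
  rewrite !in_itv/= => /andP[uiw wvi] /andP[ujw wvj].
  pose z := (Num.max (u i) (u j) + w) / 2.
  have /midf_lt[mz zw] : Num.max (u i) (u j) < w by rewrite gt_max uiw.
  move: mz; rewrite -/z gt_max => /andP[uiz ujz].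
  have Dz : D z by apply: (exhausted_le eD (Du i) (Dv i)); rewrite (ltW uiz) (le_trans (ltW zw)).
  have /trivIsetP/(_ i j Logic.I Logic.I ij)/seteqP[/(_ (s nu z)) + _] := triv.
  apply; split; rewrite /= in_itv/= -?(hu _).2 -?(hv _).2.
    by rewrite !(distr_fun_lt hnu cnu)// (lt_le_trans zw).
  by rewrite !(distr_fun_lt hnu cnu)// (lt_le_trans zw).
pose A := \big[setU/set0]_(i < n) `]u i, v i]%classic.
have mA : measurable A by exact: bigsetU_measurable.
have nuA : (nu A < d%:E)%E.
  rewrite /A measure_semi_additive_ord//.
  rewrite (eq_bigr (fun i => (y i - x i)%:E)) ?sumEFin ?lte_fin// => i _.
  by rewrite -(hu i).2 -(hv i).2 distr_funB.
rewrite -lte_fin.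
apply: (@le_lt_trans _ _ (\int[nu]_(w in A) `|(phi \_ `]a, b]) w|)%:E); last first.
  by rewrite lte_fin; exact: H.
have mphi : measurable_fun setT (phi \_ `]a, b]).
  by have /integrableP[/measurable_EFinP] := iphi.
have iA : nu.-integrable A (EFin \o (fun x => `|(phi \_ `]a, b]) x|)).
  by apply: integrable_norm; exact: integrableS iphi.
rewrite /Rintegral fineK; last exact: integrable_fin_num.
rewrite /A ge0_integral_bigsetU//.
- rewrite -sumEFin; apply: lee_sum => i _ /=.
  rewrite -(hu i).2 -(hv i).2 !tK//.
  have [_ /(_ _ _ (Du i) (Dv i) (uv i))[ii ->]] := hf.
  rewrite (@EFin_normr_Rintegral _ _ _ nu)//.
  apply: le_trans (le_abse_integral _ _ _) _ => //; first by have /integrableP[] := ii.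
  rewrite le_eqVlt; apply/orP; left; apply/eqP; apply: eq_integral => w.
  by rewrite inE => /uvab hw; rewrite patchE mem_set.
- exact: index_enum_uniq.
- by apply: sub_trivIset trivuv.
- by apply/measurable_EFinP; apply: measurable_funTS; exact: measurableT_comp.
Qed.

End Primitive.

Section Densities.
Context {R : realType}.
Implicit Types (nu lam m : {measure set R -> \bar R}) (D : set R) (x y : R).
Implicit Types (f g phi psi w : R -> R).
Notation s := distr_fun.

(** A function whose integrals over subintervals vanish is null almost
    everywhere: its integrals over all Borel sets vanish, by a monotone class
    argument. *)
Lemma integral_itv_eq0 nu a b phi : nu.-integrable `]a, b] (EFin \o phi) ->
  (forall x y, a <= x -> x <= y -> y <= b -> \int[nu]_(t in `]x, y]) phi t = 0) ->
  {ae nu, forall x, `]a, b]%classic x -> phi x = 0}.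
Proof.
move=> iphi H; pose J := `]a, b]%classic : set R.
have mJ : measurable J by exact: measurable_itv.
have mphi : measurable_fun J (EFin \o phi) by have /integrableP[] := iphi.
have isub A : measurable A -> nu.-integrable (A `&` J) (EFin \o phi).
  by move=> mA; apply: integrableS iphi => //; exact: measurableI.
have key : forall A, measurable A -> (\int[nu]_(x in A `&` J) (phi x)%:E = 0)%E.
  apply: (@dynkin_induction _ R (@ocitv R) (fun A => \int[nu]_(x in A `&` J) (phi x)%:E = 0)%E) => //.
  - exact: ocitvI.
  - rewrite setTI; have [ab|ba] := leP a b.
      have := H a b (lexx _) ab (lexx _); rewrite /Rintegral => h.
      by rewrite -[LHS]fineK ?h//; apply: integrable_fin_num.
    by rewrite /J set_itv_ge ?integral_set0// bnd_simp -leNgt ltW.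
  - move=> _ [[x y] _ <-]/=.
    have -> : `]x, y] `&` J = `]Num.max x a, Num.min y b]%classic.
      apply/seteqP; split => t; rewrite /J /= !in_itv/= gt_max le_min.
        by move=> [/andP[-> ->] /andP[-> ->]].
      by move=> /andP[/andP[-> ->] /andP[-> ->]].
    have [h|h] := leP (Num.max x a) (Num.min y b); last first.
      by rewrite set_itv_ge ?integral_set0// bnd_simp -leNgt ltW.
    have := H _ _ _ h; rewrite le_max lexx orbT ge_min lexx orbT /Rintegral => /(_ isT isT) h0.
    rewrite -[LHS]fineK ?h0//; apply: integrable_fin_num => //.
    apply: integrableS iphi => // t /=; rewrite !in_itv/= gt_max le_min.
    by move=> /andP[/andP[_ ->] /andP[_ ->]].
  - move=> A mA A0.
    have : (\int[nu]_(x in J) (phi x)%:E = 0)%E.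
      have [ab|ba] := leP a b.
        have := H a b (lexx _) ab (lexx _); rewrite /Rintegral => h.
        by rewrite -[LHS]fineK ?h//; apply: integrable_fin_num.
      by rewrite /J set_itv_ge ?integral_set0// bnd_simp -leNgt ltW.
    rewrite -{1}[J]setTI -(setUv A) setIUl integral_setU//.
    + by rewrite A0 add0e.
    + exact: measurableI.
    + by apply: measurableI => //; exact: measurableC.
    + by rewrite -setIUl setUv setTI.
    + by apply/disj_setPLR => t [At _] [/(_ At)].
  - move=> F mF tF F0; rewrite setI_bigcupl integral_bigcup//.
    + by rewrite eseries0// => i _ _; exact: F0.
    + by apply: trivIset_setIr.
    + by move=> k; exact: measurableI.
    + rewrite -setI_bigcupl; apply: isub; exact: bigcupT_measurable.
have : ae_eq nu J (EFin \o phi) (cst 0%E).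
  apply: integral_ae_eq => // A AJ mA.
  by have := key A mA; rewrite setIidl// integral0.
by apply: filterS => x /= h /h [].
Qed.

Lemma ae_bigcup nu (F : nat -> set R) (P : R -> Prop) :
  (forall n, {ae nu, forall x, F n x -> P x}) ->
  {ae nu, forall x, (\bigcup_n F n) x -> P x}.
Proof.
move=> H; have := ae_foralln H.
by apply: filterS => x h [n _ Fnx]; exact: (h n Fnx).
Qed.

Lemma exhausted_ae D nu (P : R -> Prop) : exhausted D -> diffuse nu ->
  (forall x y, D x -> D y -> x < y -> {ae nu, forall t, `]x, y]%classic t -> P t}) ->
  {ae nu, forall t, D t -> P t}.
Proof.
move=> eD [_ at0] H; have [a [b [ab Da Db DE]]] := exhausted_bigcup eD.
rewrite DE; apply: ae_bigcup => n.
have ha : {ae nu, forall x, x != a n}.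
  exists [set a n]; split => //.
  by move=> x /= /negP; rewrite negbK => /eqP.
have := H _ _ (Da n) (Db n) (ab n); apply: filterS2 ha => x xa h.
rewrite /= in_itv/= => /andP[ax xb]; apply: h.
by rewrite /= in_itv/= xb lt_neqAle eq_sym xa ax.
Qed.

Lemma primitive_unique D nu f phi psi : exhausted D -> diffuse nu ->
  primitive D nu f phi -> primitive D nu f psi -> phi = psi %[ae nu in D].
Proof.
move=> eD hnu [mphi Hphi] [mpsi Hpsi]; apply: exhausted_ae => // x y Dx Dy xy.
have [iphi _] := Hphi _ _ Dx Dy (ltW xy).
have [ipsi _] := Hpsi _ _ Dx Dy (ltW xy).
have : {ae nu, forall t, `]x, y]%classic t -> (phi \- psi) t = 0}.
  apply: integral_itv_eq0 => [|u v xu uv vy].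
    rewrite (_ : EFin \o _ = (EFin \o phi) \- (EFin \o psi))%E//.
    exact: integrableB.
  have Du : D u by apply: (exhausted_le eD Dx Dy); rewrite xu (le_trans uv).
  have Dv : D v by apply: (exhausted_le eD Dx Dy); rewrite vy (le_trans xu).
  have [i1 e1] := Hphi _ _ Du Dv uv; have [i2 e2] := Hpsi _ _ Du Dv uv.
  by rewrite RintegralB// -e1 -e2 subrr.
by apply: filterS => t h /h/eqP; rewrite subr_eq0 => /eqP.
Qed.

Lemma primitive_eq D nu f g phi : (forall x, D x -> f x = g x) ->
  primitive D nu f phi -> primitive D nu g phi.
Proof. by move=> fg [mphi H]; split => // x y Dx Dy xy; rewrite -!fg//; exact: H. Qed.

Lemma ll_dd D nu f : exhausted D -> diffuse nu -> charging D nu ->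
  ll D nu f -> primitive D nu f (dd D nu f).
Proof.
move=> eD hnu cnu [g fg]; apply: factors_through_primitive => //.
exact: (@xgetI _ (cst 0) [set g | factors_through D nu f g] g).
Qed.

Lemma primitive_dd D nu f phi : exhausted D -> diffuse nu -> charging D nu ->
  primitive D nu f phi -> dd D nu f = phi %[ae nu in D].
Proof.
move=> eD hnu cnu hf; have hll := primitive_ll eD hnu cnu hf.
exact: (primitive_unique eD hnu (ll_dd eD hnu cnu hll) hf).
Qed.

Lemma ll_continuous D nu f x y : exhausted D -> diffuse nu -> ll D nu f ->
  D x -> D y -> x <= y ->
  exists2 F, continuous F & forall t, x <= t <= y -> f t = F t.
Proof.
move=> eD hnu [g fg] Dx Dy xy.
have /abs_cont_itv_seq acg := factors_through_itv eD hnu fg Dx Dy xy.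
have sxy := distr_fun_nd hnu xy.
exists ((g \o clamp (s nu x) (s nu y)) \o s nu) => [t|t /andP[xt ty]].
  apply: continuous_comp; first exact: distr_fun_continuous.
  exact: abs_cont_seq_cont.
rewrite /= clamp_id ?fg.2//; last by rewrite !distr_fun_nd.
by apply: (exhausted_le eD Dx Dy); rewrite xt.
Qed.

(** Two functions absolutely continuous with respect to [m] that agree almost
    everywhere for a measure of full support agree everywhere. *)
Lemma ll_ae_eq D lam m f g : exhausted D -> diffuse m -> charging D lam ->
  ll D m f -> ll D m g -> f = g %[ae lam in D] -> forall x, D x -> f x = g x.
Proof.
move=> eD hm clam llf llg fg x Dx; apply/eqP/negP => /negP fgx.
have [a [b [ab0 ab nda ndb DE]]] := eD.
have [n xab] := (DE x).1 Dx.
have Da : D (a n) by apply/DE; exists n; rewrite lexx ltW.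
have Db : D (b n) by apply/DE; exists n; rewrite lexx ltW.
have [F cF fF] := ll_continuous eD hm llf Da Db (ltW (ab n)).
have [G cG gG] := ll_continuous eD hm llg Da Db (ltW (ab n)).
have : \forall t \near x, F t - G t != 0.
  have : F t - G t @[t --> x] --> F x - G x by apply: cvgB; [exact: cF|exact: cG].
  by move=> /cvgr_neq0; apply; rewrite subr_eq0 -fF// -gG.
move=> [d /= d0 hd].
have [u [v [uv au vb uvd]]] : exists u v, [/\ u < v, a n <= u, v <= b n &
    forall t, u < t <= v -> `|x - t| < d].
  have /andP[ax xb] := xab; have := ab n.
  have d2 : d / 2 < d by rewrite ltr_pdivrMr// ltr_pMr// ltr1n.
  have d20 : 0 < d / 2 by rewrite divr_gt0.
  have [axlt|] := ltP (a n) x.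
    exists (Num.max (a n) (x - d / 2)), x; split => //; first by rewrite gt_max axlt/= ltrBlDr ltrDl.
      by rewrite le_max lexx.
    move=> t /andP[]; rewrite gt_max => /andP[_ h1] h2.
    by rewrite ger0_norm ?subr_ge0//; lra.
  move=> xa; have xlt : x < b n by apply: le_lt_trans xa _.
  exists x, (Num.min (b n) (x + d / 2)); split => //; first by rewrite lt_min xlt/= ltrDl.
    by rewrite ge_min lexx.
  move=> t /andP[h1]; rewrite le_min => /andP[_ h2].
  by rewrite distrC ger0_norm ?subr_ge0 ?(ltW h1)//; lra.
have Du : D u by apply: (exhausted_le eD Da Db); rewrite au (le_trans (ltW uv)).
have Dv : D v by apply: (exhausted_le eD Da Db); rewrite vb (le_trans au (ltW uv)).
have := clam _ _ Du Dv uv.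
case: fg => N [mN N0 hN].
suff uvN : `]u, v] `<=` N.
  apply/negP; rewrite -leNgt -N0.
  by apply: le_measure; rewrite ?inE//; exact: measurable_itv.
move=> t /=; rewrite in_itv/= => tuv; apply: hN => /= h.
have tab : a n <= t <= b n.
  by case/andP: tuv => ut tv; rewrite (le_trans au (ltW ut)) (le_trans tv vb).
have /= := hd t (uvd t tuv).
rewrite -fF// -gG// h ?subrr ?eqxx//.
exact: (exhausted_le eD Da Db).
Qed.

(** If [df/dlam] agrees almost everywhere with a primitive [w] of [h] with
    respect to [m], then [w] is its continuous version and [h] the iterated
    derivative. *)
Lemma primitive_cdd D lam m f w h : exhausted D -> diffuse lam -> diffuse m ->
  charging D lam -> charging D m -> primitive D m w h ->
  w = dd D lam f %[ae lam in D] ->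
  [/\ dd_ll D lam m f, forall x, D x -> cdd D lam m f x = w x &
      ddd D lam m f = h %[ae m in D]].
Proof.
move=> eD hlam hm clam cm hw wE.
have llw : ll D m w := primitive_ll eD hm cm hw.
have ddw : is_dd_version D lam m f w by split.
have [cE llc] : is_dd_version D lam m f (cdd D lam m f).
  exact: (@xgetI _ (dd D lam f) [set w | is_dd_version D lam m f w] w).
have cw : forall x, D x -> cdd D lam m f x = w x.
  apply: (ll_ae_eq eD hm clam llc llw).
  by apply: filterS2 cE wE => x h1 h2 Dx; rewrite h1// h2.
split => //; first by exists w.
apply: primitive_dd => //.
by apply: primitive_eq hw => x Dx; rewrite cw.
Qed.

Lemma dd_ll_primitive D lam m f : exhausted D -> diffuse m -> charging D m ->
  dd_ll D lam m f ->
  cdd D lam m f = dd D lam f %[ae lam in D] /\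
  primitive D m (cdd D lam m f) (ddd D lam m f).
Proof.
move=> eD hm cm [w hw].
have [cE llc] : is_dd_version D lam m f (cdd D lam m f).
  exact: (@xgetI _ (dd D lam f) [set w | is_dd_version D lam m f w] w).
by split => //; exact: ll_dd.
Qed.

End Densities.

(** * Integration by parts *)

Section IntegrationByParts.
Context {R : realType}.
Implicit Types (nu lam m : {measure set R -> \bar R}) (D : set R) (x y : R).
Implicit Types (f g h phi psi w v : R -> R).

Lemma integral_mrestr d (T : measurableType d) (mu : {measure set T -> \bar R})
    (A : set T) (mA : measurable A) (f : T -> \bar R) : measurable_fun setT f ->
  (\int[mrestr mu mA]_z f z = \int[mu]_(z in A) f z)%E.
Proof.
move=> mf; rewrite [LHS]integralE [RHS]integralE; congr (_ - _)%E.
  by apply: ge0_integral_mrestr => //; exact: measurable_funepos.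
by apply: ge0_integral_mrestr => //; exact: measurable_funeneg.
Qed.

Lemma integral_patch nu A B f (c : R) : measurable A -> measurable B -> B `<=` A ->
  nu.-integrable A (EFin \o f) ->
  (\int[nu]_(y in A) (c * (f \_ B) y)%:E = (c * \int[nu]_(y in B) f y)%:E)%E.
Proof.
move=> mA mB BA iA.
have iB : nu.-integrable B (EFin \o f) by exact: integrableS iA.
rewrite EFinM /Rintegral fineK ?integrable_fin_num//.
rewrite -[in RHS](setIidr BA) integral_mkcondr -integralZl//.
  by apply: eq_integral => y _; rewrite EFinM restrict_EFin.
by apply/integrable_restrict => //; rewrite setIidr.
Qed.

(** Fubini's theorem on the triangle [y <= x] of the square of side (a, b]; the
    diagonal is negligible for [lam]. *)
Lemma iterated_integral_swap lam m a b psi h : diffuse lam -> diffuse m ->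
  lam.-integrable `]a, b] (EFin \o psi) -> m.-integrable `]a, b] (EFin \o h) ->
  \int[lam]_(x in `]a, b]) (psi x * \int[m]_(y in `]a, x]) h y) =
  \int[m]_(y in `]a, b]) (h y * \int[lam]_(x in `]y, b]) psi x).
Proof.
move=> hlam hm ipsi ih; pose J := `]a, b]%classic : set R.
have mJ : measurable J by exact: measurable_itv.
pose L : {finite_measure set R -> \bar R} := mfrestr mJ (diffuse_oc_lty a b hlam).
pose M : {finite_measure set R -> \bar R} := mfrestr mJ (diffuse_oc_lty a b hm).
pose psi' := psi \_ J; pose h' := h \_ J.
have mpsi : measurable_fun setT psi'.
  by apply/(measurable_restrictT _ _).1 => //; have /integrableP[/measurable_EFinP] := ipsi.
have mh : measurable_fun setT h'.
  by apply/(measurable_restrictT _ _).1 => //; have /integrableP[/measurable_EFinP] := ih.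
pose E := [set p : R * R | p.2 <= p.1].
have mE : measurable E.
  rewrite -[E]setTI; apply: measurable_fun_le => //; exact: measurable_snd.
(* The integrand on the square, cut off to the triangle. *)
pose k (p : R * R) := psi' p.1 * h' p.2 * \1_E p.
have mk : measurable_fun setT k.
  apply: measurable_funM; last exact: measurable_indic.
  by apply: measurable_funM; [apply: measurableT_comp|apply: measurableT_comp].
have inner1 x : (\int[M]_y (k (x, y))%:E)%E = (psi' x * \int[m]_(y in `]a, x]) h y)%:E.
  rewrite (integral_mrestr m mJ); last first.
    by apply/measurable_EFinP; apply: (measurableT_comp mk); exact: pair1_measurable.
  have [xJ|xJ] := boolP (x \in J); last first.
    rewrite /psi' patchE (negbTE xJ) mul0r; apply: integral0_eq => y _.
    by rewrite /k /psi' /= patchE (negbTE xJ) !mul0r.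
  rewrite -(@integral_patch m J)//.
  - apply: eq_integral => y yJ; rewrite /k/= /h' patchE yJ -mulrA; congr (_ * _)%:E.
    rewrite indicE patchE.
    have -> : ((x, y) \in E) = (y \in `]a, x]%classic).
      apply/idP/idP; rewrite !inE /E /= in_itv/=; last by case/andP.
      by move: yJ; rewrite inE /J /= in_itv/= => /andP[-> _] ->.
    by case: ifP => _; rewrite ?mulr1 ?mulr0.
  - move=> y /=; move: xJ; rewrite inE /J /= !in_itv/= => /andP[_ xb] /andP[-> yx].
    exact: le_trans xb.
have inner2 y : (\int[L]_x (k (x, y))%:E)%E = (h' y * \int[lam]_(x in `]y, b]) psi x)%:E.
  rewrite (integral_mrestr lam mJ); last first.
    by apply/measurable_EFinP; apply: (measurableT_comp mk); exact: pair2_measurable.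
  have [yJ|yJ] := boolP (y \in J); last first.
    rewrite /h' patchE (negbTE yJ) mul0r; apply: integral0_eq => x _.
    by rewrite /k /h' /= patchE (negbTE yJ) mulr0 mul0r.
  have ayb : a < y <= b by move: yJ; rewrite inE /J/= in_itv.
  rewrite -(@integral_patch lam J)//; last first.
    move=> x /=; rewrite /J /= !in_itv/= => /andP[yx ->].
    by case/andP: ayb => ay _; rewrite (lt_trans ay yx).
  have myb : measurable_fun setT (psi \_ `]y, b]).
    apply/(measurable_restrictT _ _).1 => //.
    have /integrableP[/measurable_EFinP + _] := ipsi; apply: measurable_funS => //.
    move=> x /=; rewrite !in_itv/= => /andP[yx ->].
    by case/andP: ayb => ay _; rewrite (lt_trans ay yx).
  apply: ae_eq_integral => //.
  - apply/measurable_EFinP; apply: measurable_funTS; apply: (measurableT_comp mk).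
    exact: pair2_measurable.
  - apply/measurable_EFinP; apply: measurable_funTS; exact: measurable_funM.
  - have ha : {ae lam, forall x, x != y}.
      exists [set y]; split => //; first exact: hlam.2.
      by move=> x /= /negP; rewrite negbK => /eqP.
    apply: filterS ha => x xy xJ /=.
    rewrite /k/= /psi' patchE mem_set// [psi x * _]mulrC -mulrA; congr (_ * _)%:E.
    rewrite indicE patchE.
    have -> : ((x, y) \in E) = (x \in `]y, b]%classic).
      apply/idP/idP; rewrite !inE /E /= in_itv/=; last by case/andP => /ltW.
      by move: xJ; rewrite /J /= in_itv/= => /andP[_ ->]; rewrite andbT lt_neqAle eq_sym xy.
    by case: ifP => _; rewrite ?mulr1 ?mulr0.
pose K := (\int[M]_y `|h' y|%:E)%E.
have Kfin : (K < +oo)%E.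
  rewrite /K (integral_mrestr m mJ); last by apply/measurable_EFinP; exact: measurableT_comp.
  have /integrableP[_] := ih; apply: le_lt_trans.
  rewrite le_eqVlt; apply/orP; left; apply/eqP; apply: eq_integral => y yJ.
  by rewrite /h' patchE yJ.
have K0 : (0 <= K)%E by apply: integral_ge0 => y _; rewrite lee_fin.
have intk : (L \x M)%E.-integrable setT (EFin \o k).
  apply/integrable12ltyP; first exact/measurable_EFinP.
  have mF : measurable_fun setT (fun x => \int[M]_y `|(k (x, y))%:E|)%E.
    apply: (@measurable_fun_fubini_tonelli_F _ _ _ _ _ M (fun p => `|(k p)%:E|%E)) => //.
    by apply: measurableT_comp => //; exact/measurable_EFinP.
  apply: (@le_lt_trans _ _ (\int[L]_x (`|psi' x|%:E * K))%E).
    apply: ge0_le_integral => //.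
    - by move=> x _; apply: integral_ge0.
    - apply: emeasurable_funM; last exact: measurable_cst.
      by apply/measurable_EFinP; exact: measurableT_comp.
    - move=> x _.
      have -> : (`|psi' x|%:E * K = \int[M]_y (`|psi' x|%:E * `|h' y|%:E))%E.
        apply/esym; apply: ge0_integralZl_EFin => //.
        by apply/measurable_EFinP; exact: measurableT_comp.
      apply: ge0_le_integral => //.
      + apply: measurableT_comp => //; apply/measurable_EFinP; apply: (measurableT_comp mk).
        exact: pair1_measurable.
      + apply: emeasurable_funM; first exact: measurable_cst.
        by apply/measurable_EFinP; exact: measurableT_comp.
      + move=> y _ /=; rewrite -EFinM lee_fin /k/= !normrM ler_piMr ?mulr_ge0//.
        by rewrite indicE; case: (_ \in _); rewrite ?normr1 ?normr0.
  rewrite [X in (X < _)%E](_ : _ = ((\int[L]_x `|psi' x|%:E) * K)%E); last first.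
    apply: ge0_integralZr => //.
    by apply/measurable_EFinP; exact: measurableT_comp.
  rewrite lte_mul_pinfty//.
  - by apply: integral_ge0 => x _; rewrite lee_fin.
  - rewrite ge0_fin_numE; last by apply: integral_ge0 => x _; rewrite lee_fin.
    rewrite (integral_mrestr lam mJ); last by apply/measurable_EFinP; exact: measurableT_comp.
    have /integrableP[_] := ipsi; apply: le_lt_trans.
    rewrite le_eqVlt; apply/orP; left; apply/eqP; apply: eq_integral => y yJ.
    by rewrite /psi' patchE yJ.
have := Fubini intk => /=.
under eq_integral do rewrite inner1.
under [X in _ = X -> _]eq_integral do rewrite inner2.
have mF1 : measurable_fun setT (fun x => (psi' x * \int[m]_(y in `]a, x]) h y)%:E).
  rewrite (_ : (fun x => _) = (fun x => \int[M]_y (k (x, y))%:E)%E); last first.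
    by apply/funext => x; rewrite inner1.
  exact: (measurable_fubini_F intk).
have mF2 : measurable_fun setT (fun y => (h' y * \int[lam]_(x in `]y, b]) psi x)%:E).
  rewrite (_ : (fun y => _) = (fun y => \int[L]_x (k (x, y))%:E)%E); last first.
    by apply/funext => y; rewrite inner2.
  exact: (measurable_fubini_G intk).
rewrite (integral_mrestr lam mJ)// (integral_mrestr m mJ)// => eqF.
transitivity (fine (\int[lam]_(x in J) (psi' x * \int[m]_(y in `]a, x]) h y)%:E)%E).
  by congr fine; apply: eq_integral => x xJ; rewrite /psi' patchE xJ.
rewrite eqF; congr fine; apply: eq_integral => y yJ.
by rewrite /h' patchE yJ.
Qed.

Lemma ll_mul_integrable D m nu w phi a b : exhausted D -> diffuse m -> ll D m w ->
  D a -> D b -> a <= b -> nu.-integrable `]a, b] (EFin \o phi) ->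
  nu.-integrable `]a, b] (EFin \o (fun x => w x * phi x)).
Proof.
move=> eD hm llw Da Db ab iphi.
have [F cF wF] := ll_continuous eD hm llw Da Db ab.
have mJ : measurable (`]a, b]%classic : set R) by exact: measurable_itv.
have : nu.-integrable `]a, b] ((EFin \o F) \* (EFin \o phi))%E.
  apply: integrableMr => //.
    by apply: measurable_funTS; exact: continuous_measurable_fun.
  have cF' : {within `[a, b], continuous F} by exact: continuous_subspaceT.
  have /compact_bounded[M [Mr hM]] := continuous_compact cF' (@segment_compact _ a b).
  exists M; split => // y My x /= xab; apply: (hM y My); exists x => //.
  exact: subset_itv_oc_cc xab.
apply: eq_integrable => // x; rewrite inE/= in_itv/= => /andP[ax xb].
by rewrite /= wF// (ltW ax).
Qed.

(** Integration by parts for two primitives with respect to two different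
    diffuse measures. *)
Lemma primitive_by_parts D lam m w h v psi a b : exhausted D ->
  diffuse lam -> diffuse m -> charging D lam -> charging D m ->
  primitive D m w h -> primitive D lam v psi -> D a -> D b -> a <= b ->
  \int[lam]_(x in `]a, b]) (w x * psi x) + \int[m]_(x in `]a, b]) (h x * v x) =
  w b * v b - w a * v a.
Proof.
move=> eD hlam hm clam cm hw hv Da Db ab.
have ipsi := primitive_integrable hv Da Db.
have ih := primitive_integrable hw Da Db.
have llw := primitive_ll eD hm cm hw.
have llv := primitive_ll eD hlam clam hv.
have mJ : measurable (`]a, b]%classic : set R) by exact: measurable_itv.
have iwpsi := ll_mul_integrable eD hm llw Da Db ab ipsi.
have ivh := ll_mul_integrable eD hlam llv Da Db ab ih.
have Dx x : `]a, b]%classic x -> D x.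
  by rewrite /= in_itv/= => /andP[/ltW ax xb]; apply: (exhausted_le eD Da Db); rewrite ax.
have swap := iterated_integral_swap hlam hm ipsi ih.
have [_ Hw] := hw; have [_ Hv] := hv.
have l1 : \int[lam]_(x in `]a, b]) (psi x * \int[m]_(y in `]a, x]) h y) =
    \int[lam]_(x in `]a, b]) (w x * psi x) - w a * (v b - v a).
  have [_ ->] := Hv _ _ Da Db ab.
  rewrite -RintegralZl// -RintegralB//; last first.
    have -> : EFin \o (fun x => w a * psi x) = (fun x => (w a)%:E * (EFin \o psi) x)%E by [].
    exact: integrableZl.
  apply: eq_Rintegral => x; rewrite inE => xab.
  have ax : a <= x by move: xab; rewrite /= in_itv/= => /andP[/ltW].
  by have [_ <-] := Hw _ _ Da (Dx _ xab) ax; rewrite mulrC mulrBl.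
have l2 : \int[m]_(y in `]a, b]) (h y * \int[lam]_(x in `]y, b]) psi x) =
    v b * (w b - w a) - \int[m]_(x in `]a, b]) (h x * v x).
  have [_ ->] := Hw _ _ Da Db ab.
  rewrite -RintegralZl// -RintegralB//; last 2 first.
    have -> : EFin \o (fun x => v b * h x) = (fun x => (v b)%:E * (EFin \o h) x)%E by [].
    exact: integrableZl.
    by apply: eq_integrable ivh => // x _ /=; rewrite mulrC.
  apply: eq_Rintegral => x; rewrite inE => xab.
  have xb : x <= b by move: xab; rewrite /= in_itv/= => /andP[].
  by have [_ <-] := Hv _ _ (Dx _ xab) Db xb; rewrite mulrBr [v b * _]mulrC.
by move: swap; rewrite l1 l2; lra.
Qed.

End IntegrationByParts.

(** * Boundary terms at infinity *)

Section BoundaryTerms.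
Context {R : realType}.
Implicit Types (nu lam m : {measure set R -> \bar R}) (D : set R) (x y : R).
Implicit Types (f g h phi psi w v : R -> R) (b : bool).

(** The point of the half-line [b] at distance [r] from the origin. *)
Definition ray b (r : R) : R := if b then r else - r.

(** The points of the half-line [b] at distance at most [r] from the origin. *)
Definition segment0 b (r : R) : set R :=
  if b then `[0, r]%classic else `[- r, 0]%classic.

(** The points of the half-line [b] at distance between [p] and [r] from the
    origin. Intervals are open on the left for both values of [b], as in
    [primitive], so the endpoint at distance [p] belongs to it only on the
    negative side. *)
Definition annulus b (p r : R) : set R :=
  if b then `]p, r]%classic else `]- r, - p]%classic.

Lemma ray_halfline b r : 0 <= r -> halfline b (ray b r).
Proof. by case: b => r0; rewrite /halfline/= in_itv/= ?r0// oppr_le0. Qed.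

Lemma ray_norm b x : halfline b x -> ray b `|x| = x.
Proof.
case: b; rewrite /halfline/= in_itv/= ?andbT => x0; first by rewrite ger0_norm.
by rewrite ler0_norm// opprK.
Qed.

Lemma segment0E b r x : segment0 b r x <-> halfline b x /\ `|x| <= r.
Proof.
case: b; rewrite /segment0 /halfline/= !in_itv/= ?andbT.
  by split=> [/andP[x0 xr]|[x0]]; rewrite ger0_norm ?x0.
by split=> [/andP[xr x0]|[x0]]; rewrite ler0_norm ?x0 ?andbT 1?lerNl// andbT lerNl.
Qed.

Lemma measurable_segment0 b r : measurable (segment0 b r).
Proof. by case: b; exact: measurable_itv. Qed.

Lemma annulusE b p r x : 0 <= p -> annulus b p r x ->
  [/\ halfline b x, p <= `|x| & `|x| <= r].
Proof.
move=> p0; case: b; rewrite /annulus /halfline/= !in_itv/= ?andbT => /andP[h1 h2].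
  have x0 : 0 <= x by apply: le_trans p0 (ltW h1).
  by rewrite ger0_norm// (ltW h1).
have x0 : x <= 0 by rewrite (le_trans h2)// oppr_le0.
by rewrite ler0_norm//; split => //; [rewrite lerNr|rewrite lerNl; exact: ltW].
Qed.

Lemma annulus_sub b p q r : 0 <= p -> q < p ->
  annulus b p r `<=` halfline b `\` segment0 b q.
Proof.
move=> p0 qp x /(annulusE p0)[hx px _]; split => // /segment0E[_ xq].
by move: (lt_le_trans qp px); rewrite ltNge xq.
Qed.

Lemma integral_cc_oc nu x y (F : R -> \bar R) : diffuse nu -> x <= y ->
  measurable_fun `[x, y] F ->
  (\int[nu]_(t in `[x, y]) F t = \int[nu]_(t in `]x, y]) F t)%E.
Proof.
move=> hnu xy; rewrite -(@setU1itv _ _ _ _ false) ?bnd_simp// => mF.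
rewrite integral_setU//.
  by rewrite null_set_integral ?add0e//; [exact: measurable_fun_set1|exact: hnu.2].
by apply/disj_setPLR => t /= -> /=; rewrite in_itv/= ltxx.
Qed.

Lemma integral_tail b nu f (e : R) :
  nu.-integrable (halfline b) (EFin \o f) -> 0 < e ->
  exists2 N : R, 0 <= N & forall r, N <= r ->
    `|\int[nu]_(x in halfline b) f x - \int[nu]_(x in segment0 b r) f x| < e /\
    \int[nu]_(x in halfline b `\` segment0 b r) `|f x| < e.
Proof.
move=> iF e0.
have mh := @measurable_halfline R b.
have ms r := @measurable_segment0 b r.
have ss r : segment0 b r `<=` halfline b by move=> x /segment0E[].
have iN : nu.-integrable (halfline b) (EFin \o (fun x => `|f x|)) by exact: integrable_norm.
have mN : measurable_fun (halfline b) (fun x => `|f x|).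
  by have /integrableP[/measurable_EFinP] := iN.
have cvgN : (\int[nu]_(x in segment0 b n%:R) `|f x|%:E @[n --> \oo] -->
    \int[nu]_(x in halfline b) `|f x|%:E)%E.
  have -> : halfline b = \bigcup_n segment0 b (n%:R).
    apply/seteqP; split => x; last by move=> [n _ /segment0E[]].
    move=> hx; exists (Num.bound `|x|) => //; apply/segment0E; split => //.
    by apply/ltW/archi_boundP.
  apply: ge0_nondecreasing_set_cvg_integral => //.
  - move=> n k nk; apply/subsetPset => x /segment0E[hx xn]; apply/segment0E; split => //.
    by apply: le_trans xn _; rewrite ler_nat.
  - move=> n; apply: measurable_funS (ss _) _ => //.
    exact/measurable_EFinP.
have fin A : measurable A -> A `<=` halfline b ->
    (\int[nu]_(x in A) `|f x|%:E)%E \is a fin_num.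
  by move=> mA Ah; apply: integrable_fin_num => //; exact: integrableS iN.
have [N hN] : exists N : nat, \int[nu]_(x in halfline b) `|f x| -
     \int[nu]_(x in segment0 b N%:R) `|f x| < e.
  move: cvgN; rewrite -(fineK (fin _ mh (@subset_refl _ _))) => /fine_cvgP[_ /cvgrPdist_lt/(_ e e0)[N _ hN]].
  exists N; apply: le_lt_trans (ler_norm _) _.
  exact: (hN N (leqnn N)).
exists N%:R => // r Nr.
have iD : nu.-integrable (halfline b `\` segment0 b r) (EFin \o (fun x => `|f x|)).
  by apply: integrableS iN => //; exact: measurableD.
have splitI (F : R -> R) : nu.-integrable (halfline b) (EFin \o F) ->
    \int[nu]_(x in halfline b) F x = \int[nu]_(x in segment0 b r) F x +
      \int[nu]_(x in halfline b `\` segment0 b r) F x.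
  move=> iF'; rewrite -[in LHS](setDUK (ss r)) Rintegral_setU//.
  - exact: measurableD.
  - by rewrite setDUK.
  - by apply/disj_setPLR => x sx [_].
have tl : \int[nu]_(x in halfline b `\` segment0 b r) `|f x| < e.
  apply: le_lt_trans hN; rewrite (splitI _ iN) [leRHS]addrAC lerDr subr_ge0.
  rewrite -lee_fin !fineK ?fin//.
  apply: ge0_subset_integral => //.
    by apply/measurable_EFinP; apply: measurable_funS mN.
  by move=> x /segment0E[hx xn]; apply/segment0E; split => //; exact: le_trans Nr.
split => //.
have -> : \int[nu]_(x in halfline b) f x - \int[nu]_(x in segment0 b r) f x =
   \int[nu]_(x in halfline b `\` segment0 b r) f x.
  by rewrite (splitI _ iF) addrAC subrr add0r.
apply: le_lt_trans tl; apply: le_normr_Rintegral; first exact: measurableD.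
by apply: integrableS iF => //; exact: measurableD.
Qed.

Lemma integrableZl_EFin nu A (c : R) f : measurable A ->
  nu.-integrable A (EFin \o f) -> nu.-integrable A (EFin \o (fun x => c * f x)).
Proof.
move=> mA iF; have -> : EFin \o (fun x => c * f x) = (fun x => c%:E * (EFin \o f) x)%E by [].
exact: integrableZl.
Qed.

(** The sign of the nonzero points of the half-line [b]. *)
Definition orient b : R := if b then 1 else -1.

Lemma segment0_by_parts b lam m w h v psi r : diffuse lam -> diffuse m ->
  charging (halfline b) lam -> charging (halfline b) m ->
  primitive (halfline b) m w h -> primitive (halfline b) lam v psi ->
  lam.-integrable (halfline b) (EFin \o (fun x => w x * psi x)) ->
  m.-integrable (halfline b) (EFin \o (fun x => h x * v x)) ->
  0 <= r ->
  \int[lam]_(x in segment0 b r) (w x * psi x) +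
  \int[m]_(x in segment0 b r) (h x * v x) =
  orient b * (w (ray b r) * v (ray b r) - w 0 * v 0).
Proof.
move=> hlam hm clam cm hw hv i1 i2 r0.
have eD := @halfline_exhausted R b.
have Dr := ray_halfline b r0; have D0 := exhausted0 eD.
have meas nu F : nu.-integrable (halfline b) (EFin \o F) -> measurable_fun (segment0 b r) (EFin \o F).
  move=> /integrableP[mF _]; apply: measurable_funS mF; first exact: measurable_halfline.
  by move=> x /segment0E[].
have := meas _ _ i1; have := meas _ _ i2.
rewrite /Rintegral; case: b hw hv i1 i2 clam cm eD Dr D0 meas => hw hv i1 i2 clam cm eD Dr D0 _ m2 m1.
  rewrite /segment0 /orient /ray mul1r !integral_cc_oc//.
  exact: (primitive_by_parts eD hlam hm clam cm hw hv).
rewrite /segment0 /orient /ray mulN1r opprB !integral_cc_oc ?oppr_le0//.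
by apply: (primitive_by_parts eD hlam hm clam cm hw hv) => //; rewrite oppr_le0.
Qed.

Lemma primitive_ray_le b nu v psi p t : primitive (halfline b) nu v psi ->
  0 <= p -> p <= t ->
  nu.-integrable (annulus b p t) (EFin \o psi) /\
  `|v (ray b t) - v (ray b p)| <= \int[nu]_(x in annulus b p t) `|psi x|.
Proof.
move=> hv p0 pt; have t0 := le_trans p0 pt.
have := ray_halfline b p0; have := ray_halfline b t0; case: b hv => -[mv hv]; rewrite /ray/= => Dt Dp.
  have [ii ->] := hv _ _ Dp Dt pt; split => //.
  by apply: le_normr_Rintegral => //; exact: measurable_itv.
have [|ii] := hv _ _ Dt Dp; first by rewrite lerN2.
rewrite distrC => ->; split => //.
by apply: le_normr_Rintegral => //; exact: measurable_itv.
Qed.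

Lemma ray_continuous b nu v p t : diffuse nu -> ll (halfline b) nu v ->
  0 <= p -> p <= t ->
  exists2 F, continuous F & forall u, p <= u <= t -> v (ray b u) = F u.
Proof.
move=> hnu llv p0 pt; have t0 := le_trans p0 pt.
have eD := @halfline_exhausted R b.
have := ray_halfline b p0; have := ray_halfline b t0; case: b llv eD => llv eD; rewrite /ray/= => Dt Dp.
  exact: (ll_continuous eD hnu llv).
have Ntp : - t <= - p by rewrite lerN2.
have [F cF vF] := ll_continuous eD hnu llv Dt Dp Ntp.
exists (F \o -%R) => [u|u /andP[pu ut]].
  by apply: continuous_comp; [exact: opp_continuous|exact: cF].
by rewrite vF// !lerN2 ut.
Qed.

(** Where [|w v|] is bounded below by [c] and the integral of [|w psi|] is at
    most [c / 4], [v] is almost constant. If [M] is the maximum of [|v|]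
    at distances from [p] to [t], then [c |psi| <= |w v| |psi| <= M |w psi|], so
    [v] differs from [v (ray b p)] by at most [M / 4] there. *)
Lemma ray_almost_constant b nu w v psi (c p : R) : diffuse nu ->
  ll (halfline b) nu v -> primitive (halfline b) nu v psi -> 0 < c -> 0 <= p ->
  (forall r, p <= r -> c <= `|w (ray b r) * v (ray b r)|) ->
  (forall t, p <= t -> nu.-integrable (annulus b p t) (EFin \o (fun x => w x * psi x)) /\
    \int[nu]_(x in annulus b p t) `|w x * psi x| <= c / 4) ->
  forall t, p <= t -> `|v (ray b t) - v (ray b p)| <= `|v (ray b p)| / 3.
Proof.
move=> hnu llv hv c0 p0 lb small t pt.
have [F cF vF] := ray_continuous hnu llv p0 pt.
have [u] : exists2 u, u \in `[p, t] & forall r, r \in `[p, t] -> `|F r| <= `|F u|.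
  apply: EVT_max => //; apply: continuous_subspaceT => x.
  by apply: continuous_comp; [exact: cF|exact: norm_continuous].
rewrite in_itv/= => put maxu.
have key q : p <= q <= t -> `|v (ray b q) - v (ray b p)| <= `|v (ray b u)| / 4.
  move=> /andP[pq qt]; have [ipsi le1] := primitive_ray_le hv p0 pq.
  have [iwp le2] := small q pq.
  have mA : measurable (annulus b p q) by case: (b); exact: measurable_itv.
  suff : c * \int[nu]_(x in annulus b p q) `|psi x| <= `|v (ray b u)| * (c / 4).
    rewrite mulrCA ler_pM2l// => h; exact: le_trans le1 h.
  apply: le_trans (ler_wpM2l (normr_ge0 _) le2).
  have in1 := integrable_norm ipsi; have in2 := integrable_norm iwp.
  rewrite -!RintegralZl//; apply: le_Rintegral => //.
  - exact: integrableZl_EFin.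
  - exact: integrableZl_EFin.
  - move=> x xA; have [hx px xq] := annulusE p0 xA.
    have := lb _ px; rewrite (ray_norm hx) => h1.
    have vxu : `|v x| <= `|v (ray b u)|.
      have := maxu `|x|; rewrite in_itv/= px (le_trans xq qt) => /(_ isT).
      by rewrite -!vF ?px ?(le_trans xq qt)// (ray_norm hx).
    apply: (@le_trans _ _ (`|w x * v x| * `|psi x|)); first by rewrite ler_wpM2r.
    by rewrite !normrM mulrAC [leRHS]mulrC ler_wpM2l ?mulr_ge0.
have hu := key u put.
have ht : `|v (ray b t) - v (ray b p)| <= `|v (ray b u)| / 4.
  by apply: key; rewrite pt lexx.
have := ler_normD (v (ray b u) - v (ray b p)) (v (ray b p)); rewrite subrK.
by move: hu ht; lra.
Qed.

Lemma infty_ray b (P : R -> Prop) (p : R) : (\forall x \near infty b, P x) -> 0 <= p ->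
  exists2 t, p <= t & P (ray b t).
Proof.
case: b => -[M [_ hM]] p0; exists (Num.max p (`|M| + 1)); rewrite ?le_max ?lexx//; apply: hM; rewrite /ray.
  by rewrite lt_max; apply/orP; right; apply: le_lt_trans (ler_norm _) _; rewrite ltrDl.
rewrite ltrNl lt_max; apply/orP; right.
by apply: le_lt_trans (ler_norm _) _; rewrite normrN ltrDl.
Qed.

Lemma tail_infinite b lam p : diffuse lam -> ~ (lam (halfline b) < +oo)%E ->
  lam (halfline b `\` segment0 b p) = +oo%E.
Proof.
move=> hlam; have mh := @measurable_halfline R b.
have ms := @measurable_segment0 b p.
have ss : segment0 b p `<=` halfline b by move=> x /segment0E[].
move/negP; rewrite -leNgt leye_eq => /eqP hinf; apply/eqP; rewrite -leye_eq leNgt; apply/negP => tfin.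
suff : (lam (halfline b) < +oo)%E by rewrite hinf ltxx.
rewrite -(setDUK ss); apply: le_lt_trans (measureU2 _ _ _) _ => //.
  exact: measurableD.
apply: lte_add_pinfty => //.
by case: (b); exact: hlam.1.
Qed.

(** Integration by parts on a half-line, without boundary term at infinity when
    [w] is square integrable and [v] vanishes at infinity if [lam] is finite. *)
Lemma boundary_by_parts b lam m w h v psi : diffuse lam -> diffuse m ->
  charging (halfline b) lam -> charging (halfline b) m ->
  primitive (halfline b) m w h -> primitive (halfline b) lam v psi ->
  lam.-integrable (halfline b) (EFin \o (fun x => w x ^+ 2)) ->
  lam.-integrable (halfline b) (EFin \o (fun x => w x * psi x)) ->
  m.-integrable (halfline b) (EFin \o (fun x => h x * v x)) ->
  ((lam (halfline b) < +oo)%E -> v @ infty b --> (0 : R)) ->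
  \int[lam]_(x in halfline b) (w x * psi x) +
  \int[m]_(x in halfline b) (h x * v x) = - orient b * (w 0 * v 0).
Proof.
move=> hlam hm clam cm hw hv iw2 iwp ihv van.
have eD := @halfline_exhausted R b.
have llv := primitive_ll eD hlam clam hv.
have mh := @measurable_halfline R b.
have oo : orient b * orient b = 1 :> R by rewrite /orient; case: (b); rewrite ?mulr1// mulrNN mulr1.
have on : `|orient b| = 1 :> R by rewrite /orient; case: (b); rewrite ?normrN normr1.
set I1 := \int[lam]_(x in halfline b) _; set I2 := \int[m]_(x in halfline b) _.
(* [c0] is the limit of [w v] at infinity; it is assumed nonzero below. *)
pose c0 := w 0 * v 0 + orient b * (I1 + I2).
suff : c0 = 0.
  rewrite /c0 => /eqP; rewrite addrC addr_eq0 => /eqP h0.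
  by rewrite mulNr -mulrN -h0 mulrA oo mul1r.
apply: contrapT => /eqP c00; have nc0 : 0 < `|c0| by rewrite normr_gt0.
have e0 : 0 < `|c0| / 8 by rewrite divr_gt0.
have [N1 N10 tail1] := integral_tail iwp e0.
have [N2 N20 tail2] := integral_tail ihv e0.
pose N := Num.max N1 N2; pose p := N + 1.
have N1N : N1 <= N by rewrite le_max lexx.
have N2N : N2 <= N by rewrite le_max lexx orbT.
have N0 : 0 <= N by exact: le_trans N1N.
have p0 : 0 <= p by rewrite addr_ge0.
have c2 : 0 < `|c0| / 2 by rewrite divr_gt0.
have lb r : p <= r -> `|c0| / 2 <= `|w (ray b r) * v (ray b r)|.
  move=> pr; have r0 := le_trans p0 pr.
  have Nr : N <= r by apply: le_trans pr; rewrite lerDl.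
  have [/= t1 _] := tail1 r (le_trans N1N Nr).
  have [/= t2 _] := tail2 r (le_trans N2N Nr).
  have bp := segment0_by_parts hlam hm clam cm hw hv iwp ihv r0.
  have Ac : `|c0 - w (ray b r) * v (ray b r)| <= `|c0| / 4.
    have -> : c0 - w (ray b r) * v (ray b r) = orient b * ((I1 + I2) -
       (\int[lam]_(x in segment0 b r) (w x * psi x) + \int[m]_(x in segment0 b r) (h x * v x))).
      by rewrite bp mulrBr mulrA oo mul1r /c0; lra.
    rewrite normrM on mul1r opprD addrACA.
    by apply: le_trans (ler_normD _ _) _; move: t1 t2; rewrite -/I1 -/I2; lra.
  have := ler_normD (c0 - w (ray b r) * v (ray b r)) (w (ray b r) * v (ray b r)).
  by rewrite subrK; move: Ac; lra.
have small t : p <= t -> lam.-integrable (annulus b p t) (EFin \o (fun x => w x * psi x)) /\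
    \int[lam]_(x in annulus b p t) `|w x * psi x| <= `|c0| / 2 / 4.
  move=> pt.
  have asub : annulus b p t `<=` halfline b `\` segment0 b N by apply: annulus_sub => //; rewrite ltrDl.
  have mA : measurable (annulus b p t) by case: (b); exact: measurable_itv.
  have mT : measurable (halfline b `\` segment0 b N) by apply: measurableD => //; exact: measurable_segment0.
  have ia : lam.-integrable (annulus b p t) (EFin \o (fun x => w x * psi x)).
    by apply: integrableS iwp => // x /asub[].
  have it : lam.-integrable (halfline b `\` segment0 b N) (EFin \o (fun x => w x * psi x)).
    by apply: integrableS iwp => // x [].
  split => //.
  have ina := integrable_norm ia; have int := integrable_norm it.
  have [_ /ltW] := tail1 N N1N.
  move=> h1; have -> : `|c0| / 2 / 4 = `|c0| / 8 by rewrite -mulrA -invfM -natrM.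
  apply: le_trans h1; rewrite -lee_fin !fineK; try exact: integrable_fin_num.
  apply: ge0_subset_integral => //.
  by have /integrableP[] := int.
have ac := ray_almost_constant hlam llv hv c2 p0 lb small.
set V := `|v (ray b p)| in ac.
have V0 : 0 < V.
  rewrite normr_gt0; apply/negP => /eqP vp0.
  by have := lb p (lexx _); rewrite vp0 mulr0 normr0 leNgt c2.
(* If [lam] is finite, [v] tends to [0], but it stays close to [v (ray b p)]. *)
have [lfin|linf] := pselect (lam (halfline b) < +oo)%E.
  have V2 : 0 < V / 2 by rewrite divr_gt0.
  have vnear : \forall t \near infty b, `|0 - v t| < V / 2.
    by move: (van lfin); case: (b) => /cvgrPdist_lt; apply.
  have [t pt] := infty_ray vnear p0.
  rewrite sub0r normrN => vt; have := ac t pt.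
  have := ler_normD (v (ray b p) - v (ray b t)) (v (ray b t)); rewrite subrK distrC -/V.
  by move: vt V0; lra.
(* Otherwise [|w| >= d] on a set of infinite measure, since [|w v| >= |c0| / 2]
   and [|v| <= 2 V] there. *)
pose d := `|c0| / 2 / (V * 2).
have d0 : 0 < d by rewrite divr_gt0// mulr_gt0.
pose T := halfline b `\` segment0 b p.
have mT : measurable T by apply: measurableD => //; exact: measurable_segment0.
have wlb x : T x -> d ^+ 2 <= w x ^+ 2.
  move=> [hx /segment0E nx]; have px : p <= `|x|.
    by rewrite leNgt; apply/negP => xp; apply: nx; split => //; exact: ltW.
  rewrite -[leRHS]real_normK ?num_real//; apply: lerXn2r; rewrite ?nnegrE ?(ltW d0)//.
  have := lb _ px; rewrite (ray_norm hx) normrM => h1.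
  have := ac _ px; rewrite (ray_norm hx) => h2.
  have vx : `|v x| <= V * 2.
    have := ler_normD (v x - v (ray b p)) (v (ray b p)); rewrite subrK -/V.
    by move: h2 V0; lra.
  by rewrite /d ler_pdivrMr ?mulr_gt0//; apply: le_trans h1 _; rewrite ler_wpM2l.
have iT : lam.-integrable T (EFin \o (fun x => w x ^+ 2)).
  by apply: integrableS iw2 => // x [].
have : (\int[lam]_(x in T) (d ^+ 2)%:E <= \int[lam]_(x in T) (w x ^+ 2)%:E)%E.
  apply: ge0_le_integral => //.
  - by move=> x _; rewrite lee_fin sqr_ge0.
  - by have /integrableP[] := iT.
have := integrable_fin_num mT iT.
rewrite integral_cst// tail_infinite// gt0_muley ?lte_fin ?exprn_gt0//.
by rewrite leye_eq fin_numE => /andP[_ /negP] + /eqP h1; rewrite -h1.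
Qed.

End BoundaryTerms.

(** * Square integrable functions, form domains and Green's formula *)

Section SquareIntegrable.
Context {R : realType} {d : measure_display} {T : measurableType d}.
Context (mu : {measure set T -> \bar R}) (D : set T) (mD : measurable D).

Lemma L2P (f : T -> R) : L2 mu D f <->
  measurable_fun D f /\ mu.-integrable D (EFin \o (fun x => f x ^+ 2)).
Proof.
have sq : (EFin \o (fun x => f x ^+ 2)) \_ D = EFin \o (fun x => (f \_ D) x ^+ 2).
  apply/funext => x; rewrite /= !patchE; case: ifP => //= _.
  by rewrite expr2 mul0r.
split=> [Lf|[mf i2]].
  split; last by apply/(integrable_mkcond _ mD).2; rewrite sq; exact: Lfun2_integrable_sqr.
  apply/(measurable_restrictT _ mD).2.
  by move: Lf; rewrite /L2/= inE => /andP[]; rewrite inE.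
have mfD : measurable_fun setT (f \_ D) by exact/(measurable_restrictT _ mD).1.
rewrite /L2/= inE; apply/andP; split; first by rewrite inE.
rewrite inE/= /finite_norm unlock/=; apply: poweR_lty.
have := (integrable_mkcond _ mD).1 i2; rewrite sq => /integrableP[_].
apply: le_lt_trans; rewrite le_eqVlt; apply/orP; left; apply/eqP.
apply: eq_integral => x _ /=; rewrite powR_mulrn ?normr_ge0// real_normK ?num_real//.
by rewrite ger0_norm ?sqr_ge0.
Qed.

Lemma integrable_sqr_mul (f g : T -> R) :
  measurable_fun D f -> measurable_fun D g ->
  mu.-integrable D (EFin \o (fun x => f x ^+ 2)) ->
  mu.-integrable D (EFin \o (fun x => g x ^+ 2)) ->
  mu.-integrable D (EFin \o (fun x => f x * g x)).
Proof.
move=> mf mg i1 i2; have i12 := integrableD mD i1 i2.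
apply: le_integrable i12 => //; first by apply/measurable_EFinP; exact: measurable_funM.
move=> x Dx /=; rewrite lee_fin [leRHS]ger0_norm ?addr_ge0 ?sqr_ge0//.
have := sqr_ge0 (`|f x| - `|g x|); rewrite sqrrB !real_normK ?num_real// normrM.
have : 0 <= `|f x| * `|g x| by rewrite mulr_ge0.
by lra.
Qed.

Lemma ae_eq_integrable (f g : T -> R) : measurable_fun D g ->
  f = g %[ae mu in D] -> mu.-integrable D (EFin \o f) -> mu.-integrable D (EFin \o g).
Proof.
move=> mg fg /integrableP[mf i1]; apply/integrableP; split; first exact/measurable_EFinP.
apply: le_lt_trans i1; rewrite le_eqVlt; apply/orP; left; apply/eqP.
apply: ae_eq_integral => //.
- by apply: measurableT_comp => //; exact/measurable_EFinP.
- exact: measurableT_comp.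
- by apply: filterS fg => x /= h /h ->.
Qed.

Lemma ae_eq_Rintegral (f g : T -> R) : measurable_fun D f -> measurable_fun D g ->
  f = g %[ae mu in D] -> \int[mu]_(x in D) f x = \int[mu]_(x in D) g x.
Proof.
move=> mf mg fg; rewrite /Rintegral; congr fine; apply: ae_eq_integral => //.
- exact/measurable_EFinP.
- exact/measurable_EFinP.
- by apply: filterS fg => x /= h /h ->.
Qed.

End SquareIntegrable.

Section FormDomain.
Context {R : realType}.
Implicit Types (nu lam m : {measure set R -> \bar R}) (D : set R) (x y : R).
Implicit Types (f g h phi psi w v u : R -> R) (b : bool).

(** The common shape of the form domains on a half-line and on the line: a
    boundary condition is imposed at each infinite end of [D]. *)
Definition form_dom D m lam f : Prop :=
  [/\ L2 m D f, ll D lam f, finite_energy D lam f &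
      forall b, halfline b `<=` D -> (lam (halfline b) < +oo)%E ->
        f @ infty b --> (0 : R)].

Lemma primitive_sub D D' nu f phi : measurable D -> D' `<=` D ->
  primitive D nu f phi -> primitive D' nu f phi.
Proof.
move=> mD sub [mphi H]; split; first exact: measurable_funS mphi.
by move=> x y /sub Dx /sub Dy; exact: H.
Qed.

Lemma charging_sub D D' nu : D' `<=` D -> charging D nu -> charging D' nu.
Proof. by move=> sub H x y /sub Dx /sub Dy; exact: H. Qed.

Lemma energy_integrable D nu f : exhausted D -> diffuse nu -> charging D nu ->
  ll D nu f -> finite_energy D nu f ->
  nu.-integrable D (EFin \o (fun x => dd D nu f x ^+ 2)).
Proof.
move=> eD hnu cnu llf fe; have [mdd _] := ll_dd eD hnu cnu llf.
apply/integrableP; split.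
  by apply/measurable_EFinP; exact: measurable_funX.
apply: le_lt_trans fe; rewrite le_eqVlt; apply/orP; left; apply/eqP.
by apply: eq_integral => x _ /=; rewrite ger0_norm ?sqr_ge0.
Qed.

Lemma ll_measurable D nu f : exhausted D -> diffuse nu -> ll D nu f ->
  measurable_fun D f.
Proof.
move=> eD hnu llf; have [a [b [ab Da Db DE]]] := exhausted_bigcup eD.
rewrite [X in measurable_fun X _]DE; apply/measurable_fun_bigcup => // n.
have [F cF fF] := ll_continuous eD hnu llf (Da n) (Db n) (ltW (ab n)).
apply: (@eq_measurable_fun _ _ _ _ _ F).
  by move=> x; rewrite inE /= in_itv/= => xab; rewrite fF.
by apply: measurable_funTS; exact: continuous_measurable_fun.
Qed.

Lemma Rintegral_line nu f : diffuse nu -> nu.-integrable setT (EFin \o f) ->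
  \int[nu]_x f x = \int[nu]_(x in halfline true) f x + \int[nu]_(x in halfline false) f x.
Proof.
move=> hnu i1; have it b : nu.-integrable (halfline b) (EFin \o f).
  by apply: integrableS i1 => //; exact: measurable_halfline.
have e1 : (\int[nu]_(x in halfline true) (f x)%:E = \int[nu]_(x in `]0%R, +oo[) (f x)%:E)%E.
  rewrite /halfline -(@setU1itv _ _ _ _ false) ?bnd_simp// integral_setU//.
  - by rewrite null_set_integral ?add0e//; [exact: measurable_fun_set1|exact: hnu.2].
  - have /integrableP[m1 _] := i1; exact: measurable_funTS.
  - by apply/disj_setPLR => t /= -> /=; rewrite in_itv/= ltxx.
have hT : halfline false `|` `]0, +oo[ = [set: R].
  by apply/seteqP; split => // t _; rewrite /halfline/= !in_itv/= andbT; case: (leP t 0) => h; [left|right].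
rewrite [in X in _ = X + _]/Rintegral e1 -/(Rintegral _ _ _) addrC -Rintegral_setU ?hT//.
- exact: measurable_halfline.
- by apply/disj_setPLR => t /=; rewrite !in_itv/= andbT => /le_gtF ->.
Qed.

(** Green's formula on a half-line contained in [D]. *)
Lemma green_halfline b D m lam u v : exhausted D -> halfline b `<=` D ->
  diffuse lam -> diffuse m -> charging D lam -> charging D m ->
  form_dom D m lam u -> form_dom D m lam v -> dd_ll D lam m u ->
  L2 m D (ddd D lam m u) ->
  \int[lam]_(x in halfline b) (dd D lam u x * dd D lam v x) +
  \int[m]_(x in halfline b) (ddd D lam m u x * v x) =
  - orient b * (cdd D lam m u 0 * v 0).
Proof.
move=> eD hD hlam hm clam cm [uL2 llu feu vu] [vL2 llv fev vv] du L2h.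
have mD := exhausted_measurable eD; have mh := @measurable_halfline R b.
have [wE hw] := dd_ll_primitive eD hm cm du.
have hv := ll_dd eD hlam clam llv; have hu := ll_dd eD hlam clam llu.
have llw := primitive_ll eD hm cm hw.
set w := cdd D lam m u in wE hw llw *; set h := ddd D lam m u in hw L2h *.
have mw : measurable_fun D w.
  exact: (ll_measurable eD hm).
have iu2 := energy_integrable eD hlam clam llu feu.
have iv2 := energy_integrable eD hlam clam llv fev.
have iw2 : lam.-integrable D (EFin \o (fun x => w x ^+ 2)).
  apply: (ae_eq_integrable mD _ _ iu2); first exact: measurable_funX.
  by apply: filterS wE => x /= H /H ->.
have [mu_ _] := hu; have [mv_ _] := hv; have [mh_ _] := hw.
have iwv := integrable_sqr_mul mD mw mv_ iw2 iv2.
have [_ ih2] := (L2P m mD h).1 L2h; have [mv iv] := (L2P m mD v).1 vL2.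
have ihv := integrable_sqr_mul mD mh_ mv ih2 iv.
have -> : \int[lam]_(x in halfline b) (dd D lam u x * dd D lam v x) =
   \int[lam]_(x in halfline b) (w x * dd D lam v x).
  apply: ae_eq_Rintegral => //.
  - by apply: measurable_funM; apply: measurable_funS (hD) _ => //.
  - by apply: measurable_funM; apply: measurable_funS (hD) _ => //.
  - by apply: filterS wE => x H /hD /H ->.
apply: boundary_by_parts => //.
- exact: charging_sub clam.
- exact: charging_sub cm.
- exact: primitive_sub hw.
- exact: primitive_sub hv.
- exact: integrableS iw2.
- exact: integrableS iwv.
- exact: integrableS ihv.
- exact: vv.
Qed.

End FormDomain.

(** * Test functions *)

Section TestFunctions.
Context {R : realType}.
Implicit Types (nu lam m : {measure set R -> \bar R}) (D : set R) (x y : R).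
Implicit Types (f g h phi psi w v u : R -> R) (b : bool).

(** A primitive of the indicator of (x, y], for [x <= y]. *)
Definition ramp nu x y (t : R) : R := distr_fun nu (clamp x y t).

Lemma ramp_continuous nu x y : diffuse nu -> continuous (ramp nu x y).
Proof.
move=> hnu t; apply: continuous_comp; last exact: distr_fun_continuous.
apply: continuous_min; last exact: cst_continuous.
by apply: continuous_max; [exact: cst_continuous|].
Qed.

Lemma Rintegral_indic nu A B : measurable A -> measurable B ->
  \int[nu]_(t in A) \1_B t = fine (nu (B `&` A)).
Proof. by move=> mA mB; rewrite /Rintegral integral_indic. Qed.

Lemma ramp_primitive D nu x y : exhausted D -> diffuse nu -> x <= y ->
  primitive D nu (ramp nu x y) \1_(`]x, y]%classic).
Proof.
move=> eD hnu xy; split.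
  by apply: measurable_funTS; apply: measurable_indic; exact: measurable_itv.
move=> a b Da Db ab; split.
  apply/integrableP; split.
    by apply/measurable_EFinP; apply: measurable_funTS; apply: measurable_indic; exact: measurable_itv.
  apply: (@le_lt_trans _ _ (\int[nu]_(t in `]a, b]) cst 1 t)%E).
    apply: ge0_le_integral => //.
    - by apply/measurable_EFinP; apply: measurableT_comp.
    - move=> t _ /=; rewrite lee_fin indicE.
      by case: (_ \in _); rewrite ?normr1 ?normr0.
  by rewrite integral_cst// mul1e; exact: diffuse_oc_lty.
rewrite Rintegral_indic//; try exact: measurable_itv.
rewrite /ramp -[LHS]/(fine (_)%:E) distr_funB ?clamp_nd//; congr (fine (nu _)).
apply/seteqP; split => t /=; rewrite !in_itv/= /clamp gt_min gt_max le_min le_max;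
  rewrite (leNgt t x) (ltNge y t); case: (x < t); case: (a < t); case: (t <= y);
  by case: (t <= b) => // -[].
Qed.

Lemma Rintegral_outside nu D A f : A `<=` D -> (forall x, D x -> ~ A x -> f x = 0) ->
  \int[nu]_(x in D) f x = \int[nu]_(x in A) f x.
Proof.
move=> AD f0; rewrite Rintegral_mkcond [RHS]Rintegral_mkcond; congr Rintegral.
apply/funext => x; rewrite !patchE.
have [xA|xA] := boolP (x \in A).
  by rewrite mem_set//; apply: AD; rewrite inE in xA.
case: ifP => // xD; apply: f0; first by rewrite inE in xD.
by move=> Ax; move: xA; rewrite mem_set.
Qed.

Lemma Rintegral_cc_oc nu x y f : diffuse nu -> x <= y -> measurable_fun `[x, y] f ->
  \int[nu]_(t in `[x, y]) f t = \int[nu]_(t in `]x, y]) f t.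
Proof. by move=> hnu xy mf; rewrite /Rintegral integral_cc_oc//; exact/measurable_EFinP. Qed.

(** Primitives of bounded functions that vanish, together with their density,
    outside a compact subinterval of [D] belong to the form domain. *)
Lemma compact_support_form_dom D m lam v psi (M p q : R) : exhausted D ->
  diffuse lam -> diffuse m -> charging D lam -> continuous v ->
  primitive D lam v psi -> (forall t, `|psi t| <= M) -> D p -> D q -> p <= q ->
  (forall t, D t -> ~ `[p, q]%classic t -> v t = 0 /\ psi t = 0) ->
  form_dom D m lam v.
Proof.
move=> eD hlam hm clam cv hv psiM Dp Dq pq out.
have mD := exhausted_measurable eD.
have mv : measurable_fun setT v by exact: continuous_measurable_fun.
have llv := primitive_ll eD hlam clam hv.
have K : `[p, q] `<=` D by exact: exhausted_sub.
have fin nu (F : R -> R) : diffuse nu -> measurable_fun D F -> (exists B, forall t, `[p, q]%classic t -> `|F t| <= B) ->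
    (forall t, D t -> ~ `[p, q]%classic t -> F t = 0) -> nu.-integrable D (EFin \o F).
  move=> hnu mF [B hB] F0.
  apply/integrable_mkcond => //.
  have -> : (EFin \o F) \_ D = (EFin \o F) \_ `[p, q].
    apply/funext => x; rewrite !patchE; have [xA|xA] := boolP (x \in `[p, q]%classic).
      by rewrite mem_set//; apply: K; rewrite inE in xA.
    case: ifP => // xD; rewrite /= F0//; first by rewrite inE in xD.
    by move=> Ax; move: xA; rewrite mem_set.
  apply/(integrable_mkcond _ (measurable_itv _)).1.
  apply: measurable_bounded_integrable; first exact: measurable_itv.
  - exact: hnu.1.
  - exact: measurable_funS mF.
  - exists B; split; first exact: num_real.
    by move=> z Bz t tpq; exact: le_trans (hB t tpq) (ltW Bz).
split => //.
- apply/L2P => //; split; first exact: measurable_funTS.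
  apply: fin => //; first by apply: measurable_funTS; exact: measurable_funX.
    have [M' [_ hM']] : bounded_set [set v x | x in `[p, q]].
      apply: compact_bounded; apply: continuous_compact; last exact: segment_compact.
      exact: continuous_subspaceT.
    exists ((`|M'| + 1) ^+ 2) => t tpq; rewrite normrX; apply: lerXn2r; rewrite ?nnegrE ?addr_ge0//.
    by apply: (hM' (`|M'| + 1)); [apply: le_lt_trans (ler_norm _) _; rewrite ltrDl|exists t].
  by move=> t Dt nt; rewrite (out _ Dt nt).1 expr0n.
- have : lam.-integrable D (EFin \o (fun x => dd D lam v x ^+ 2)).
    have mpsi := hv.1.
    apply: (@ae_eq_integrable _ _ _ lam D mD (fun t => psi t ^+ 2)).
    + by apply: measurable_funX; have [] := ll_dd eD hlam clam llv.
    + by have := primitive_dd eD hlam clam hv; apply: filterS => t H /H ->.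
    + apply: fin => //; first exact: measurable_funX.
        exists (M ^+ 2) => t _; rewrite normrX; apply: lerXn2r; rewrite ?nnegrE//.
        exact: le_trans (psiM 0).
      by move=> t Dt nt; rewrite (out _ Dt nt).2 expr0n.
  move=> /integrableP[_]; apply: le_lt_trans; rewrite le_eqVlt; apply/orP; left; apply/eqP.
  by apply: eq_integral => x _ /=; rewrite ger0_norm ?sqr_ge0.
- move=> b hb _; suff near0 : \forall t \near infty b, v t = 0.
    by move: near0; case: (b) => h; apply: cvg_near_cst.
  case: b hb => hb.
    exists (Num.max 0 q); split; first exact: num_real.
    move=> t; rewrite gt_max => /andP[t0 qt].
    apply: (out _ _ _).1; first by apply: hb; rewrite /halfline/= in_itv/= ltW.
    by rewrite /= in_itv/= => /andP[_]; rewrite leNgt qt.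
  exists (Num.min 0 p); split; first exact: num_real.
  move=> t; rewrite lt_min => /andP[t0 qt].
  apply: (out _ _ _).1; first by apply: hb; rewrite /halfline/= in_itv/= ltW.
  by rewrite /= in_itv/= => /andP[]; rewrite leNgt qt.
Qed.

End TestFunctions.

(** * Weak solutions *)

Section WeakSolutions.
Context {R : realType}.
Implicit Types (nu lam m : {measure set R -> \bar R}) (D : set R) (x y : R).
Implicit Types (f g h phi psi w v u : R -> R) (b : bool).

(** The primitive of [g] with respect to [nu] that vanishes at [0]. *)
Definition prim0 nu g x : R :=
  if 0 <= x then \int[nu]_(t in `]0, x]) g t else - \int[nu]_(t in `]x, 0]) g t.

Lemma prim00 nu g : prim0 nu g 0 = 0.
Proof. by rewrite /prim0 lexx set_itvoc0 Rintegral_set0. Qed.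

Lemma prim0_primitive D nu g : exhausted D -> measurable_fun D g ->
  (forall x y, D x -> D y -> nu.-integrable `]x, y] (EFin \o g)) ->
  primitive D nu (prim0 nu g) g.
Proof.
move=> eD mg ig; have D0 := exhausted0 eD; split => // x y Dx Dy xy; split; first exact: ig.
have split_ (p q r : R) : D p -> D r -> p <= q -> q <= r ->
    \int[nu]_(t in `]p, r]) g t = \int[nu]_(t in `]p, q]) g t + \int[nu]_(t in `]q, r]) g t.
  move=> Dp Dr pq qr; rewrite -Rintegral_setU//.
  - by rewrite -itv_bndbnd_setU//= bnd_simp.
  - by rewrite -itv_bndbnd_setU//= ?bnd_simp//; exact: ig.
  - apply/disj_setPLR => t /=; rewrite !in_itv/= => /andP[_ tq].
    by apply/negP; rewrite negb_and -leNgt tq.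
rewrite /prim0; case: (leP 0 x) => x0.
  by rewrite (le_trans x0 xy) (split_ 0 x y)// addrAC subrr add0r.
case: (leP 0 y) => y0.
  by rewrite opprK addrC -split_// ltW.
by rewrite opprK addrC (split_ x y 0)// ?(ltW y0)// addrK.
Qed.

Lemma integrable_cst_oc nu x y (c : R) : diffuse nu ->
  nu.-integrable `]x, y] (EFin \o cst c).
Proof.
move=> hnu; apply: measurable_bounded_integrable => //.
- exact: diffuse_oc_lty.
- by exists `|c|; split; [exact: num_real|move=> z cz t _ /=; exact: ltW].
Qed.

Lemma L2_locally_integrable D nu f x y : exhausted D -> diffuse nu -> L2 nu D f ->
  D x -> D y -> nu.-integrable `]x, y] (EFin \o f).
Proof.
move=> eD hnu; have mD := exhausted_measurable eD; move=> /(L2P nu mD)[mf i2] Dx Dy.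
have sub : `]x, y] `<=` D.
  by apply: subset_trans (exhausted_sub eD Dx Dy); exact: subset_itv_oc_cc.
have mI : measurable (`]x, y]%classic : set R) by exact: measurable_itv.
have mf' : measurable_fun `]x, y] f by exact: measurable_funS mf.
have i2' : nu.-integrable `]x, y] (EFin \o (fun t => f t ^+ 2)) by exact: integrableS i2.
have i1 : nu.-integrable `]x, y] (EFin \o (fun t => (cst 1 t) ^+ 2)).
  have := integrable_cst_oc x y 1 hnu.
  by apply: eq_integrable => // t _ /=; rewrite expr1n.
have mc : measurable_fun `]x, y] (cst 1 : R -> R) by exact: measurable_cst.
have := integrable_sqr_mul mI mf' mc i2' i1.
by apply: eq_integrable => // t _ /=; rewrite mulr1.
Qed.

Lemma L2Z D nu f (c : R) : measurable D -> L2 nu D f -> L2 nu D (fun x => c * f x).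
Proof.
move=> mD /(L2P nu mD)[mf i2]; apply/(L2P nu mD); split.
  by apply: measurable_funM => //; exact: measurable_cst.
have := integrableZl_EFin (c ^+ 2) mD i2.
by apply: eq_integrable => // x _ /=; rewrite exprMn.
Qed.

Lemma L2_ae_eq D nu f g : measurable D -> measurable_fun D g ->
  f = g %[ae nu in D] -> L2 nu D f -> L2 nu D g.
Proof.
move=> mD mg fg /(L2P nu mD)[mf i2]; apply/(L2P nu mD); split => //.
apply: (ae_eq_integrable mD _ _ i2); first exact: measurable_funX.
by apply: filterS fg => x H /H ->.
Qed.

(** If [du/dlam] has the same integrals over subintervals of [D] as the constant
    [c] plus the primitive of [2 f] vanishing at [0], then [f] is half of the
    iterated derivative of [u], and [c] is the value of [du/dlam] at the
    origin. *)
Lemma weak_solution D m lam u f (c : R) : exhausted D ->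
  diffuse lam -> diffuse m -> charging D lam -> charging D m ->
  ll D lam u -> L2 m D f ->
  (forall x y, D x -> D y -> x <= y ->
    \int[lam]_(t in `]x, y]) dd D lam u t =
    \int[lam]_(t in `]x, y]) prim0 m (fun t => 2 * f t) t +
    c * (distr_fun lam y - distr_fun lam x)) ->
  [/\ dd_ll D lam m u, L2 m D (ddd D lam m u), cdd D lam m u 0 = c &
      f = (fun x => 2^-1 * ddd D lam m u x) %[ae m in D]].
Proof.
move=> eD hlam hm clam cm llu fL2 H; have mD := exhausted_measurable eD.
pose W := prim0 m (fun t => 2 * f t).
have L2f2 := L2Z 2 mD fL2.
have hW : primitive D m W (fun t => 2 * f t).
  apply: prim0_primitive => //; first by have /(L2P m mD)[] := L2f2.
  by move=> x y Dx Dy; exact: L2_locally_integrable L2f2 Dx Dy.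
pose w x := c + W x.
have hw : primitive D m w (fun t => 2 * f t).
  case: hW => mf HW; split => // x y Dx Dy xy; have [i1 <-] := HW x y Dx Dy xy.
  by split => //; rewrite /w; lra.
have hU := ll_dd eD hlam clam llu.
have wE : w = dd D lam u %[ae lam in D].
  suff : {ae lam, forall t, D t -> (dd D lam u \- w) t = 0}.
    by apply: filterS => t h /h/eqP; rewrite subr_eq0 => /eqP ->.
  have llw := primitive_ll eD hm cm hw.
  have llW := primitive_ll eD hm cm hW.
  have iW x y : D x -> D y -> x <= y -> lam.-integrable `]x, y] (EFin \o W).
    move=> Dx Dy xy.
    have := ll_mul_integrable eD hm llW Dx Dy xy (integrable_cst_oc x y 1 hlam).
    by apply: eq_integrable => // t _ /=; rewrite mulr1.
  have iw x y : D x -> D y -> x <= y -> lam.-integrable `]x, y] (EFin \o w).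
    move=> Dx Dy xy; have := integrableD (measurable_itv _) (integrable_cst_oc x y c hlam) (iW _ _ Dx Dy xy).
    exact: eq_integrable.
  have iU x y : D x -> D y -> x <= y -> lam.-integrable `]x, y] (EFin \o dd D lam u).
    by move=> Dx Dy xy; exact: primitive_integrable hU Dx Dy.
  apply: exhausted_ae => // x y Dx Dy xy; apply: integral_itv_eq0.
    have := integrableB (measurable_itv _) (iU _ _ Dx Dy (ltW xy)) (iw _ _ Dx Dy (ltW xy)).
    exact: eq_integrable.
  move=> p q xp pq qy.
  have Dp : D p by apply: (exhausted_le eD Dx Dy); rewrite xp (le_trans pq).
  have Dq : D q by apply: (exhausted_le eD Dx Dy); rewrite qy (le_trans xp).
  rewrite RintegralB//; [|exact: iU|exact: iw].
  rewrite RintegralD//; [|exact: integrable_cst_oc|exact: iW].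
  rewrite H// Rintegral_cst// -/W -distr_funB//=; lra.
have [d1 d2 d3] := primitive_cdd eD hlam hm clam cm hw wE.
have [_ [mddd _]] := dd_ll_primitive eD hm cm d1.
split => //.
- by apply: (L2_ae_eq mD mddd _ L2f2); apply: filterS d3 => t h /h ->.
- by rewrite (d2 _ (exhausted0 eD)) /w /W prim00 addr0.
- by apply: filterS d3 => t h /h ->; rewrite mulrA mulVf// mul1r.
Qed.

(** Pairing a compactly supported test function [v] with [f] and integrating by
    parts. The boundary terms vanish at an end [p] or [q] where [v] does, and at
    the origin, where the primitive of [2 f] does. *)
Lemma test_pairing D m lam u f v psi p q : exhausted D ->
  diffuse lam -> diffuse m -> charging D lam -> charging D m ->
  ll D lam u -> L2 m D f -> continuous v -> primitive D lam v psi ->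
  D p -> D q -> p <= q ->
  (forall t, D t -> ~ `[p, q]%classic t -> v t = 0 /\ psi t = 0) ->
  prim0 m (fun t => 2 * f t) p * v p = 0 ->
  prim0 m (fun t => 2 * f t) q * v q = 0 ->
  \int[lam]_(t in D) (dd D lam u t * dd D lam v t) +
  2 * \int[m]_(t in D) (f t * v t) =
  \int[lam]_(t in `]p, q]) (dd D lam u t * psi t) -
  \int[lam]_(t in `]p, q]) (prim0 m (fun t => 2 * f t) t * psi t).
Proof.
move=> eD hlam hm clam cm llu fL2 cv hv Dp Dq pq out Wp Wq.
have mD := exhausted_measurable eD.
pose W := prim0 m (fun t => 2 * f t).
have L2f2 := L2Z 2 mD fL2.
have hW : primitive D m W (fun t => 2 * f t).
  apply: prim0_primitive => //; first by have /(L2P m mD)[] := L2f2.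
  by move=> x y Dx Dy; exact: L2_locally_integrable L2f2 Dx Dy.
have llv := primitive_ll eD hlam clam hv.
have hU := ll_dd eD hlam clam llu.
have hV := ll_dd eD hlam clam llv.
have sub : `[p, q] `<=` D by exact: exhausted_sub.
have mv : measurable_fun setT v by exact: continuous_measurable_fun.
have [mf _] := (L2P m mD f).1 fL2.
have e1 : \int[lam]_(t in D) (dd D lam u t * dd D lam v t) =
    \int[lam]_(t in `]p, q]) (dd D lam u t * psi t).
  transitivity (\int[lam]_(t in D) (dd D lam u t * psi t)).
    apply: ae_eq_Rintegral => //.
    - by apply: measurable_funM; [exact: hU.1|exact: hV.1].
    - by apply: measurable_funM; [exact: hU.1|exact: hv.1].
    - by apply: filterS (primitive_dd eD hlam clam hv) => t H /H ->.
  rewrite (Rintegral_outside _ sub); last by move=> t Dt nt; rewrite (out _ Dt nt).2 mulr0.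
  apply: Rintegral_cc_oc => //; apply: measurable_funS mD sub _.
  by apply: measurable_funM; [exact: hU.1|exact: hv.1].
have e2 : 2 * \int[m]_(t in D) (f t * v t) = \int[m]_(t in `]p, q]) (2 * f t * v t).
  rewrite (Rintegral_outside _ sub); last by move=> t Dt nt; rewrite (out _ Dt nt).1 mulr0.
  have mfv : measurable_fun `[p, q] (fun t => f t * v t).
    apply: measurable_funS mD sub _; apply: measurable_funM => //; exact: measurable_funTS.
  rewrite Rintegral_cc_oc// -RintegralZl//.
    by apply: eq_Rintegral => t _; rewrite mulrA.
  have := ll_mul_integrable eD hlam llv Dp Dq pq (L2_locally_integrable eD hm fL2 Dp Dq).
  by apply: eq_integrable => // t _ /=; rewrite mulrC.
have := primitive_by_parts eD hlam hm clam cm hW hv Dp Dq pq.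
by rewrite e1 e2 -/W in Wp Wq *; move: Wp Wq => -> ->; lra.
Qed.

Lemma Rintegral_mul_indic nu A B f : A `<=` B ->
  \int[nu]_(t in B) (f t * \1_A t) = \int[nu]_(t in A) f t.
Proof.
move=> AB; rewrite (Rintegral_outside _ AB); last first.
  by move=> t _ nA; rewrite indicE memNset// mulr0.
by apply: eq_Rintegral => t tA; rewrite indicE tA mulr1.
Qed.

Lemma primitive_addc D nu f phi (c : R) : primitive D nu f phi ->
  primitive D nu (fun t => f t + c) phi.
Proof.
move=> [mphi H]; split => // x y Dx Dy xy; have [i1 <-] := H _ _ Dx Dy xy.
by split => //; lra.
Qed.

Lemma indic_norm_le1 (A : set R) t : `|\1_A t| <= 1 :> R.
Proof. by rewrite indicE; case: (_ \in _); rewrite ?normr1 ?normr0. Qed.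

(** On a half-line the form identity, with a multiple of the boundary value of
    the test function added, determines both the equation and the boundary
    condition. *)
Lemma halfline_solution b m lam u f (c : R) : diffuse lam -> diffuse m ->
  charging (halfline b) lam -> charging (halfline b) m ->
  ll (halfline b) lam u -> L2 m (halfline b) f ->
  (forall v, form_dom (halfline b) m lam v ->
    2^-1 * \int[lam]_(x in halfline b) (dd (halfline b) lam u x * dd (halfline b) lam v x) +
    c / 2 * (orient b * v 0) = - \int[m]_(x in halfline b) (f x * v x)) ->
  [/\ dd_ll (halfline b) lam m u, L2 m (halfline b) (ddd (halfline b) lam m u),
      cdd (halfline b) lam m u 0 = c &
      f = (fun x => 2^-1 * ddd (halfline b) lam m u x) %[ae m in halfline b]].
Proof.
move=> hlam hm clam cm llu fL2 H; have eD := @halfline_exhausted R b.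
apply: weak_solution => // x y Dx Dy xy.
have D0 : halfline b (0 : R) by exact: exhausted0.
(* Shifted by [k], the ramp vanishes beyond [[x, y]] in the direction of the
   infinite end; it is constant between the origin and [[x, y]]. *)
pose k := if b then distr_fun lam y else distr_fun lam x.
pose p := if b then 0 else x; pose q := if b then y else 0.
pose v t := ramp lam x y t - k.
have hv : primitive (halfline b) lam v \1_(`]x, y]%classic).
  exact/primitive_addc/ramp_primitive.
have cv : continuous v.
  by move=> t; apply: cvgB; [exact: ramp_continuous|exact: cvg_cst].
have Dp : halfline b p by rewrite /p; case: (b) Dx D0.
have Dq : halfline b q by rewrite /q; case: (b) Dy D0.
have pq : p <= q.
  by rewrite /p /q; case: (b) Dx Dy; rewrite /halfline/= !in_itv/= ?andbT.
have v0 : v 0 = - orient b * (distr_fun lam y - distr_fun lam x).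
  rewrite /v /k /ramp /orient; case: (b) Dx Dy; rewrite /halfline/= !in_itv/= ?andbT => x0 y0.
    by rewrite clamp_le//; lra.
  by rewrite clamp_ge//; lra.
have vpq : prim0 m (fun t => 2 * f t) p * v p = 0 /\ prim0 m (fun t => 2 * f t) q * v q = 0.
  rewrite /p /q /v /k /ramp; case: (b); rewrite prim00 mul0r; split => //.
    by rewrite clamp_ge ?subrr ?mulr0.
  by rewrite clamp_le ?subrr ?mulr0.
have sub : `]x, y] `<=` `]p, q].
  move=> t; rewrite /p /q; case: (b) Dx Dy; rewrite /halfline/= !in_itv/= ?andbT => x0 y0 /andP[xt ty].
    by rewrite (le_lt_trans x0 xt).
  by rewrite xt (le_trans ty y0).
have out t : halfline b t -> ~ `[p, q]%classic t -> v t = 0 /\ \1_(`]x, y]%classic) t = 0 :> R.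
  move=> Dt nt; split; last first.
    by rewrite indicE memNset// => /sub xyt; apply: nt; exact: subset_itv_oc_cc xyt.
  move: nt Dt; rewrite /v /p /q /k /ramp; case: (b); rewrite /halfline/= !in_itv/= ?andbT => /negP.
    by move=> + t0; rewrite t0/= -ltNge => yt; rewrite clamp_ge ?subrr// ltW.
  by move=> + t0; rewrite t0 andbT -ltNge => tx; rewrite clamp_le ?subrr// ltW.
have fv : form_dom (halfline b) m lam v.
  by apply: (compact_support_form_dom eD hlam hm clam cv hv _ Dp Dq pq out (M := 1)) => t; exact: indic_norm_le1.
have := test_pairing eD hlam hm clam cm llu fL2 cv hv Dp Dq pq out vpq.1 vpq.2.
rewrite !Rintegral_mul_indic//.
have oo : orient b * orient b = 1 :> R by rewrite /orient; case: (b); rewrite ?mulr1// mulrNN mulr1.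
have ov : orient b * v 0 = - (distr_fun lam y - distr_fun lam x).
  by rewrite v0 mulrA mulrN oo mulN1r.
by have := H v fv; rewrite ov; lra.
Qed.

Lemma line_solution m lam u f : diffuse lam -> diffuse m ->
  charging setT lam -> charging setT m ->
  ll setT lam u -> L2 m setT f ->
  (forall v, form_dom setT m lam v ->
    2^-1 * \int[lam]_x (dd setT lam u x * dd setT lam v x) = - \int[m]_x (f x * v x)) ->
  [/\ dd_ll setT lam m u, L2 m setT (ddd setT lam m u) &
      f = (fun x => 2^-1 * ddd setT lam m u x) %[ae m]].
Proof.
move=> hlam hm clam cm llu fL2 H; have eD := @setT_exhausted R.
pose W := prim0 m (fun t => 2 * f t).
pose U := dd setT lam u.
pose s := distr_fun lam.
have s01 : s 0 < s 1 by apply: (distr_fun_lt hlam clam).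
(* On (0, 1] the equality to be proved defines the constant [c]. *)
pose c := (\int[lam]_(t in `]0, 1]) U t - \int[lam]_(t in `]0, 1]) W t) / (s 1 - s 0).
suff : [/\ dd_ll setT lam m u, L2 m setT (ddd setT lam m u), cdd setT lam m u 0 = c &
      f = (fun x => 2^-1 * ddd setT lam m u x) %[ae m in setT]].
  by case=> h1 h2 _ h3; split => //; apply: filterS h3 => t; exact.
apply: weak_solution => // x y _ _ xy; rewrite -/U -/W -/s.
have mT := @measurableT _ R.
have L2f2 := L2Z 2 mT fL2.
have hW : primitive setT m W (fun t => 2 * f t).
  apply: prim0_primitive => //; first by have /(L2P m mT)[] := L2f2.
  by move=> x' y' Dx Dy; exact: L2_locally_integrable L2f2 Dx Dy.
have llW := primitive_ll eD hm cm hW.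
have hU := ll_dd eD hlam clam llu.
(* The test function [v] is the ramp of (x, y] minus the multiple of the ramp of
   (0, 1] that makes it vanish at both ends. *)
pose k := (s y - s x) / (s 1 - s 0).
pose p := Num.min x 0; pose q := Num.max y 1.
pose psi t : R := \1_(`]x, y]%classic) t - k * \1_(`]0, 1]%classic) t.
pose v t := (ramp lam x y t - s x) - k * (ramp lam 0 1 t - s 0).
have hv : primitive setT lam v psi.
  have [m1 h1] := ramp_primitive eD hlam xy.
  have [m2 h2] := ramp_primitive eD hlam (@ler01 R).
  split; first by apply: measurable_funB => //; apply: measurable_funM => //; exact: measurable_cst.
  move=> x' y' Dx Dy xy'; have [i1 e1] := h1 _ _ Dx Dy xy'; have [i2 e2] := h2 _ _ Dx Dy xy'.
  have i3 := integrableZl_EFin k (measurable_itv _) i2; split.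
    by have := integrableB (measurable_itv _) i1 i3; exact: eq_integrable.
  by rewrite RintegralB// RintegralZl// -e1 -e2 /v; lra.
have cv : continuous v.
  move=> t; apply: cvgB; first by apply: cvgB; [exact: ramp_continuous|exact: cvg_cst].
  apply: cvgM; first exact: cvg_cst.
  by apply: cvgB; [exact: ramp_continuous|exact: cvg_cst].
have px : p <= x by rewrite ge_min lexx.
have p0 : p <= 0 by rewrite ge_min lexx orbT.
have yq : y <= q by rewrite le_max lexx.
have q1 : 1 <= q by rewrite le_max lexx orbT.
have pq : p <= q by rewrite (le_trans px)// (le_trans xy).
have sub1 : `]x, y] `<=` `]p, q].
  by move=> t /=; rewrite !in_itv/= => /andP[xt ty]; rewrite (le_lt_trans px xt) (le_trans ty yq).
have sub2 : `]0, 1] `<=` `]p, q].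
  by move=> t /=; rewrite !in_itv/= => /andP[xt ty]; rewrite (le_lt_trans p0 xt) (le_trans ty q1).
have vlow t : t <= p -> v t = 0.
  move=> tp; rewrite /v /ramp !clamp_le ?(le_trans tp)//.
  by rewrite -/s !subrr mulr0 subrr.
have vhigh t : q <= t -> v t = 0.
  move=> qt; rewrite /v /ramp !clamp_ge ?(le_trans _ qt)//.
  by rewrite -/s /k divfK ?subrr// subr_eq0 gt_eqF.
have out t : setT t -> ~ `[p, q]%classic t -> v t = 0 /\ psi t = 0.
  move=> _ nt; split.
    move: nt; rewrite /= in_itv/= => /negP; rewrite negb_and -!ltNge.
    by case/orP => /ltW; [exact: vlow|exact: vhigh].
  rewrite /psi !indicE !memNset ?mulr0 ?subrr//.
    by move=> /sub2/subset_itv_oc_cc.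
  by move=> /sub1/subset_itv_oc_cc.
have psiM t : `|psi t| <= 1 + `|k|.
  apply: le_trans (ler_normB _ _) _; apply: lerD; first exact: indic_norm_le1.
  by rewrite normrM ler_piMr// indic_norm_le1.
have fv : form_dom setT m lam v.
  exact: (compact_support_form_dom eD hlam hm clam cv hv psiM I I pq out).
have vp : v p = 0 by exact: vlow.
have vq : v q = 0 by exact: vhigh.
have := test_pairing eD hlam hm clam cm llu fL2 cv hv I I pq out.
rewrite vp vq !mulr0 => /(_ erefl erefl); rewrite -/W -/U.
have dist F : lam.-integrable `]p, q] (EFin \o F) ->
   \int[lam]_(t in `]p, q]) (F t * psi t) =
   \int[lam]_(t in `]x, y]) F t - k * \int[lam]_(t in `]0, 1]) F t.
  move=> iF.
  have iI (A : set R) : measurable A -> lam.-integrable `]p, q] (EFin \o (fun t => F t * \1_A t)).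
    move=> mA; apply: le_integrable (iF) => //.
      apply/measurable_EFinP; apply: measurable_funM; last exact: measurable_funTS (measurable_indic mA).
      by have /integrableP[/measurable_EFinP] := iF.
    by move=> t _ /=; rewrite lee_fin normrM ler_piMr// indic_norm_le1.
  rewrite -(Rintegral_mul_indic _ _ sub1) -(Rintegral_mul_indic _ _ sub2).
  have iI1 := iI _ (measurable_itv `]x, y]); have iI2 := iI _ (measurable_itv `]0, 1]).
  rewrite -RintegralZl// -RintegralB//; last exact: integrableZl_EFin.
  by apply: eq_Rintegral => t _; rewrite /psi; lra.
rewrite !dist; last 2 first.
- have := ll_mul_integrable eD hm llW I I pq (integrable_cst_oc p q 1 hlam).
  by apply: eq_integrable => // t _ /=; rewrite mulr1.
- exact: primitive_integrable hU I I.
have := H v fv; rewrite -/U => h1 h2.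
have : \int[lam]_(t in `]x, y]) U t - \int[lam]_(t in `]x, y]) W t =
   k * (\int[lam]_(t in `]0, 1]) U t - \int[lam]_(t in `]0, 1]) W t) by lra.
have -> : k * (\int[lam]_(t in `]0, 1]) U t - \int[lam]_(t in `]0, 1]) W t) = c * (s y - s x).
  by rewrite /k /c; lra.
by lra.
Qed.

End WeakSolutions.

(** * Measures and integrals on the disjoint union of two half-lines *)

Section TwoSheets.
Context {R : realType}.
Implicit Types (mu m lam : {measure set (bool * R) -> \bar R}) (b : bool).

Lemma GspaceU : Gspace = ([set true] `*` halfline true) `|` ([set false] `*` halfline false)
  :> set (bool * R).
Proof.
apply/seteqP; split=> [[[] x] /=|[b x] [] [/= -> ]] //= h; first by left.
by right.
Qed.

Lemma half_measureE mu b A : half_measure mu b A = mu ([set b] `*` (A `&` halfline b)).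
Proof.
rewrite /half_measure /pushforward /mrestr; congr (mu _).
by apply/seteqP; split => [[c x] [/= Ax [-> hx]]|[c x] [/= -> [Ax hx]]].
Qed.

Lemma half_measure_sort mu b A :
  (half_measure mu b : {measure set R -> \bar R}) A = half_measure mu b A.
Proof. by []. Qed.

Lemma line_measure_sort mu A :
  (line_measure mu : {measure set R -> \bar R}) A = line_measure mu A.
Proof. by []. Qed.

Lemma line_measureE mu A : measurable A ->
  line_measure mu A = (half_measure mu true A + half_measure mu false A)%E.
Proof.
move=> mA; rewrite !half_measureE -measureU//.
- rewrite /line_measure /pushforward /mrestr; congr (mu _).
  apply/seteqP; split => [[[] x] [/= Ax hx]|[b x] [] [/= -> [Ax hx]]].
  + by left.
  + by right.
  + by split.
  + by split.
- by apply: measurableX => //; apply: measurableI => //; exact: measurable_halfline.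
- by apply: measurableX => //; apply: measurableI => //; exact: measurable_halfline.
- by apply/seteqP; split => // -[b x] [[/= -> _] [/=]].
Qed.

Lemma half_measure_diffuse mu b : scrM mu -> diffuse (half_measure mu b).
Proof.
move=> [[_ fin] _ at0]; split => [x y|x].
  rewrite half_measure_sort half_measureE; apply: fin.
    by move=> [c t] [/= -> [_ ht]].
  apply: compact_setX; first exact: compact_set1.
  apply: compact_closedI; first exact: segment_compact.
  by case: b; exact: interval_closed.
rewrite half_measure_sort half_measureE.
have [hx|hx] := pselect (halfline b x).
  have -> : [set b] `*` ([set x] `&` halfline b) = [set (b, x)].
    by apply/seteqP; split => [[c t] [/= -> [-> _]]|_ ->].
  exact: at0.
have -> : [set b] `*` ([set x] `&` halfline b) = set0.
  by apply/seteqP; split => // -[c t] [/= _ [-> ]].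
exact: measure0.
Qed.

Lemma half_measure_charging mu b : scrM mu -> charging (halfline b) (half_measure mu b).
Proof.
move=> [_ full _] x y Dx Dy xy; rewrite half_measure_sort half_measureE.
have sub : `]x, y[ `<=` halfline b.
  move=> t /=; case: (b) Dx Dy; rewrite /halfline/= !in_itv/= ?andbT => h1 h2 /andP[xt ty].
    exact: le_trans (ltW xt).
  exact: le_trans (ltW ty) h2.
pose U : set (bool * R) := [set b] `*` `]x, y[.
have GU : Gspace (b, (x + y) / 2) /\ U (b, (x + y) / 2).
  have [h1 h2] := midf_lt xy; split; last by split => //=; rewrite in_itv/= h1.
  by apply: sub; rewrite /= in_itv/= h1.
have oU : open U.
  have -> : U = (fst @^-1` [set b]) `&` (snd @^-1` `]x, y[) by [].
  apply: openI; apply: open_comp.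
  - by move=> p _; exact: cvg_fst.
  - exact: discrete_open.
  - by move=> p _; exact: cvg_snd.
  - exact: interval_open.
have : (0 < mu (U `&` Gspace))%E by apply: full => //; exists (b, (x + y) / 2); case: GU.
move=> /lt_le_trans; apply; apply: le_measure; rewrite ?inE.
- by apply: measurableI; [apply: measurableX|exact: measurable_Gspace].
- by apply: measurableX => //; apply: measurableI => //; exact: measurable_halfline.
- move=> [c t] [[/= -> xyt] ht]; split => //; split => //.
  exact: subset_itv_oo_oc xyt.
Qed.

Lemma line_measure_diffuse mu : scrM mu -> diffuse (line_measure mu).
Proof.
move=> hmu; split => [x y|x]; rewrite line_measure_sort line_measureE//.
  by rewrite lte_add_pinfty//; apply: (half_measure_diffuse _ hmu).1.
by rewrite !(half_measure_diffuse _ hmu).2 adde0.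
Qed.

Lemma line_measure_charging mu : scrM mu -> charging setT (line_measure mu).
Proof.
move=> hmu x y _ _ xy; rewrite line_measure_sort line_measureE//.
have sub b u v : halfline b u -> halfline b v -> x <= u -> u < v -> v <= y ->
    (0 < half_measure mu b `]x, y]%classic)%E.
  move=> hu hv xu uv vy; have := half_measure_charging hmu hu hv uv.
  move=> /lt_le_trans; apply; apply: le_measure; rewrite ?inE//.
  by move=> t /=; rewrite !in_itv/= => /andP[ut tv]; rewrite (le_lt_trans xu ut) (le_trans tv vy).
have [y0|y0] := leP y 0.
  rewrite lte_paddl//; apply: (sub false x y) => //; rewrite /halfline/= in_itv/= ?(le_trans (ltW xy))//.
rewrite lte_paddr//; apply: (sub true (Num.max 0 x) y) => //.
- by rewrite /halfline/= in_itv/= le_max lexx.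
- by rewrite /halfline/= in_itv/= ltW.
- by rewrite le_max lexx orbT.
- by rewrite gt_max y0.
Qed.

Lemma line_measure_halfline mu b : scrM mu ->
  line_measure mu (halfline b) = half_measure mu b (halfline b).
Proof.
move=> hmu; rewrite line_measureE; last exact: measurable_halfline.
have h0 c : c != b -> half_measure mu c (halfline b) = 0%E.
  move=> cb; rewrite -[RHS]((half_measure_diffuse c hmu).2 0) half_measure_sort !half_measureE.
  congr (mu (_ `*` _)); apply/seteqP; split => x [].
    move=> hb hc; split => //; apply/eqP; rewrite eq_le.
    by move: cb hb hc; case: (b); case: (c); rewrite /halfline//= !in_itv/= ?andbT => _ -> ->.
  by move=> /= -> hc; split => //; exact: exhausted0 (halfline_exhausted b).
by case: b h0 => h0; [rewrite (h0 false)// adde0|rewrite (h0 true)// add0e].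
Qed.

End TwoSheets.

Section SheetIntegrals.
Context {R : realType}.
Implicit Types (mu m lam : {measure set (bool * R) -> \bar R}) (b : bool).

Local Notation sheet b := ([set b] `*` halfline b : set (bool * R)).

Lemma measurable_fun_Gspace d (T : measurableType d) (F : bool * R -> T) :
  measurable_fun Gspace F <-> forall b, measurable_fun (halfline b) (fun x => F (b, x)).
Proof.
split=> [mF b|mF].
  apply: (measurable_comp measurable_Gspace _ mF).
    by move=> _ [x hx <-].
  by apply: measurable_funTS; exact: pair1_measurable.
rewrite GspaceU; apply/measurable_funU; [exact: measurable_GspaceI|exact: measurable_GspaceI|].
suff h b : measurable_fun (sheet b) F by split; exact: h.
apply: (@eq_measurable_fun _ _ _ _ _ ((fun x => F (b, x)) \o snd)).
  by move=> [c x]; rewrite inE => -[/= ->].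
apply: (measurable_comp (@measurable_halfline R b) _ (mF b)).
  by move=> _ [[c x] [/= _ hx] <-].
by apply: measurable_funTS; exact: measurable_snd.
Qed.

Lemma ge0_integral_sheet mu b (F : bool * R -> \bar R) :
  measurable_fun Gspace F -> (forall p, 0 <= F p)%E ->
  (\int[mu]_(p in sheet b) F p = \int[half_measure mu b]_(x in halfline b) F (b, x))%E.
Proof.
move=> mF F0; have mh := @measurable_halfline R b.
have mFb : measurable_fun (halfline b) (fun x => F (b, x)) by exact: (measurable_fun_Gspace F).1.
pose g := (fun x => F (b, x)) \_ (halfline b).
have mg : measurable_fun setT g by apply: (measurable_restrictT _ mh).1.
have g0 x : (0 <= g x)%E.
  rewrite /g patchE. case: ifP => _. exact: F0. exact: lexx.
rewrite [RHS]integral_mkcond -/g.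
rewrite (ge0_integral_pushforward measurable_snd (mrestr mu (measurable_GspaceI b)) measurableT)//.
rewrite preimage_setT ge0_integral_mrestr//.
- apply: eq_integral => -[c x]; rewrite inE => -[/= -> hx].
  by rewrite /g patchE mem_set.
- by move=> p; exact: g0.
- exact: measurableT_comp.
Qed.

Lemma ge0_integral_Gspace mu (F : bool * R -> \bar R) :
  measurable_fun Gspace F -> (forall p, 0 <= F p)%E ->
  (\int[mu]_(p in Gspace) F p =
   \int[half_measure mu true]_(x in halfline true) F (true, x) +
   \int[half_measure mu false]_(x in halfline false) F (false, x))%E.
Proof.
move=> mF F0; rewrite -!ge0_integral_sheet// GspaceU ge0_integral_setU//.
- exact: measurable_GspaceI.
- exact: measurable_GspaceI.
- by rewrite -GspaceU.
- by apply/disj_setPLR => -[c x] [/= -> _] [].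
Qed.

Lemma integrable_Gspace mu (F : bool * R -> R) :
  mu.-integrable Gspace (EFin \o F) <->
  forall b, (half_measure mu b).-integrable (halfline b) (EFin \o (fun x => F (b, x))).
Proof.
have key : measurable_fun Gspace F ->
  (\int[mu]_(p in Gspace) `|(F p)%:E| =
   \int[half_measure mu true]_(x in halfline true) `|(F (true, x))%:E| +
   \int[half_measure mu false]_(x in halfline false) `|(F (false, x))%:E|)%E.
  move=> mF; rewrite (ge0_integral_Gspace mu (F := fun p => `|(F p)%:E|%E))//.
  by apply: measurableT_comp => //; exact/measurable_EFinP.
split=> [/integrableP[/measurable_EFinP mF fin] b|H].
  apply/integrableP; split; first by apply/measurable_EFinP; exact: (measurable_fun_Gspace F).1.
  apply: le_lt_trans fin; rewrite [leRHS]key//.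
  case: b; first by apply: leeDl; exact: integral_ge0.
  by apply: leeDr; exact: integral_ge0.
have mF : measurable_fun Gspace F.
  by apply/measurable_fun_Gspace => b; have /integrableP[/measurable_EFinP] := H b.
apply/integrableP; split; first exact/measurable_EFinP.
rewrite [X in (X < _)%E]key//; apply: lte_add_pinfty.
  by have /integrableP[] := H true.
by have /integrableP[] := H false.
Qed.

Lemma Rintegral_Gspace mu (F : bool * R -> R) : mu.-integrable Gspace (EFin \o F) ->
  \int[mu]_(p in Gspace) F p =
  \int[half_measure mu true]_(x in halfline true) F (true, x) +
  \int[half_measure mu false]_(x in halfline false) F (false, x).
Proof.
move=> iF; have mh b := @measurable_halfline R b.
have iFb := (integrable_Gspace mu F).1 iF.
have mF : measurable_fun Gspace (EFin \o F) by have /integrableP[] := iF.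
have eqb b : \int[half_measure mu b]_(x in halfline b) F (b, x) = \int[mu]_(p in sheet b) F p.
  rewrite /Rintegral; congr fine; rewrite integralE [RHS]integralE; congr (_ - _)%E.
    rewrite (ge0_integral_sheet mu b (measurable_funepos mF) (fun p => funepos_ge0 _ p)).
    by apply: eq_integral => x _; rewrite !funeposE.
  rewrite (ge0_integral_sheet mu b (measurable_funeneg mF) (fun p => funeneg_ge0 _ p)).
  by apply: eq_integral => x _; rewrite !funenegE.
rewrite !eqb GspaceU Rintegral_setU//.
- exact: measurable_GspaceI.
- exact: measurable_GspaceI.
- by rewrite -GspaceU.
- by apply/disj_setPLR => -[c x] [/= -> _] [].
Qed.

Lemma L2_Gspace mu (f : bool * R -> R) :
  L2 mu Gspace f <-> forall b, L2 (half_measure mu b) (halfline b) (restr b f).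
Proof.
have mh b := @measurable_halfline R b.
split=> [/(L2P mu measurable_Gspace)[mf i2] b|H].
  apply/(L2P _ (mh b)); split; first exact: (measurable_fun_Gspace f).1.
  exact: (integrable_Gspace mu (fun p => f p ^+ 2)).1.
apply/(L2P mu measurable_Gspace); split.
  by apply/measurable_fun_Gspace => b; have /(L2P _ (mh b))[] := H b.
by apply/integrable_Gspace => b; have /(L2P _ (mh b))[] := H b.
Qed.

End SheetIntegrals.

(** * The generators *)

Section Generators.
Context {R : realType}.
Implicit Types (m lam : {measure set (bool * R) -> \bar R}) (b : bool).

Lemma F_halfE m lam b (f : R -> R) :
  F_half m lam b f <-> form_dom (halfline b) (half_measure m b) (half_measure lam b) f.
Proof.
split=> [[h1 h2 h3 h4]|[h1 h2 h3 h4]]; split => //; last exact: h4.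
move=> c sub; suff -> : c = b by [].
have hc : halfline c (if c then 1 else -1 : R).
  by case: (c); rewrite /halfline/= in_itv/= ?ler01// oppr_le0 ler01.
have := sub _ hc; case: (c); case: (b) => //; rewrite /halfline/= in_itv/= ?andbT.
  by rewrite ler10.
by rewrite oppr_ge0 ler10.
Qed.

Lemma F_iE m lam (f : R -> R) : scrM lam ->
  F_i m lam f <-> form_dom setT (line_measure m) (line_measure lam) f.
Proof.
move=> hlam; split=> [[h1 h2 h3 h4]|[h1 h2 h3 h4]]; split => //.
  by move=> b _; rewrite line_measure_sort line_measure_halfline//; exact: h4.
move=> b; rewrite /vanishes_at_infty -line_measure_halfline//; exact: h4.
Qed.

Lemma primitive_cst0 (D : set R) (nu : {measure set R -> \bar R}) :
  primitive D nu (fun=> 0) (fun=> 0).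
Proof.
split=> [|x y _ _ _]; first exact: measurable_cst.
split; first exact: integrable0.
by rewrite subrr /Rintegral integral0.
Qed.

Lemma form_dom_cst0 D (m lam : {measure set R -> \bar R}) : exhausted D ->
  diffuse lam -> diffuse m -> charging D lam -> form_dom D m lam (fun=> 0).
Proof.
move=> eD hlam hm clam; have D0 := exhausted0 eD.
apply: (@compact_support_form_dom R D m lam (fun=> 0) (fun=> 0) 0 0 0) => //.
- by move=> x; exact: cvg_cst.
- exact: primitive_cst0.
- by move=> t; rewrite normr0.
Qed.

Lemma energy_cst0 D (nu : {measure set R -> \bar R}) f : exhausted D ->
  diffuse nu -> charging D nu -> ll D nu f -> energy D nu f (fun=> 0) = 0.
Proof.
move=> eD hnu cnu llf; have mD := exhausted_measurable eD.
have [mf _] := ll_dd eD hnu cnu llf.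
have p0 := primitive_cst0 D nu.
have [m0 _] := ll_dd eD hnu cnu (primitive_ll eD hnu cnu p0).
rewrite /energy (ae_eq_Rintegral (g := fun=> 0) mD)//.
- by rewrite /Rintegral integral0 mulr0.
- exact: measurable_funM.
- by apply: filterS (primitive_dd eD hnu cnu p0) => x /= H /H ->; rewrite mulr0.
Qed.

Lemma L2_integrable_mul d (T : measurableType d) (mu : {measure set T -> \bar R}) D
    (f g : T -> R) : measurable D -> L2 mu D f -> L2 mu D g ->
  mu.-integrable D (EFin \o (fun x => f x * g x)).
Proof.
move=> mD /(L2P _ mD)[mf f2] /(L2P _ mD)[mg g2].
exact: (integrable_sqr_mul mD mf mg f2 g2).
Qed.

Lemma RintegralNl_mul d (T : measurableType d) (mu : {measure set T -> \bar R}) D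
    (f g : T -> R) (c : R) : measurable D -> L2 mu D f -> L2 mu D g ->
  \int[mu]_(x in D) (- (c * f x) * g x) = - c * \int[mu]_(x in D) (f x * g x).
Proof.
move=> mD f2 g2; rewrite -RintegralZl//; last exact: L2_integrable_mul.
by apply: eq_Rintegral => x _; rewrite !mulNr mulrA.
Qed.

(** The image under the generator of the snapping out form is half of the
    iterated derivative; no sign is needed for [kappa]. *)
Lemma interface_generates m lam (kappa : R) u f : scrM m -> scrM lam ->
  generates m Gspace (F_s m lam) (E_s lam kappa) u f ->
  forall b, [/\ dd_half_ll m lam b u,
    L2 (half_measure m b) (halfline b) (ddd_half m lam b u),
    cdd_half m lam b u 0 = kappa / 2 * jump u &
    restr b f = (fun x => 2^-1 * ddd_half m lam b u x) %[ae half_measure m b in halfline b]].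
Proof.
move=> hm hlam [L2f [L2u Fu] gf] b.
have mh c := @measurable_halfline R c; have eD c := @halfline_exhausted R c.
have dm c := half_measure_diffuse c hm; have dlam c := half_measure_diffuse c hlam.
have cm c := half_measure_charging (b := c) hm; have clam c := half_measure_charging (b := c) hlam.
have llu c : ll (halfline c) (half_measure lam c) (restr c u) by have [] := Fu c.
have L2fb := (L2_Gspace m f).1 L2f.
apply: (halfline_solution (dlam b) (dm b) (clam b) (cm b) (llu b) (L2fb b)) => v fv.
(* Test functions supported on one of the half-lines. *)
pose V (p : bool * R) : R := if p.1 == b then v p.2 else 0.
have Vb : restr b V = v by apply/funext => x; rewrite /restr /V/= eqxx.
have Vnb : restr (~~ b) V = fun=> 0.
  by apply/funext => x; rewrite /restr /V/=; case: (b).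
have sumb (G : bool -> R) : G true + G false = G b + G (~~ b).
  by case: (b) => //; rewrite addrC.
have FVc c : F_half m lam c (restr c V).
  have [->|cb] := eqVneq c b; first by rewrite Vb; exact/F_halfE.
  have -> : c = ~~ b by move: cb; case: (c); case: (b).
  by rewrite Vnb; apply/F_halfE; exact: form_dom_cst0.
have L2V c : L2 (half_measure m c) (halfline c) (restr c V) by have [] := FVc c.
have FV : F_s m lam V by split => //; exact/L2_Gspace.
have := gf V FV; rewrite /E_s /E_X.
rewrite (sumb (fun c => E_half lam c (restr c u) (restr c V))) Vb Vnb.
rewrite [X in _ + X + _]energy_cst0// addr0.
have -> : jump V = orient b * v 0.
  by rewrite /jump /V /orient /zero_pt; case: (b) => /=; rewrite ?subr0 ?mul1r// sub0r mulN1r.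
rewrite Rintegral_Gspace; last first.
  apply/integrable_Gspace => c; have := L2_integrable_mul (mh c) (L2Z (-1) (mh c) (L2fb c)) (L2V c).
  by apply: eq_integrable => // x _; rewrite /= mulN1r.
have intc c : \int[half_measure m c]_(x in halfline c) (- f (c, x) * V (c, x)) =
    - \int[half_measure m c]_(x in halfline c) (restr c f x * restr c V x).
  rewrite -[RHS]mulN1r -RintegralNl_mul//; first by apply: eq_Rintegral => x _; rewrite mul1r.
rewrite !intc (sumb (fun c => - \int[half_measure m c]_(x in halfline c) (restr c f x * restr c V x))).
rewrite Vb Vnb [X in _ = _ - X](_ : _ = 0); last first.
  rewrite -[RHS](_ : \int[half_measure m (~~ b)]_(x in halfline (~~ b)) 0 = 0).
    by apply: eq_Rintegral => x _; rewrite mulr0.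
  by rewrite /Rintegral integral0.
rewrite subr0 /E_half /energy => <-; congr (_ + _).
by field.
Qed.

(** Functions satisfying the boundary condition are in the domain: by Green's
    formula on each half-line, the boundary terms add up to minus the jump
    term. *)
Lemma interface_generator m lam (kappa : R) u : scrM m -> scrM lam ->
  F_s m lam u ->
  (forall b, [/\ dd_half_ll m lam b u,
    L2 (half_measure m b) (halfline b) (ddd_half m lam b u) &
    cdd_half m lam b u 0 = kappa / 2 * jump u]) ->
  generates m Gspace (F_s m lam) (E_s lam kappa) u (fun p => 2^-1 * ddd_half m lam p.1 u p.2).
Proof.
move=> hm hlam Fu cond.
have mh c := @measurable_halfline R c; have eD c := @halfline_exhausted R c.
have dm c := half_measure_diffuse c hm; have dlam c := half_measure_diffuse c hlam.
have cm c := half_measure_charging (b := c) hm; have clam c := half_measure_charging (b := c) hlam.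
have L2h c : L2 (half_measure m c) (halfline c) (ddd_half m lam c u) by have [] := cond c.
split => [|//|v Fv].
  by apply/L2_Gspace => c; apply: L2Z => //; exact: L2h.
have L2v c : L2 (half_measure m c) (halfline c) (restr c v) by have [] := Fv.2 c.
rewrite Rintegral_Gspace; last first.
  apply/integrable_Gspace => c; have := L2_integrable_mul (mh c) (L2Z (- 2^-1) (mh c) (L2h c)) (L2v c).
  by apply: eq_integrable => // x _; rewrite /= mulNr.
have intc c : \int[half_measure m c]_(x in halfline c) (- (2^-1 * ddd_half m lam c u x) * v (c, x)) =
    - 2^-1 * \int[half_measure m c]_(x in halfline c) (ddd_half m lam c u x * restr c v x).
  by rewrite -RintegralNl_mul.
have green c : \int[half_measure lam c]_(x in halfline c)
      (dd (halfline c) (half_measure lam c) (restr c u) x *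
       dd (halfline c) (half_measure lam c) (restr c v) x) =
   - orient c * (kappa / 2 * jump u * v (zero_pt c)) -
   \int[half_measure m c]_(x in halfline c) (ddd_half m lam c u x * restr c v x).
  have [du L2d <-] := cond c; apply/eqP; rewrite eq_sym subr_eq eq_sym; apply/eqP.
  apply: green_halfline => //; apply/F_halfE; [exact: Fu.2|exact: Fv.2].
rewrite /= !intc /E_s /E_X /E_half /energy !green /orient /jump.
by field.
Qed.

(** On the line the boundary terms of the two half-lines at [0] cancel, since
    [du/dlam] and [v] are single-valued there. *)
Lemma line_generator m lam u : scrM m -> scrM lam ->
  F_i m lam u -> dd_ll setT (line_measure lam) (line_measure m) u ->
  L2 (line_measure m) setT (ddd setT (line_measure lam) (line_measure m) u) ->
  generates (line_measure m) setT (F_i m lam) (E_i lam) u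
    (fun x => 2^-1 * ddd setT (line_measure lam) (line_measure m) u x).
Proof.
move=> hm hlam Fu du L2h.
have eT := @setT_exhausted R.
have dm := line_measure_diffuse hm; have dlam := line_measure_diffuse hlam.
have cm := line_measure_charging hm; have clam := line_measure_charging hlam.
split => [|//|v Fv]; first exact: L2Z.
have [L2u llu feu _] := Fu; have [L2v llv fev _] := Fv.
rewrite RintegralNl_mul// /E_i /energy.
have [mdu _] := ll_dd eT dlam clam llu; have [mdv _] := ll_dd eT dlam clam llv.
have iuv := integrable_sqr_mul measurableT mdu mdv
  (energy_integrable eT dlam clam llu feu) (energy_integrable eT dlam clam llv fev).
rewrite (Rintegral_line dlam iuv) (Rintegral_line dm (L2_integrable_mul measurableT L2h L2v)).
have green b := @green_halfline R b setT _ _ u v eT (@subsetT _ _) dlam dm clam cm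
  ((F_iE _ _ hlam).1 Fu) ((F_iE _ _ hlam).1 Fv) du L2h.
have := green true; have := green false; rewrite /orient.
by lra.
Qed.

Lemma line_generates m lam u f : scrM m -> scrM lam ->
  generates (line_measure m) setT (F_i m lam) (E_i lam) u f ->
  [/\ dd_ll setT (line_measure lam) (line_measure m) u,
    L2 (line_measure m) setT (ddd setT (line_measure lam) (line_measure m) u) &
    f = (fun x => 2^-1 * ddd setT (line_measure lam) (line_measure m) u x)
      %[ae line_measure m]].
Proof.
move=> hm hlam [L2f [_ llu _ _] gf].
apply: line_solution => //; [exact: line_measure_diffuse|exact: line_measure_diffuse
  |exact: line_measure_charging|exact: line_measure_charging|].
move=> v fv; have Fv := (F_iE m v hlam).2 fv; have [L2v _ _ _] := Fv.
rewrite -[LHS]/(E_i lam u v) gf// -[RHS]mulN1r -RintegralNl_mul//.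
by apply: eq_Rintegral => x _; rewrite mul1r.
Qed.

End Generators.

Theorem proposition4p5 (R : realType)
    (m lam : {measure set (bool * R) -> \bar R}) (kappa : R)
    (hm : scrM m) (hlam : scrM lam) (hkappa : 0 < kappa) :
  [/\
    (generator_dom m Gspace (F_X m lam) (E_X lam) =
       [set u | F_X m lam u /\
          forall b, [/\ dd_half_ll m lam b u,
             L2 (half_measure m b) (halfline b) (ddd_half m lam b u) &
             cdd_half m lam b u 0 = 0]] /\
     forall u f, generates m Gspace (F_X m lam) (E_X lam) u f ->
       forall b, restr b f = (fun x => 2^-1 * ddd_half m lam b u x)
         %[ae half_measure m b in halfline b]),
    (generator_dom m Gspace (F_s m lam) (E_s lam kappa) =
       [set u | F_s m lam u /\
          forall b, [/\ dd_half_ll m lam b u,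
             L2 (half_measure m b) (halfline b) (ddd_half m lam b u) &
             cdd_half m lam b u 0 =
               kappa / 2 * (u (zero_pt true) - u (zero_pt false))]] /\
     forall u f, generates m Gspace (F_s m lam) (E_s lam kappa) u f ->
       forall b, restr b f = (fun x => 2^-1 * ddd_half m lam b u x)
         %[ae half_measure m b in halfline b]) &
    (generator_dom (line_measure m) setT (F_i m lam) (E_i lam) =
       [set u | [/\ F_i m lam u,
          dd_ll setT (line_measure lam) (line_measure m) u &
          L2 (line_measure m) setT
             (ddd setT (line_measure lam) (line_measure m) u)]] /\
     forall u f,
       generates (line_measure m) setT (F_i m lam) (E_i lam) u f ->
       f = (fun x => 2^-1 * ddd setT (line_measure lam) (line_measure m) u x)
         %[ae line_measure m])].
Proof.
have interface (k : R) : generator_dom m Gspace (F_s m lam) (E_s lam k) =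
       [set u | F_s m lam u /\
          forall b, [/\ dd_half_ll m lam b u,
             L2 (half_measure m b) (halfline b) (ddd_half m lam b u) &
             cdd_half m lam b u 0 =
               k / 2 * (u (zero_pt true) - u (zero_pt false))]] /\
     forall u f, generates m Gspace (F_s m lam) (E_s lam k) u f ->
       forall b, restr b f = (fun x => 2^-1 * ddd_half m lam b u x)
         %[ae half_measure m b in halfline b].
  split.
    apply/seteqP; split => [u [f gf]|u [Fu condu]].
      split; first by case: gf.
      by move=> b; have [] := interface_generates hm hlam gf b.
    by eexists; exact: (interface_generator hm hlam Fu condu).
  by move=> u f gf b; have [] := interface_generates hm hlam gf b.
split => //; last split.
- have E0 : E_s lam 0 = E_X lam.
    by apply/funext => f; apply/funext => g; rewrite /E_s !mul0r addr0.
  have [dom gen] := interface 0; rewrite E0 in dom gen; split => //.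
  rewrite -[F_X m lam]/(F_s m lam) dom; apply/seteqP; split=> [u|u] [Fu H]; split => // b.
    by have [? ? ->] := H b; rewrite !mul0r.
  by have [? ? ->] := H b; rewrite !mul0r.
- apply/seteqP; split => [u [f gf]|u [Fu du L2u]].
    by have [? ? _] := line_generates hm hlam gf; have [_ ? _] := gf.
  by eexists; exact: line_generator.
- by move=> u f gf; have [] := line_generates hm hlam gf.
Qed.
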